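(* Let $\mathcal{A}_\imath$ be the algebra of (micro-local) differential invariants, with respect to $G_2$, of unparametrized integral curves of the rank 2 distribution $$\Pi=\langle \partial_x+p\,\partial_y+q\,\partial_p+q^2\,\partial_z,\ \partial_q\rangle$$ on $M=G_2/P_1$. Then $\mathcal{A}_\imath$ is generated in the Lie--Tresse sense by the differential invariant $$I_{10}=\frac{R_{10}^3}{R_8^7}$$ and the invariant derivation $$\Box_\imath=\frac{q_2}{R_8^{1/6}}\,\mathcal{D}_x ,$$ where $R_8$, $R_{10}$ and $\mathcal{D}_x$ are given by $$\begin{aligned}R_8 ={}& 196\,q_2^5q_8-2352\,q_2^4q_3q_7-5040\,q_2^4q_4q_6-3255\,q_2^4q_5^2+16632\,q_2^3q_3^2q_6+59598\,q_2^3q_3q_4q_5\\&+13772\,q_2^3q_4^3-83160\,q_2^2q_3^3q_5-174735\,q_2^2q_3^2q_4^2+297000\,q_2q_3^4q_4-118800\,q_3^6,\end{aligned}$$ $$R_{10} = 21\,q_2R_8\,\mathcal{D}_x\bigl(q_2\mathcal{D}_xR_8\bigr)-\frac{91}{4}\bigl(q_2\mathcal{D}_xR_8\bigr)^2+9R_8^2\bigl(13q_3^2-19q_2q_4\bigr),$$ $$\mathcal{D}_x=\partial_x+p\,\partial_y+q\,\partial_p+q^2\,\partial_z+\sum_{i=0}^\infty q_{i+1}\,\partial_{q_i}\qquad(q_0=q).$$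
   Context: $G_2$ is the split real form, $P_1$ its parabolic subgroup such that $M=G_2/P_1$ is the 5-dimensional homogeneous space carrying a $G_2$-invariant rank 2 distribution $\Pi$ of growth $(2,3,5)$. In an affine chart with coordinates $(x,y,p,q,z)$ the distribution is $\Pi=\langle \partial_x+p\partial_y+q\partial_p+q^2\partial_z,\partial_q\rangle$, and $\mathfrak g=\mathrm{Lie}(G_2)$ (dimension 14) acts as the Lie algebra of infinitesimal symmetries of $\Pi$. $J^k(M,1)$ is the space of $k$-jets of unparametrized regular curves in $M$. Curves transversal to $\{x=\mathrm{const}\}$ are written $y=y(x),p=p(x),q=q(x),z=z(x)$, giving jet coordinates $x,y,p,q,z,y_i,p_i,q_i,z_i$, $1\le i\le k$, where the index $i$ denotes the $i$-th derivative by $x$. Curves tangent to $\Pi$ (integral curves) are given by $y_1=p,\ p_1=q,\ z_1=q^2$; these equations with all differential consequences define $\mathcal{E}_\Pi\subset J^\infty(M,1)$, with coordinates $x,y,p,q,z,q_1,q_2,\dots$; $\mathcal{E}_\Pi^k\subset J^k(M,1)$ is its $k$-jet level. The action of $\mathfrak g$ on $M$ prolongs naturally to $\mathcal{E}_\Pi^k$ by vector fields $v^{(k)}$, $v\in\mathfrak g$. A micro-local differential invariant of order $\le k$ is a smooth function $I$ on an open (not necessarily invariant) subset of $\mathcal{E}_\Pi^k$ with $L_{v^{(k)}}I=0$ for all $v\in\mathfrak g$; statements about such invariants are understood near generic jets. An invariant derivation is $\Box=h\,\mathcal{D}_x$, with $h$ a function on (an open subset of) some $\mathcal{E}_\Pi^k$,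 commuting with all prolonged fields: $[v^{(\infty)},\Box]=0$ for all $v\in\mathfrak g$; it maps differential invariants to differential invariants. $R_8^{1/6}$ means a local branch of the root where $R_8\neq0$ (constant factors are irrelevant). Generation in the Lie--Tresse sense (micro-local version) means: near a generic jet every differential invariant is, locally, a function of finitely many of $I_{10},\Box_\imath I_{10},\Box_\imath^2 I_{10},\dots$. *)

(* Defs.v *)
From HB Require Import structures.
From mathcomp Require Import all_boot all_order all_algebra.
From mathcomp Require Import all_classical all_reals all_analysis.

Set Implicit Arguments.
Unset Strict Implicit.
Unset Printing Implicit Defensive.

Import Order.TTheory GRing.Theory Num.Theory.
Import numFieldNormedType.Exports.

Local Open Scope classical_set_scope.
Local Open Scope ring_scope.

(** Infinitely differentiable on [U] (meant for open [U]): every iterated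
    partial derivative is differentiable at every point of [U]. *)
Definition smooth (R : realType) (n : nat) (U : set 'rV[R]_n)
    (f : 'rV[R]_n -> R) : Prop :=
  forall (s : seq 'I_n) (a : 'rV[R]_n), U a ->
    differentiable (foldr (fun i g b => 'D_(delta_mx 0 i) g b) f s) a.

(** Coordinates are ordered as [x, y, p, z, q, q_1, q_2, ...], so that [q_i] is
    number [4 + i] (with [q_0 = q]).  The space [E k] of [k]-jets of integral
    curves is [R^(5+k)]; in particular [E R 0] is the chart of [M]. *)
Notation E R k := 'rV[R]_(5 + k).

(** The infinite jet space of integral curves. *)
Definition jet (R : realType) : Type := nat -> R.

Definition trunc (R : realType) (k : nat) (t : jet R) : E R k := \row_i t i.

Definition jq (R : realType) (i : nat) (t : jet R) : R := t (4 + i)%N.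

(** A possibly locally defined function of order at most [k]: on the jets lying
    over the open set [U] of [E k], [f] is the pull-back of a smooth function on
    [U].  The values of [f] on other jets are irrelevant. *)
Definition jet_function (R : realType) (k : nat) (U : set (E R k))
    (f : jet R -> R) : Prop :=
  open U /\
  exists2 g : E R k -> R, smooth U g &
    forall t : jet R, U (trunc k t) -> f t = g (trunc k t).

Definition pd (R : realType) (j : nat) (f : jet R -> R) : jet R -> R :=
  fun t => derive1 (fun s : R => f [eta t with j |-> s]) (t j).

(** The derivation [sum_j X_j d/d(coordinate j)].  The sum has finitely many
    nonzero terms at a jet near which [f] has finite order. *)
Definition lie (R : realType) (X : nat -> jet R -> R) (f : jet R -> R) :
    jet R -> R :=
  fun t => limn (series (fun j => X j t * pd j f t)).

Definition total_field (R : realType) (j : nat) (t : jet R) : R :=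
  match j with
  | 0 => 1
  | 1 => t 2%N
  | 2 => jq 0 t
  | 3 => jq 0 t ^+ 2
  | i.+4 => jq i.+1 t
  end.

Definition Dx (R : realType) (f : jet R -> R) : jet R -> R :=
  lie (@total_field R) f.

(** The frame [d_x + p d_y + q d_p + q^2 d_z], [d_q] of the distribution. *)
Definition Pi1 (R : realType) (m : E R 0) : E R 0 :=
  let p := m 0 (inord 2) in
  let q := m 0 (inord 4) in
  \row_(j < 5) [:: 1; p; q; q ^+ 2; 0]`_j.

Definition Pi2 (R : realType) (m : E R 0) : E R 0 := delta_mx 0 (inord 4).

Definition in_Pi (R : realType) (m w : E R 0) : Prop :=
  exists a b : R, w = a *: Pi1 m + b *: Pi2 m.

Definition bracket (R : realType) (v w : E R 0 -> E R 0) : E R 0 -> E R 0 :=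
  fun m => 'D_(v m) w m - 'D_(w m) v m.

(** The Lie algebra of [G_2], as the algebra of infinitesimal symmetries of the
    distribution: vector fields [v] with [[v, Pi] \subset Pi]. *)
Definition symmetry (R : realType) (v : E R 0 -> E R 0) : Prop :=
  (forall j : 'I_5, smooth setT (fun m => v m 0 j)) /\
  (forall m : E R 0, in_Pi m (bracket v (@Pi1 R) m) /\
                     in_Pi m (bracket v (@Pi2 R) m)).

Definition base_coef (R : realType) (v : E R 0 -> E R 0) (j : nat) :
    jet R -> R := fun t => v (trunc 0 t) 0 (inord j).

(** Standard prolongation formula: with [a] the [d_x]-component of [v], the
    [d_{q_{i+1}}]-component is [eta_{i+1} = Dx eta_i - q_{i+1} Dx a]; that is,
    [eta_i = Dx^i (eta_0 - a q_1) + a q_{i+1}].  It is the restriction of the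
    prolongation of [v] to the jets of integral curves, where [Dx] restricts the
    total derivative. *)
Fixpoint eta (R : realType) (v : E R 0 -> E R 0) (i : nat) : jet R -> R :=
  match i with
  | 0 => base_coef v 4
  | i'.+1 => fun t => Dx (eta v i') t - jq i'.+1 t * Dx (base_coef v 0) t
  end.

Definition prolong (R : realType) (v : E R 0 -> E R 0) (j : nat) :
    jet R -> R :=
  if j is i.+4 then eta v i else base_coef v j.

Definition diff_invariant (R : realType) (k : nat) (U : set (E R k))
    (I : jet R -> R) : Prop :=
  jet_function U I /\
  forall v : E R 0 -> E R 0, symmetry v ->
    forall t : jet R, U (trunc k t) -> lie (prolong v) I t = 0.

(** The derivation [h Dx]. *)
Definition derivation (R : realType) (h f : jet R -> R) : jet R -> R :=
  fun t => h t * Dx f t.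

(** [h Dx] commutes with all prolonged symmetries, as an operator on the smooth
    functions of arbitrary finite order. *)
Definition invariant_derivation (R : realType) (k : nat) (U : set (E R k))
    (h : jet R -> R) : Prop :=
  jet_function U h /\
  forall v : E R 0 -> E R 0, symmetry v ->
    forall (l : nat) (W : set (E R l)) (f : jet R -> R), jet_function W f ->
      forall t : jet R, U (trunc k t) -> W (trunc l t) ->
        lie (prolong v) (derivation h f) t = derivation h (lie (prolong v) f) t.

Definition iterates (R : realType) (h f : jet R -> R) (n : nat) (t : jet R) :
    'rV[R]_n := \row_(i < n) iter i (derivation h) f t.

(** Micro-local Lie-Tresse generation by the function [f] and the derivation
    [h Dx], both defined on [D].  Generic jets are those over an open dense set
    [G] in some [E k0]; near such a jet, every invariant is a smooth function
    [F] of the first [n] iterated derivatives of [f]. *)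
Definition Lie_Tresse_generated (R : realType) (D : set (jet R))
    (f h : jet R -> R) : Prop :=
  exists (k0 : nat) (G : set (E R k0)),
    [/\ open G, dense G &
      forall (k : nat) (U : set (E R k)) (I : jet R -> R) (t : jet R),
        diff_invariant U I -> U (trunc k t) -> G (trunc k0 t) ->
        exists (n l : nat) (V : set (E R l)) (W : set 'rV[R]_n)
               (F : 'rV[R]_n -> R),
          [/\ open V, V (trunc l t), open W, smooth W F &
            forall t' : jet R, V (trunc l t') ->
              [/\ U (trunc k t'), D t', W (iterates h f n t') &
                  I t' = F (iterates h f n t')]]].

Definition R8 (R : realType) (t : jet R) : R :=
  let q2 := jq 2 t in let q3 := jq 3 t in let q4 := jq 4 t in
  let q5 := jq 5 t in let q6 := jq 6 t in let q7 := jq 7 t in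
  let q8 := jq 8 t in
  196%N%:R * q2 ^+ 5 * q8 - 2352%N%:R * q2 ^+ 4 * q3 * q7
  - 5040%N%:R * q2 ^+ 4 * q4 * q6 - 3255%N%:R * q2 ^+ 4 * q5 ^+ 2
  + 16632%N%:R * q2 ^+ 3 * q3 ^+ 2 * q6
  + 59598%N%:R * q2 ^+ 3 * q3 * q4 * q5 + 13772%N%:R * q2 ^+ 3 * q4 ^+ 3
  - 83160%N%:R * q2 ^+ 2 * q3 ^+ 3 * q5
  - 174735%N%:R * q2 ^+ 2 * q3 ^+ 2 * q4 ^+ 2
  + 297000%N%:R * q2 * q3 ^+ 4 * q4 - 118800%N%:R * q3 ^+ 6.

Definition R10 (R : realType) (t : jet R) : R :=
  let q2 := jq 2 t in let q3 := jq 3 t in let q4 := jq 4 t in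
  let DR8 := derivation (jq 2) (@R8 R) in
  21 * q2 * R8 t * Dx DR8 t - 91 / 4 * DR8 t ^+ 2
  + 9 * R8 t ^+ 2 * (13 * q3 ^+ 2 - 19 * q2 * q4).

Definition I10 (R : realType) (t : jet R) : R := R10 t ^+ 3 / R8 t ^+ 7.

(** The coefficient [q_2 / R8^(1/6)], with [`|R8|^(1/6)] as the real branch of
    the root, up to a constant factor, on each of [R8 > 0] and [R8 < 0]. *)
Definition box_coef (R : realType) (t : jet R) : R :=
  jq 2 t / (`|R8 t| `^ (6^-1)).

Definition regular (R : realType) : set (jet R) := [set t | R8 t != 0].

(* Main.v *)
From HB Require Import structures.
Require Import Defs.
From mathcomp Require Import all_boot all_order all_algebra.
From mathcomp Require Import all_classical all_reals all_analysis.
From mathcomp Require Import ring lra.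
Set Implicit Arguments.
Unset Strict Implicit.
Unset Printing Implicit Defensive.
Import Order.TTheory GRing.Theory Num.Theory.
Import numFieldNormedType.Exports.
Local Open Scope classical_set_scope.
Local Open Scope ring_scope.

(** The proof has three parts: infinitesimal invariance is a polynomial identity
    once the symmetries are understood, the symmetries act locally transitively on
    generic jets of order 9, and the iterated derivatives of [I10] are coordinates
    on the jets above those.

    Symmetries.  Put [f = v^y - p v^x] for a symmetry [v].  The condition [[v, Pi]
    \subset Pi] forces [f] to be a function of [x, y, p, z], and [v] to be given by
    [f] and a second such function [g] ([sym_potentials]).  The equations for [f]
    and [g] are overdetermined.  Their differential consequences
    ([structure_functions_exist]) give eight functions [al, al1, be, a, a1, .., a4]
    whose total derivatives are explicit combinations of themselves, and such that
    [eta_2 = (be - 5 al) q_2]; here [Dx v^x = 2 al].  Hence every further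
    coefficient [eta_i] of the prolongation is explicit, and substitution shows that
    [v] multiplies [R8] by [6 be - 42 al] and [R10] by [14 be - 98 al] ([v_R8],
    [v_R10]).  The factors cancel in [R10^3 / R8^7].  As [v] multiplies [q_2] by [be
    - 5 al], and its bracket with [Dx] is [- 2 al Dx], they also cancel in [(q_2 /
    R8^(1/6)) Dx] ([symmetry_weights]).

    Transitivity.  Conversely there is an explicit family of potentials with 14
    parameters.  At a jet the parameters correspond to the first six components of
    the prolonged field together with the values of the eight functions
    ([realize_structure_functions]).  If [q_2] and [R8] do not vanish, the
    components up to [q_9] can then be prescribed as well ([symmetry_through]):
    those of [q_2, .., q_7] and the derivatives of [R8] and [Dx R8] along the field
    form a triangular system for the eight values, and these two derivatives
    determine the components of [q_8] and [q_9].

    Generation.  The [i]-th iterate has order [10 + i], and at a generic jet its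
    derivative in [q_(10+i)] is nonzero ([pd_top_iterate]).  The iterates after
    [I10] are affine in the highest coordinate, and [I10] is there the cube of an
    affine function up to a factor of lower order, so the iterates can be taken as
    coordinates instead of the [q_(10+i)], with an explicit smooth inverse
    ([local_inverse]).  Let [Y] be a coordinate field of the new coordinates that
    kills the iterates.  Some prolonged symmetry agrees with [Y] up to [q_9]; it
    kills the iterates too, so it agrees with [Y] in the following components, and
    [Y] kills every invariant ([lie_invariant_eq0]).  An invariant is therefore a
    function of the iterates alone ([near_independent]). *)

(** * Functions of class C^k on R^n *)

Section NearDiff.
Context {R : realType} {V W : normedModType R}.
Implicit Types (f g : V -> W) (a : V).

(** The zero map satisfies the defining expansion of the differential, which is
    unique. *)
Lemma near0_differentiable f a : (\near a, f a = 0) -> differentiable f a.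
Proof.
move=> f0; have fa0 : f a = 0 by exact: (nbhs_singleton f0).
have E : f \o shift a = cst (f a) + (\0 : {linear V -> W}) +o_ (0 : V) id.
  apply/eqaddoP => e e0; near=> h.
  rewrite fctE /= fa0.
  have -> : f (h + a) = 0.
    near: h.
    have := f0; rewrite (near_shift 0 a) /= => f0'.
    by apply: filterS f0' => h; rewrite /= subr0.
  rewrite /cst /= !fctE /= addr0 subrr normr0 mulr_ge0 //.
  exact: ltW.
have C : continuous (\0 : {linear V -> W}) by move=> x; exact: cst_continuous.
have dE := diff_unique C E.
by apply/diff_locallyP; rewrite dE; split.
Unshelve. all: by end_near. Qed.

Lemma near_eq_differentiable f g a :
  (\near a, f a = g a) -> differentiable f a -> differentiable g a.
Proof.
move=> fg df.
have -> : g = f + (g - f) by apply/funext => x; rewrite !fctE addrC subrK.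
apply: differentiableD => //; apply: near0_differentiable.
by apply: filterS fg => x fgx; rewrite !fctE fgx subrr.
Qed.

End NearDiff.

Section Ck.
Context {R : realType}.

(** [smooth] quantifies over all words of partial derivatives; the finite levels
    make the closure properties provable by induction. *)
Fixpoint Ck n (k : nat) (U : set 'rV[R]_n) (f : 'rV[R]_n -> R) : Prop :=
  (forall a, U a -> differentiable f a) /\
  (if k is k'.+1 then
     forall i : 'I_n, Ck k' U (fun b => 'D_(delta_mx 0 i) f b)
   else True).

Lemma smooth_Ck n (U : set 'rV[R]_n) f : smooth U f <-> forall k, Ck k U f.
Proof.
split=> [sf k|cf s].
  suff : forall s : seq 'I_n, Ck k U
     (foldr (fun i g b => 'D_(delta_mx 0 i) g b) f s) by move=> /(_ [::]).
  elim: k => [|k IH] s; split=> //.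
  - by move=> a Ua; exact: sf.
  - by move=> a Ua; exact: sf.
  - by move=> i; exact: (IH (i :: s)).
suff : forall k, Ck k U (foldr (fun i g b => 'D_(delta_mx 0 i) g b) f s).
  by move=> /(_ 0%N)[].
elim/last_ind: s f cf => [|s i IH] f cf; first exact: cf.
rewrite foldr_rcons; apply: IH => k; exact: (cf k.+1).2.
Qed.

Lemma smoothCk n (U : set 'rV[R]_n) f k : smooth U f -> Ck k U f.
Proof. by move=> /smooth_Ck. Qed.

Lemma Ck_pred n k (U : set 'rV[R]_n) f : Ck k.+1 U f -> Ck k U f.
Proof.
elim: k f => [|k IH] f [] H1 H2; split=> //.
by move=> i; apply: IH; exact: H2.
Qed.

Lemma Ck_eq n k (U : set 'rV[R]_n) f g : open U ->
  (forall a, U a -> f a = g a) -> Ck k U f -> Ck k U g.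
Proof.
move=> oU; elim: k f g => [|k IH] f g fg [] H1 H2.
  split=> // a Ua; apply: near_eq_differentiable (H1 a Ua).
  by near=> b; apply: fg; near: b; exact: open_nbhs_nbhs.
split=> [a Ua|i].
  apply: near_eq_differentiable (H1 a Ua).
  by near=> b; apply: fg; near: b; exact: open_nbhs_nbhs.
apply: IH (H2 i) => a Ua; apply: near_eq_derive.
by near=> b; apply: fg; near: b; exact: open_nbhs_nbhs.
Unshelve. all: by end_near. Qed.

Lemma Ck_ext n k (U : set 'rV[R]_n) f g : f =1 g -> Ck k U f -> Ck k U g.
Proof. by move=> /funext ->. Qed.

Lemma Ck_cst n k (U : set 'rV[R]_n) c : Ck k U (fun=> c).
Proof.
elim: k c => [|k IH] c; split=> //; try (by move=> a _; exact: differentiable_cst).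
by move=> i; apply: Ck_ext (IH 0) => b; rewrite derive_cst.
Qed.

Lemma derive_coord n (i j : 'I_n) (b : 'rV[R]_n) :
  'D_(delta_mx 0 i) (fun a : 'rV[R]_n => a 0 j : R) b = (i == j)%:R.
Proof.
rewrite deriveE; last exact: differentiable_coord.
have coord_lin : linear (fun a : 'rV[R]_n => a 0 j : R^o).
  by move=> c u v; rewrite !mxE.
pose L : {linear 'rV[R]_n -> R^o} := HB.pack (fun a : 'rV[R]_n => a 0 j : R^o)
   (GRing.isLinear.Build _ _ _ _ _ coord_lin).
rewrite (_ : (fun a : 'rV[R]_n => _) = L) // diff_lin.
  by rewrite /L /= mxE eqxx /= eq_sym.
by move=> x; exact: coord_continuous.
Qed.

Lemma Ck_coord n k (U : set 'rV[R]_n) j : Ck k U (fun a => a 0 j).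
Proof.
case: k => [|k]; split=> //; try by move=> a _; exact: differentiable_coord.
by move=> i; apply: Ck_ext (Ck_cst _ _ (i == j)%:R) => b; rewrite derive_coord.
Qed.

Lemma CkD n k (U : set 'rV[R]_n) f g : open U ->
  Ck k U f -> Ck k U g -> Ck k U (fun a => f a + g a).
Proof.
move=> oU; elim: k f g => [|k IH] f g [] f1 f2 [] g1 g2; split=> //;
  try by move=> a Ua; apply: differentiableD; [exact: f1|exact: g1].
move=> i; apply: Ck_eq (IH _ _ (f2 i) (g2 i)) => // a Ua.
by rewrite deriveD //; apply: diff_derivable; [exact: f1|exact: g1].
Qed.

Lemma CkM n k (U : set 'rV[R]_n) f g : open U ->
  Ck k U f -> Ck k U g -> Ck k U (fun a => f a * g a).
Proof.
move=> oU; elim: k f g => [|k IH] f g Hf Hg.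
  by split=> // a Ua; apply: differentiableM; [exact: Hf.1|exact: Hg.1].
split; first by move=> a Ua; apply: differentiableM; [exact: Hf.1|exact: Hg.1].
move=> i; apply: Ck_eq (CkD oU (IH _ _ (Ck_pred Hf) (Hg.2 i))
   (IH _ _ (Ck_pred Hg) (Hf.2 i))) => // a Ua.
by rewrite deriveM //; apply: diff_derivable; [exact: Hf.1|exact: Hg.1].
Qed.

Lemma Ck_sum n k (U : set 'rV[R]_n) (I : Type) (r : seq I) (F : I -> 'rV[R]_n -> R) :
  open U -> (forall i, Ck k U (F i)) -> Ck k U (fun a => \sum_(i <- r) F i a).
Proof.
move=> oU HF; elim: r => [|i r IH].
  by apply: Ck_ext (Ck_cst k U 0) => a; rewrite big_nil.
by apply: Ck_ext (CkD oU (HF i) IH) => a; rewrite big_cons.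
Qed.

Lemma CkV n k (U : set 'rV[R]_n) f : open U -> (forall a, U a -> f a != 0) ->
  Ck k U f -> Ck k U (fun a => (f a)^-1).
Proof.
move=> oU f0; elim: k => [|k IH] Hf.
  by split=> // a Ua; apply: differentiableV; [exact: Hf.1|exact: f0].
split; first by move=> a Ua; apply: differentiableV; [exact: Hf.1|exact: f0].
move=> i; have HV := IH (Ck_pred Hf).
apply: Ck_eq (CkM oU (CkM oU (Ck_cst k U (-1)) (CkM oU HV HV)) (Hf.2 i)) => // a Ua.
rewrite deriveV; [|exact: f0|by apply: diff_derivable; exact: Hf.1].
by rewrite mulN1r -invfM -expr2.
Qed.

Lemma derive_comp1 (V : normedModType R) (f : V -> R) (phi : R -> R) (a v : V) :
  differentiable f a -> derivable phi (f a) 1 ->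
  'D_v (phi \o f) a = 'D_1 phi (f a) * 'D_v f a.
Proof.
move=> df /derivable1_diffP dphi; rewrite deriveE; last exact: differentiable_comp.
rewrite diff_comp //= !deriveE // mulrC -[in LHS](mulr1 ('d f a v)).
exact: linearZ.
Qed.

Lemma is_derive_absr (y : R) : y != 0 -> is_derive y 1 (@Num.norm R R) (Num.sg y).
Proof.
move=> y0; case: (ltgtP y 0) y0 => // y0 _.
  rewrite ltr0_sg //; apply: (@near_eq_is_derive _ _ _ -%R).
  by near=> z; rewrite ltr0_norm //; near: z; exact: lt_nbhsl.
rewrite gtr0_sg //; apply: (@near_eq_is_derive _ _ _ id).
by near=> z; rewrite gtr0_norm //; near: z; exact: lt_nbhsr.
Unshelve. all: by end_near. Qed.

Lemma is_derive_abs_powR (r y : R) : y != 0 ->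
  is_derive y 1 (fun z => `|z| `^ r) (r * `|y| `^ r / y).
Proof.
move=> y0; have y1 : 0 < `|y| by rewrite normr_gt0.
have := is_derive1_comp (is_derive1_powR r y1) (is_derive_absr y0).
rewrite /comp; set d := (X in is_derive _ _ _ X -> _).
suff -> : d = r * `|y| `^ r / y by [].
rewrite /d powRB; last by rewrite (gt_eqF y1) implybT.
rewrite powRr1 ?ltW //.
rewrite -!mulrA; congr (_ * (_ * _)).
case: (ltgtP y 0) y0 => // yl _.
  by rewrite ltr0_sg // ltr0_norm // invrN mulrNN mulr1.
by rewrite gtr0_sg // gtr0_norm // mulr1.
Qed.

(** The derivative of [`|z| `^ r] is [r * `|z| `^ r / z], a product to which the
    induction hypothesis applies. *)
Lemma Ck_abs_powR n k (U : set 'rV[R]_n) f r : open U ->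
  (forall a, U a -> f a != 0) ->
  Ck k U f -> Ck k U (fun a => `|f a| `^ r).
Proof.
move=> oU f0.
have d0 (a : 'rV[R]_n) : Ck 0 U f -> U a -> differentiable (fun a => `|f a| `^ r) a.
  move=> Hf Ua; have [H _] := is_derive_abs_powR r (f0 a Ua).
  apply: (@differentiable_comp _ _ _ _ f (fun z => `|z| `^ r)); first exact: Hf.1.
  exact/derivable1_diffP.
elim: k => [|k IH] Hf; first by split=> // a Ua; exact: d0.
split; first by move=> a Ua; apply: d0 => //; split=> //; exact: Hf.1.
move=> i; have HP := IH (Ck_pred Hf).
have HV := CkV oU f0 (Ck_pred Hf).
apply: Ck_eq (CkM oU (CkM oU (CkM oU (Ck_cst k U r) HP) HV) (Hf.2 i)) => // a Ua.
have [H1 H2] := is_derive_abs_powR r (f0 a Ua).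
rewrite (@derive_comp1 _ f (fun z => `|z| `^ r)) //; last exact: Hf.1.
by rewrite H2.
Qed.

Lemma row_basis n (u : 'rV[R]_n) : u = \sum_j u 0 j *: delta_mx 0 j.
Proof. by rewrite [LHS]matrix_sum_delta big_ord1. Qed.

Lemma derive_row n (g : 'rV[R]_n -> R) b (u : 'rV[R]_n) : differentiable g b ->
  'D_u g b = \sum_j u 0 j * 'D_(delta_mx 0 j) g b.
Proof.
move=> dg; rewrite deriveE // {1}(row_basis u) linear_sum.
by apply: eq_bigr => j _; rewrite linearZ /= deriveE.
Qed.

Lemma differentiable_row m n (Psi : 'I_n -> 'rV[R]_m -> R) a :
  (forall j, differentiable (Psi j) a) ->
  differentiable (fun a => \row_j Psi j a) a.
Proof.
move=> H; rewrite (_ : (fun a => _) =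
  \sum_j (fun a => Psi j a *: (delta_mx 0 j : 'rV[R]_n))).
  by apply: differentiable_sum => j; exact: differentiableZl.
apply/funext => b; rewrite fct_sumE [LHS]row_basis.
by apply: eq_bigr => j _; rewrite mxE.
Qed.

Lemma derive_comp_row m n (g : 'rV[R]_n -> R) (Psi : 'I_n -> 'rV[R]_m -> R) a v :
  (forall j, differentiable (Psi j) a) ->
  differentiable g (\row_j Psi j a) ->
  'D_v (fun a => g (\row_j Psi j a)) a =
  \sum_j 'D_v (Psi j) a * 'D_(delta_mx 0 j) g (\row_j Psi j a).
Proof.
move=> dP dg; have dr := differentiable_row dP.
rewrite deriveE; last exact: (@differentiable_comp _ _ _ _ (fun a => \row_j Psi j a) g).
rewrite (@diff_comp _ _ _ _ (fun a => \row_j Psi j a) g) //= -deriveE //.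
rewrite -(deriveE _ dr) derive_row //; apply: eq_bigr => j _.
rewrite derive_mx; last exact: diff_derivable.
rewrite mxE (_ : (fun t => _) = Psi j) //.
by apply/funext => b; rewrite mxE.
Qed.

Lemma Ck_comp m n k (U : set 'rV[R]_m) (V : set 'rV[R]_n) g
    (Psi : 'I_n -> 'rV[R]_m -> R) : open U ->
  (forall a, U a -> V (\row_j Psi j a)) ->
  Ck k V g -> (forall j, Ck k U (Psi j)) -> Ck k U (fun a => g (\row_j Psi j a)).
Proof.
move=> oU UV.
have d0 g' (a : 'rV[R]_m) : Ck 0 V g' -> (forall j, Ck 0 U (Psi j)) -> U a ->
    differentiable (fun a => g' (\row_j Psi j a)) a.
  move=> Hg HP Ua.
  apply: (@differentiable_comp _ _ _ _ (fun a => \row_j Psi j a) g').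
    by apply: differentiable_row => j; exact: (HP j).1.
  by apply: Hg.1; exact: UV.
elim: k g => [|k IH] g Hg HP; first by split=> // a Ua; exact: d0.
split.
  move=> a Ua; apply: d0 => //; first by split=> //; exact: Hg.1.
  by move=> j; split=> //; exact: (HP j).1.
move=> i.
have HP' j := Ck_pred (HP j).
apply: Ck_eq (Ck_sum _ oU (fun j => CkM oU ((HP j).2 i) (IH _ (Hg.2 j) HP'))) => // a Ua.
rewrite derive_comp_row //; first by move=> j; exact: (HP j).1.
by apply: Hg.1; exact: UV.
Qed.

End Ck.

(** * Symmetry of second derivatives *)

Section Schwarz.
Context {R : realType} {V : normedModType R}.
Implicit Types (f : V -> R) (a u v : V).

Lemma derive_line f a u (s : R) : derivable f (a + s *: u) u ->
  is_derive s 1 (fun s => f (a + s *: u)) ('D_u f (a + s *: u)).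
Proof.
move=> df.
have E : (fun h : R => h^-1 *: ((fun s => f (a + s *: u)) (h *: 1 + s) -
             f (a + s *: u))) =
         (fun h : R => h^-1 *: (f (h *: u + (a + s *: u)) - f (a + s *: u))).
  apply/funext => h; congr (_ *: (f _ - _)).
  by rewrite [h *: 1](mulr1) scalerDl addrCA.
by split; rewrite /derivable /derive /= E.
Qed.

(** The mixed second difference is [h] times an increment of ['D_u f], by the mean
    value theorem in the direction [u]; differentiability of ['D_u f] at the single
    point [a] estimates that increment. *)
Lemma second_difference f a u v (e : R) : 0 < e ->
  (\near a, differentiable f a) -> differentiable ('D_u f) a ->
  exists2 r : R, 0 < r & forall h, 0 < h < r ->
    `|f (a + h *: v + h *: u) - f (a + h *: u) - f (a + h *: v) + f a
       - h ^+ 2 * 'D_v ('D_u f) a| <= e * h ^+ 2.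
Proof.
move=> e0 df dG; set G := 'D_u f.
pose M := `|u| + `|v| + `|u| + 1.
have M0 : 0 < M by rewrite ltr_wpDl // !addr_ge0.
have e'0 : 0 < e / M by rewrite divr_gt0.
have [r r0 Hr] : exists2 r : R, 0 < r & forall w, `|w| < r ->
    differentiable f (a + w) /\ `|G (a + w) - G a - 'd G a w| <= e / M * `|w|.
  have N1 : \forall w \near (0 : V), differentiable f (a + w).
    have := df; rewrite (near_shift 0 a) /= => N.
    by apply: filterS N => w /=; rewrite subr0 addrC.
  have N2 : \forall w \near (0 : V),
      `|G (a + w) - G a - 'd G a w| <= e / M * `|w|.
    have /diff_locally E := dG.
    have := @eqaddoP _ _ _ _ (nbhs (0 : V)) (G \o shift a) (cst (G a) + 'd G a) id.
    move=> [H _]; have {H} := H E _ e'0.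
    by apply: filterS => w; rewrite !fctE /= opprD addrA [w + a]addrC.
  have /nbhs_ballP[r /= r0 Hr] : \forall w \near (0 : V),
      differentiable f (a + w) /\ `|G (a + w) - G a - 'd G a w| <= e / M * `|w|.
    by near do split.
  exists r => // w wr; apply: Hr; rewrite -ball_normE /=.
  by rewrite sub0r normrN.
exists (r / M); first by rewrite divr_gt0.
move=> h /andP[h0 hr].
have hM : h * M < r by rewrite -ltr_pdivlMr.
have small (s t : R) : 0 <= s <= h -> 0 <= t <= h ->
    `|t *: v + s *: u| <= h * (`|u| + `|v|).
  move=> /andP[s0 sh] /andP[t0 th].
  rewrite (le_trans (ler_normD _ _)) // !normrZ !ger0_norm // mulrDr addrC.
  by rewrite lerD // ler_wpM2r.
have small' (s t : R) : 0 <= s <= h -> 0 <= t <= h -> `|t *: v + s *: u| < r.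
  move=> sh th; apply: le_lt_trans (small s t sh th) (le_lt_trans _ hM).
  by rewrite ler_pM2l // /M -!addrA lerD2l lerDl addr_ge0.
pose g s := f (a + h *: v + s *: u) - f (a + s *: u).
have hh : 0 <= h <= h by rewrite (ltW h0) lexx.
have h00 : 0 <= (0:R) <= h by rewrite (ltW h0) lexx.
have dg (s : R) : 0 <= s <= h ->
    is_derive s 1 g (G (a + h *: v + s *: u) - G (a + s *: u)).
  move=> sh; apply: is_deriveB.
    apply: derive_line; apply: diff_derivable; rewrite -addrA.
    by apply: (Hr _ _).1; exact: small'.
  apply: derive_line; apply: diff_derivable.
  by apply: (Hr _ _).1; have := small' s 0 sh h00; rewrite scale0r add0r.
pose dgf s := G (a + h *: v + s *: u) - G (a + s *: u).
have [||x xh] := @MVT R g dgf 0 h h0.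
- move=> x; rewrite in_itv /= => /andP[x0 xh]; apply: dg.
  by rewrite !ltW.
- apply: derivable_within_continuous => x; rewrite in_itv /= => xh.
  by have [] := dg x xh.
move: xh; rewrite in_itv /= => /andP[x0 xh].
have xx : 0 <= x <= h by rewrite !ltW.
rewrite /g !scale0r !addr0 subr0 => E.
have -> : f (a + h *: v + h *: u) - f (a + h *: u) - f (a + h *: v) + f a =
  f (a + h *: v + h *: u) - f (a + h *: u) - (f (a + h *: v) - f a) by ring.
rewrite E /dgf (deriveE _ dG).
have [_ H1] := Hr _ (small' x h xx hh).
have [_ H2] := Hr _ (small' x 0 xx h00).
have dl : 'd G a (h *: v + x *: u) - 'd G a (x *: u) = h * 'd G a v.
  by rewrite linearD linearZ /= addrK.
rewrite addrA in H1; rewrite scale0r add0r in H2.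
have {H1}H1 := le_trans H1 (ler_wpM2l (ltW e'0) (small x h xx hh)).
have small2 : `|x *: u| <= h * `|u| by rewrite normrZ gtr0_norm // ler_wpM2r // ltW.
have {H2}H2 := le_trans H2 (ler_wpM2l (ltW e'0) small2).
set g1 := G _ in H1 *; set g2 := G _ in H2 *.
rewrite -/G.
have -> : (g1 - g2) * h - h ^+ 2 * 'd G a v =
  h * ((g1 - G a - 'd G a (h *: v + x *: u)) - (g2 - G a - 'd G a (x *: u))).
  rewrite expr2 -mulrA -dl.
  ring.
rewrite normrM gtr0_norm // expr2 mulrCA ler_pM2l //.
apply: (le_trans (ler_normB _ _)); apply: (le_trans (lerD H1 H2)).
rewrite -mulrDr -mulrDr mulrCA [leRHS]mulrC ler_pM2l //.
rewrite mulrAC ler_pdivrMr // ler_pM2l // /M.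
by rewrite lerDl.
Unshelve. all: by end_near. Qed.

(** The second difference is symmetric in [u] and [v]. *)
Lemma schwarz f a u v : (\near a, differentiable f a) ->
  differentiable ('D_u f) a -> differentiable ('D_v f) a ->
  'D_v ('D_u f) a = 'D_u ('D_v f) a.
Proof.
move=> df du dv; apply/eqP; rewrite -subr_eq0 -normr_le0; apply/ler_addgt0Pl => e e0.
rewrite addr0.
have e2 : 0 < e / 2 by rewrite divr_gt0.
have [r1 r10 H1] := second_difference v e2 df du.
have [r2 r20 H2] := second_difference u e2 df dv.
pose h := Num.min r1 r2 / 2.
have m0 : 0 < Num.min r1 r2 by rewrite lt_min r10.
have h0 : 0 < h by rewrite divr_gt0.
have hm : h < Num.min r1 r2 by rewrite /h ltr_pdivrMr // ltr_pMr // ltr1n.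
have /H1 {}H1 : 0 < h < r1 by rewrite h0 (lt_le_trans hm) // ge_min lexx.
have /H2 {}H2 : 0 < h < r2 by rewrite h0 (lt_le_trans hm) // ge_min lexx orbT.
have h20 : 0 < h ^+ 2 by rewrite exprn_gt0.
rewrite -(ler_pM2l h20) -[X in X * `|_|](gtr0_norm h20) -normrM.
set A := f (a + _ + _) in H1; rewrite [a + h *: u + _]addrAC -/A in H2.
move: ('D_v ('D_u f) a) ('D_u ('D_v f) a) H1 H2 => x y H1 H2.
have -> : h ^+ 2 * (x - y) =
  (A - f (a + h *: v) - f (a + h *: u) + f a - h ^+ 2 * y) -
  (A - f (a + h *: u) - f (a + h *: v) + f a - h ^+ 2 * x) by ring.
apply: (le_trans (ler_normB _ _)); apply: (le_trans (lerD H2 H1)).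
by rewrite -mulrDl -splitr mulrC.
Qed.

End Schwarz.

(** * Functions of finite order near a jet *)

Section Jets.
Context {R : realType}.
Implicit Types (t s : jet R) (f g : jet R -> R).

Definition upd t (j : nat) (x : R) : jet R := [eta t with j |-> x].

Lemma updE t j x i : upd t j x i = if i == j then x else t i.
Proof. by []. Qed.

Lemma upd_id t j : upd t j (t j) = t.
Proof. by apply/funext => i; rewrite updE; case: eqP => [->|]. Qed.

(** The filter of the conditions that hold on a cylinder over an open set of jets of
    some finite order. *)
Definition jnbhs t : set (set (jet R)) :=
  fun P => exists k (U : set (E R k)),
    [/\ open U, U (trunc k t) & forall t', U (trunc k t') -> P t'].

(** Smoothness of finite order near [t]: the order and the domain are not fixed, so
    that the property is stable under every operation used below. *)
Definition jsm t f := exists k (U : set (E R k)), jet_function U f /\ U (trunc k t).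

Definition proj k l (kl : (k <= l)%N) (a : E R l) : E R k :=
  \row_j a 0 (widen_ord (leq_add (leqnn 5) kl) j).

Lemma proj_trunc k l (kl : (k <= l)%N) t : proj kl (trunc l t) = trunc k t.
Proof. by apply/rowP => j; rewrite !mxE. Qed.

Lemma proj_continuous k l (kl : (k <= l)%N) : continuous (proj kl).
Proof.
move=> a; apply: differentiable_continuous.
by apply: differentiable_row => j; exact: differentiable_coord.
Qed.

Lemma open_preim_proj k l (kl : (k <= l)%N) (U : set (E R k)) : open U ->
  open (proj kl @^-1` U).
Proof. by move=> oU; apply: open_comp => // a _; exact: proj_continuous. Qed.

Lemma smooth_sub n (U V : set 'rV[R]_n) (f : 'rV[R]_n -> R) : V `<=` U -> smooth U f -> smooth V f.
Proof. by move=> VU sf s a /VU; exact: sf. Qed.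

Lemma jet_functionW k (U V : set (E R k)) f : open V -> V `<=` U ->
  jet_function U f -> jet_function V f.
Proof.
move=> oV VU [oU [g sg fg]]; split=> //; exists g; first exact: smooth_sub sg.
by move=> t /VU; exact: fg.
Qed.

Lemma jet_function_raise k l (kl : (k <= l)%N) (U : set (E R k)) f :
  jet_function U f -> jet_function (proj kl @^-1` U) f.
Proof.
move=> [oU [g sg fg]]; split; first exact: open_preim_proj.
exists (fun a => g (proj kl a)); last first.
  by move=> t /=; rewrite proj_trunc; exact: fg.
apply/smooth_Ck => n; apply: (Ck_comp (V := U)).
- exact: open_preim_proj.
- by [].
- exact: smoothCk.
- by move=> j; exact: Ck_coord.
Qed.

Global Instance jnbhs_filter t : ProperFilter (jnbhs t).
Proof.
split; first by move=> [k [U [_ Ut]]] /(_ _ Ut).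
split.
- by exists 0%N, setT; split=> //; exact: openT.
- move=> P Q [k [U [oU Ut UP]]] [l [V [oV Vt VQ]]].
  exists (maxn k l), (proj (leq_maxl k l) @^-1` U `&` proj (leq_maxr k l) @^-1` V).
  split; first by apply: openI; exact: open_preim_proj.
    by split; rewrite /= proj_trunc.
  by move=> t' [] /=; rewrite !proj_trunc => /UP ? /VQ.
- move=> P Q PQ [k [U [oU Ut UP]]]; exists k, U; split=> // t' /UP; exact: PQ.
Qed.

Lemma jnbhs_at t P : jnbhs t P -> P t.
Proof. by move=> [k [U [_ Ut]]] /(_ _ Ut). Qed.

Lemma jnbhs_nbhs t P : jnbhs t P -> jnbhs t (fun t' => jnbhs t' P).
Proof.
by move=> [k [U [oU Ut UP]]]; exists k, U; split=> // t' Ut'; exists k, U.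
Qed.

Lemma jet_function_jnbhs k (U : set (E R k)) t : open U -> U (trunc k t) ->
  jnbhs t (fun t' => U (trunc k t')).
Proof. by move=> oU Ut; exists k, U; split. Qed.

(** The bound [N] on the order matters in applications of the chain rule, where all
    the components that a given function depends on are needed on one domain. *)
Lemma jsm_common (n N : nat) (F : nat -> jet R -> R) t P :
  (forall i, (i < n)%N -> jsm t (F i)) -> jnbhs t P ->
  exists k (U : set (E R k)), [/\ (N <= k)%N, open U, U (trunc k t),
    (forall t', U (trunc k t') -> P t') &
    forall i, (i < n)%N -> jet_function U (F i)].
Proof.
move=> HF HP; elim: n HF => [|n IH] HF.
  case: HP => k [U [oU Ut UP]].
  exists (maxn k N), (proj (leq_maxl k N) @^-1` U).
  split; rewrite ?leq_maxr /= ?proj_trunc //; first exact: open_preim_proj.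
  by move=> t'; rewrite proj_trunc; exact: UP.
have [|k [U [Nk oU Ut UP HU]]] := IH; first by move=> i /ltnW; exact: HF.
have [l [V [HV Vt]]] := HF n (ltnSn n).
pose W := proj (leq_maxl k l) @^-1` U `&` proj (leq_maxr k l) @^-1` V.
have oW : open W by apply: openI; apply: open_preim_proj => //; case: HV.
exists (maxn k l), W; split=> //.
- by rewrite leq_max Nk.
- by split; rewrite /= proj_trunc.
- by move=> t' [] /=; rewrite !proj_trunc => /UP.
move=> i; rewrite ltnS leq_eqVlt => /predU1P[->|/HU].
  by apply: (jet_functionW _ _ (jet_function_raise (leq_maxr k l) HV)) => // a [].
move=> /(jet_function_raise (leq_maxl k l)); apply: jet_functionW => // a [] //.
Qed.

Lemma jsm_near_eq t f g : jnbhs t (fun t => f t = g t) -> jsm t f -> jsm t g.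
Proof.
move=> fg Hf; have [|k [U [_ oU Ut Ufg HU]]] := @jsm_common 1 0 (fun=> f) t _ _ fg.
  by [].
have [_ [h sh hf]] := HU 0%N isT.
exists k, U; split=> //; split=> //; exists h => // t' Ut'.
by rewrite -Ufg //; exact: hf.
Qed.

Lemma jsm_cst t c : jsm t (fun=> c).
Proof.
exists 0%N, setT; split=> //; split; first exact: openT.
by exists (fun=> c) => //; apply/smooth_Ck => k; exact: Ck_cst.
Qed.

Lemma jsm_coord t j : jsm t (fun t => t j).
Proof.
have jk : (j < 5 + j)%N by exact: (leq_addl 4 j.+1).
exists j, setT; split=> //; split; first exact: openT.
exists (fun a => a 0 (Ordinal jk)); last by move=> t' _; rewrite mxE.
by apply/smooth_Ck => k; exact: Ck_coord.
Qed.

Lemma jsm_op2 t (op : R -> R -> R) f g :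
  (forall n (U : set 'rV[R]_n) a b k, open U -> Ck k U a -> Ck k U b ->
     Ck k U (fun x => op (a x) (b x))) ->
  jsm t f -> jsm t g -> jsm t (fun t => op (f t) (g t)).
Proof.
move=> Hop Hf Hg.
have [|k [U [_ oU Ut _ HU]]] := @jsm_common 2 0 (fun i => if i is 0%N then f else g)
  t setT _ filterT.
  by case=> [|[]].
have [_ [a sa fa]] := HU 0%N isT; have [_ [b sb gb]] := HU 1%N isT.
exists k, U; split=> //; split=> //; exists (fun x => op (a x) (b x)).
  by apply/smooth_Ck => n; apply: Hop => //; exact: smoothCk.
by move=> t' Ut'; rewrite fa // gb.
Qed.

Lemma jsmD t f g : jsm t f -> jsm t g -> jsm t (fun t => f t + g t).
Proof. by apply: (jsm_op2 (op := +%R)) => *; exact: CkD. Qed.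

Lemma jsmM t f g : jsm t f -> jsm t g -> jsm t (fun t => f t * g t).
Proof. by apply: (jsm_op2 (op := *%R)) => *; exact: CkM. Qed.

Lemma jsmN t f : jsm t f -> jsm t (fun t => - f t).
Proof.
move=> Hf; rewrite (_ : (fun t => - f t) = fun t => (-1) * f t).
  by apply: jsmM => //; exact: jsm_cst.
by apply/funext => t'; rewrite mulN1r.
Qed.

Lemma jsmX t f n : jsm t f -> jsm t (fun t => f t ^+ n).
Proof.
move=> Hf; elim: n => [|n IH]; first exact: jsm_cst.
rewrite (_ : (fun t => _) = fun t => f t * f t ^+ n); first exact: jsmM.
by apply/funext => t'; rewrite exprS.
Qed.

Lemma jsm_sum t (I : Type) (r : seq I) (F : I -> jet R -> R) :
  (forall i, jsm t (F i)) -> jsm t (fun t => \sum_(i <- r) F i t).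
Proof.
move=> HF; elim: r => [|i r IH].
  rewrite (_ : (fun t => _) = fun=> 0); first exact: jsm_cst.
  by apply/funext => t'; rewrite big_nil.
rewrite (_ : (fun t => _) = fun t => F i t + \sum_(j <- r) F j t); first exact: jsmD.
by apply/funext => t'; rewrite big_cons.
Qed.

(** Beyond the order [k] moving a coordinate does not move the [k]-jet. *)
Definition jet_dir k (j : nat) : E R k :=
  if insub j is Some i then delta_mx 0 i else 0.

Lemma trunc_upd k t j x :
  trunc k (upd t j x) = (trunc k t - t j *: jet_dir k j) + x *: jet_dir k j.
Proof.
apply/rowP => i; rewrite /jet_dir !mxE updE; case: insubP => [i' _ ii'|].
  rewrite !mxE eqxx /= -val_eqE /= ii'.
  by case: eqP => [->|_]; rewrite ?mulr1 ?mulr0 ?subrr ?add0r ?subr0 ?addr0.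
rewrite !mxE mulr0 subr0 mulr0 addr0 -leqNgt.
by case: eqP => // <-; rewrite leqNgt ltn_ord.
Qed.

Lemma continuous_trunc_upd k t j :
  continuous (fun x => trunc k (upd t j x)).
Proof.
have -> : (fun x => trunc k (upd t j x)) =
    (fun x => (trunc k t - t j *: jet_dir k j) + x *: jet_dir k j).
  by apply/funext => x; rewrite trunc_upd.
move=> x; apply: cvgD; first exact: cvg_cst.
by apply: cvgZr_tmp; exact: cvg_id.
Qed.

Lemma nbhs_upd k (U : set (E R k)) t j : open U -> U (trunc k t) ->
  \forall x \near t j, U (trunc k (upd t j x)).
Proof.
move=> oU Ut; have N : nbhs (trunc k (upd t j (t j))) U.
  by rewrite upd_id; exact: open_nbhs_nbhs.
exact: (@continuous_trunc_upd k t j (t j) _ N).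
Qed.

Lemma smooth_differentiable n (U : set 'rV[R]_n) (g : 'rV[R]_n -> R) a : smooth U g -> U a ->
  differentiable g a.
Proof. by move=> sg; exact: (sg [::]). Qed.

Lemma jsm_preimage t f (O : set R) : jsm t f -> open O -> O (f t) ->
  jnbhs t (fun t => O (f t)).
Proof.
move=> [k [U [[oU [g sg fg]] Ut]]] oO Oft.
exists k, (U `&` g @^-1` O); split.
- rewrite openE => a [Ua Oa]; apply: filterI; first exact: open_nbhs_nbhs.
  have := differentiable_continuous (smooth_differentiable sg Ua).
  by apply; exact: open_nbhs_nbhs.
- by split=> //=; rewrite -fg.
- by move=> t' [Ut' /=]; rewrite fg.
Qed.

Lemma jsm_neq0 t f : jsm t f -> f t != 0 -> jnbhs t (fun t => f t != 0).
Proof.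
by move=> Hf f0; apply: (jsm_preimage (O := [set x | x != 0]) Hf).
Qed.

Lemma jsm_op1 t (op : R -> R) f :
  (forall n (U : set 'rV[R]_n) a k, open U -> (forall x, U x -> a x != 0) ->
     Ck k U a -> Ck k U (fun x => op (a x))) ->
  f t != 0 -> jsm t f -> jsm t (fun t => op (f t)).
Proof.
move=> Hop f0 Hf.
have [k [U [[oU [g sg fg]] Ut]]] := Hf.
have [oV Vt VW] : [/\ open (U `&` g @^-1` [set x | x != 0]), g (trunc k t) != 0 &
   U `&` g @^-1` [set x | x != 0] `<=` U].
  split; [|by rewrite -fg | by move=> a []].
  rewrite openE => a [Ua Oa]; apply: filterI; first exact: open_nbhs_nbhs.
  have := differentiable_continuous (smooth_differentiable sg Ua).
  by apply; apply: open_nbhs_nbhs; split.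
exists k, (U `&` g @^-1` [set x | x != 0]); split=> //; split=> //.
exists (fun x => op (g x)); last by move=> t' [Ut' _]; rewrite fg.
apply/smooth_Ck => n; apply: Hop => //; first by move=> x [].
by apply: smoothCk; exact: smooth_sub sg.
Qed.

Lemma jsmV t f : f t != 0 -> jsm t f -> jsm t (fun t => (f t)^-1).
Proof. by apply: (jsm_op1 (op := fun x => x^-1)) => *; exact: CkV. Qed.

Lemma jsm_abs_powR t f r : f t != 0 -> jsm t f -> jsm t (fun t => `|f t| `^ r).
Proof. by apply: (jsm_op1 (op := fun x => `|x| `^ r)) => *; exact: Ck_abs_powR. Qed.

Lemma pd_jet_is_derive k (U : set (E R k)) (g : E R k -> R) f t j : open U -> smooth U g ->
  (forall t, U (trunc k t) -> f t = g (trunc k t)) -> U (trunc k t) ->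
  is_derive (t j) 1 (fun x => f (upd t j x))
    (if insub j is Some i then 'D_(delta_mx 0 i) g (trunc k t) else 0).
Proof.
move=> oU sg fg Ut.
pose w := jet_dir k j.
have tr0 : (trunc k t - t j *: w) + t j *: w = trunc k t by rewrite subrK.
have dg : differentiable g (trunc k t) by exact: smooth_differentiable Ut.
have : is_derive (t j) 1 (fun x => g ((trunc k t - t j *: w) + x *: w))
    ('D_w g (trunc k t)).
  have := @derive_line _ _ g (trunc k t - t j *: w) w (t j).
  by rewrite tr0; apply; exact: diff_derivable.
suff -> : 'D_w g (trunc k t) =
    (if insub j is Some i then 'D_(delta_mx 0 i) g (trunc k t) else 0).
  apply: near_eq_is_derive; near=> x; rewrite -trunc_upd -fg //.
  by near: x; exact: nbhs_upd.
by rewrite /w /jet_dir; case: insub => [i|] //; rewrite derive0.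
Unshelve. all: by end_near. Qed.

Lemma pd_jet k (U : set (E R k)) (g : E R k -> R) f t j : open U -> smooth U g ->
  (forall t, U (trunc k t) -> f t = g (trunc k t)) -> U (trunc k t) ->
  pd j f t = (if insub j is Some i then 'D_(delta_mx 0 i) g (trunc k t) else 0).
Proof.
move=> oU sg fg Ut.
by have [_ <-] := pd_jet_is_derive j oU sg fg Ut; rewrite /pd derive1E.
Qed.

Lemma pd_is_derive t f j : jsm t f ->
  is_derive (t j) 1 (fun x => f (upd t j x)) (pd j f t).
Proof.
move=> [k [U [[oU [g sg fg]] Ut]]]; rewrite (pd_jet j oU sg fg Ut).
exact: pd_jet_is_derive fg Ut.
Qed.

Lemma pd_high k (U : set (E R k)) f t j : jet_function U f -> U (trunc k t) ->
  (5 + k <= j)%N -> pd j f t = 0.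
Proof.
move=> [oU [g sg fg]] Ut kj; rewrite (pd_jet j oU sg fg Ut) insubF //.
by rewrite ltnNge kj.
Qed.

Lemma jet_function_pd k (U : set (E R k)) f j : jet_function U f ->
  jet_function U (pd j f).
Proof.
move=> [oU [g sg fg]]; split=> //.
exists (fun a => if insub j is Some i then 'D_(delta_mx 0 i) g a else 0).
  case: insub => [i|]; last by apply/smooth_Ck => k'; exact: Ck_cst.
  by apply/smooth_Ck => k'; have /smooth_Ck := sg; move=> /(_ k'.+1)[_ /(_ i)].
by move=> t; exact: pd_jet.
Qed.

Lemma jsm_pd t f j : jsm t f -> jsm t (pd j f).
Proof. by move=> [k [U [Hf Ut]]]; exists k, U; split=> //; exact: jet_function_pd. Qed.

Lemma jnbhs_line t P j : jnbhs t P -> \forall x \near (t j), P (upd t j x).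
Proof.
move=> [k [U [oU Ut UP]]]; near=> x; apply: UP.
by near: x; exact: nbhs_upd.
Unshelve. all: by end_near. Qed.

Lemma pd_near_eq t f g j : jnbhs t (fun t => f t = g t) -> pd j f t = pd j g t.
Proof.
move=> fg; rewrite /pd !derive1E; apply: near_eq_derive; exact: (jnbhs_line j fg).
Qed.

Lemma pdD t f g j : jsm t f -> jsm t g ->
  pd j (fun t => f t + g t) t = pd j f t + pd j g t.
Proof.
move=> /(pd_is_derive j) [f1 f2] /(pd_is_derive j)[g1 g2].
rewrite -f2 -g2 -(deriveD f1 g1) /pd derive1E; reflexivity.
Qed.

Lemma pdM t f g j : jsm t f -> jsm t g ->
  pd j (fun t => f t * g t) t = pd j f t * g t + f t * pd j g t.
Proof.
move=> /(pd_is_derive j) [f1 f2] /(pd_is_derive j)[g1 g2].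
have E := deriveM f1 g1; rewrite upd_id in E.
rewrite -f2 -g2 addrC [X in _ + X]mulrC -E /pd derive1E; reflexivity.
Qed.

Lemma pd_cst t c j : pd j (fun=> c) t = 0.
Proof. by rewrite /pd derive1_cst. Qed.

Lemma pd_coord t i j : pd j (fun t => t i) t = (i == j)%:R.
Proof.
rewrite /pd derive1E /=; case: eqP => _; last by rewrite derive_cst.
by rewrite derive_id.
Qed.

Lemma pd_comp1 t f (phi : R -> R) dphi j : jsm t f ->
  is_derive (f t) 1 phi dphi -> pd j (fun t => phi (f t)) t = dphi * pd j f t.
Proof.
move=> /(pd_is_derive j) [f1 f2] [p1 p2].
have E := @derive_comp1 _ _ (fun x => f (upd t j x)) phi (t j) 1.
rewrite upd_id in E; rewrite -f2 -p2 -E //; last exact/derivable1_diffP.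
by rewrite /pd derive1E; reflexivity.
Qed.

(** Schwarz's theorem in the finitely many coordinates that [f] depends on. *)
Lemma pd_comm t f i j : jsm t f -> pd i (pd j f) t = pd j (pd i f) t.
Proof.
move=> [k [U [[oU [g sg fg]] Ut]]].
have H i' : jnbhs t (fun t => pd i' f t =
    if insub i' is Some i then 'D_(delta_mx 0 i) g (trunc k t) else 0).
  by exists k, U; split=> // t' Ut'; exact: pd_jet fg Ut'.
have sD (i' : 'I_(5 + k)) : smooth U (fun b => 'D_(delta_mx 0 i') g b).
  by apply/smooth_Ck => k'; have /smooth_Ck := sg; move=> /(_ k'.+1)[_ /(_ i')].
have E i' (o : 'I_(5 + k)) : 
    pd i' (fun t => 'D_(delta_mx 0 o) g (trunc k t)) t =
    if insub i' is Some o' then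
      'D_(delta_mx 0 o') (fun b => 'D_(delta_mx 0 o) g b) (trunc k t) else 0.
  exact: (pd_jet i' oU (sD o) (fun _ _ => erefl) Ut).
rewrite (pd_near_eq _ (H j)) (pd_near_eq _ (H i)).
case Ei : (insub i) => [oi|]; case Ej : (insub j) => [oj|]; last first.
- by rewrite !pd_cst.
- by rewrite pd_cst; have := E i oj; rewrite Ei => E'; exact: E'.
- by rewrite pd_cst; have := E j oi; rewrite Ej => E'; exact: esym E'.
have := E i oj; rewrite Ei => ->; have := E j oi; rewrite Ej => ->.
apply: schwarz.
- near=> a; apply: (smooth_differentiable sg).
  by near: a; exact: open_nbhs_nbhs.
- exact: smooth_differentiable (sD oj) Ut.
- exact: smooth_differentiable (sD oi) Ut.
Unshelve. all: by end_near. Qed.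

(** The series defining [lie] is a finite sum. *)
Lemma lie_jet k (U : set (E R k)) X f t N : jet_function U f -> U (trunc k t) ->
  (5 + k <= N)%N -> lie X f t = \sum_(j < N) X j t * pd j f t.
Proof.
move=> Hf Ut kN; rewrite /lie; apply: lim_near_cst => //.
exists N => // n /= Nn; rewrite seriesEnat /= -(big_mkord xpredT (fun j => X j t * pd j f t)).
rewrite [LHS](big_cat_nat _ (n := N)) //= [X in _ + X]big1_seq ?addr0 //.
move=> i /andP[_]; rewrite mem_index_iota => /andP[Ni _].
by rewrite (pd_high Hf Ut) ?mulr0 // (leq_trans kN).
Qed.

Lemma lie_fin t f : jsm t f -> exists N0, forall X N, (N0 <= N)%N ->
  lie X f t = \sum_(j < N) X j t * pd j f t.
Proof. by move=> [k [U [Hf Ut]]]; exists (5 + k)%N => X N; exact: (lie_jet X Hf Ut). Qed.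

End Jets.

(** * Vector fields on the jet space *)

Section Lie.
Context {R : realType}.
Implicit Types (t s : jet R) (f g : jet R -> R) (X Y : nat -> jet R -> R).

Lemma jnbhs_jet k (U : set (E R k)) t (P : jet R -> Prop) : open U ->
  U (trunc k t) -> (forall t, U (trunc k t) -> P t) -> jnbhs t P.
Proof. by move=> oU Ut UP; exists k, U; split. Qed.

Lemma lie_fin_near t f : jsm t f -> exists N0, forall N, (N0 <= N)%N ->
  jnbhs t (fun t => forall X, lie X f t = \sum_(j < N) X j t * pd j f t).
Proof.
move=> [k [U [Hf Ut]]]; exists (5 + k)%N => N kN.
apply: (jnbhs_jet _ Ut); first by case: Hf.
by move=> t' Ut' X; exact: (lie_jet X Hf Ut').
Qed.

Lemma lie_fin2 t f g : jsm t f -> jsm t g -> exists N0, forall N, (N0 <= N)%N ->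
  forall X, lie X f t = \sum_(j < N) X j t * pd j f t /\
            lie X g t = \sum_(j < N) X j t * pd j g t.
Proof.
move=> /lie_fin[N1 H1] /lie_fin[N2 H2]; exists (maxn N1 N2) => N.
by rewrite geq_max => /andP[n1 n2] X; rewrite (H1 _ N) // (H2 _ N).
Qed.

Lemma lie_ext X Y f t : (forall j, X j t = Y j t) -> lie X f t = lie Y f t.
Proof.
move=> XY; rewrite /lie; congr (limn (series _)).
by apply/funext => j; rewrite XY.
Qed.

Lemma lie_near_eq X t f g : jnbhs t (fun t => f t = g t) -> lie X f t = lie X g t.
Proof.
move=> fg; rewrite /lie; congr (limn (series _)).
by apply/funext => j; rewrite (pd_near_eq j fg).
Qed.

Lemma lie_scale c X f t : jsm t f -> lie (fun j t => c * X j t) f t = c * lie X f t.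
Proof.
move=> /lie_fin[N H]; rewrite !(H _ N) // mulr_sumr.
by apply: eq_bigr => j _; rewrite mulrA.
Qed.

Lemma lieD X t f g : jsm t f -> jsm t g ->
  lie X (fun t => f t + g t) t = lie X f t + lie X g t.
Proof.
move=> Hf Hg; have [N1 H1] := lie_fin2 Hf Hg; have [N2 H2] := lie_fin (jsmD Hf Hg).
pose N := maxn N1 N2.
rewrite (H2 _ N) ?leq_maxr //.
have [-> ->] := H1 N (leq_maxl _ _) X.
by rewrite -big_split /=; apply: eq_bigr => j _; rewrite pdD // mulrDr.
Qed.

Lemma lieM X t f g : jsm t f -> jsm t g ->
  lie X (fun t => f t * g t) t = lie X f t * g t + f t * lie X g t.
Proof.
move=> Hf Hg; have [N1 H1] := lie_fin2 Hf Hg; have [N2 H2] := lie_fin (jsmM Hf Hg).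
pose N := maxn N1 N2.
rewrite (H2 _ N) ?leq_maxr //.
have [-> ->] := H1 N (leq_maxl _ _) X.
rewrite mulr_suml mulr_sumr -big_split /=; apply: eq_bigr => j _.
by rewrite pdM // mulrDr mulrA [in X in _ + X]mulrCA.
Qed.

Lemma lie_cst X t c : lie X (fun=> c) t = 0.
Proof.
have [N H] := lie_fin (jsm_cst t c).
by rewrite (H _ N) // big1 // => j _; rewrite pd_cst mulr0.
Qed.

Lemma lie_coord X t i : lie X (fun t => t i) t = X i t.
Proof.
have [N0 H] := lie_fin (jsm_coord t i).
pose N := maxn N0 i.+1; have iN : (i < N)%N by exact: leq_maxr.
rewrite (H _ N) ?leq_maxl // (bigD1 (Ordinal iN)) //= pd_coord eqxx mulr1.
rewrite big1 ?addr0 // => j ji; rewrite pd_coord.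
by move: ji; rewrite -val_eqE /= eq_sym => /negbTE ->; rewrite mulr0.
Qed.

Lemma lie_comp1 X t f (phi : R -> R) dphi : jsm t f ->
  jsm t (fun t => phi (f t)) ->
  is_derive (f t) 1 phi dphi -> lie X (fun t => phi (f t)) t = dphi * lie X f t.
Proof.
move=> Hf Hp Hd; have [N0 H] := lie_fin2 Hf Hp.
have [-> ->] := H N0 (leqnn _) X.
by rewrite mulr_sumr; apply: eq_bigr => j _; rewrite (pd_comp1 j Hf Hd) mulrCA.
Qed.

Lemma lie_sum X t (I : Type) (r : seq I) (F : I -> jet R -> R) :
  (forall i, jsm t (F i)) ->
  lie X (fun t => \sum_(i <- r) F i t) t = \sum_(i <- r) lie X (F i) t.
Proof.
move=> HF; elim: r => [|i r IH].
  have -> : (fun t => \sum_(i <- [::]) F i t) = fun=> 0.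
    by apply/funext => t'; rewrite big_nil.
  by rewrite big_nil lie_cst.
have -> : (fun t => \sum_(j <- i :: r) F j t) =
    fun t => F i t + \sum_(j <- r) F j t.
  by apply/funext => t'; rewrite big_cons.
by rewrite big_cons -IH -lieD //; exact: jsm_sum.
Qed.

Lemma jsm_lie X t f : (forall j, jsm t (X j)) -> jsm t f -> jsm t (lie X f).
Proof.
move=> HX Hf; have [N H] := lie_fin_near Hf.
apply: (@jsm_near_eq _ t (fun t => \sum_(j < N) X j t * pd j f t)).
  by apply: filterS (H N (leqnn _)) => t' ->.
by apply: jsm_sum => j; apply: jsmM => //; exact: jsm_pd.
Qed.

(** The Lie bracket of vector fields acts as the commutator, because partial
    derivatives commute. *)
Lemma lie_commutator X Y t f : (forall j, jsm t (X j)) -> (forall j, jsm t (Y j)) ->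
  jsm t f -> lie X (lie Y f) t - lie Y (lie X f) t =
  lie (fun j t => lie X (Y j) t - lie Y (X j) t) f t.
Proof.
move=> HX HY [k [U [Hf Ut]]]; pose N := (5 + k)%N.
have oU : open U by case: Hf.
have near Z : jnbhs t (fun t => lie Z f t = \sum_(j < N) Z j t * pd j f t).
  by apply: (jnbhs_jet oU Ut) => t' Ut'; exact: (lie_jet Z Hf Ut').
have sf : jsm t f by exists k, U.
have half Z W : (forall j, jsm t (Z j)) -> (forall j, jsm t (W j)) ->
    lie Z (lie W f) t = \sum_(j < N) lie Z (W j) t * pd j f t +
      \sum_(j < N) \sum_(i < N) W j t * (Z i t * pd i (pd j f) t).
  move=> HZ HW; rewrite (lie_near_eq _ (near W)) lie_sum; last first.
    by move=> j; apply: jsmM => //; exact: jsm_pd.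
  rewrite -big_split /=; apply: eq_bigr => j _.
  rewrite lieM //; last exact: jsm_pd.
  by rewrite (lie_jet Z (jet_function_pd j Hf) Ut (leqnn _)) mulr_sumr.
rewrite (half X Y) // (half Y X) // (lie_jet _ Hf Ut (leqnn _)).
rewrite [X in _ + X - _]exchange_big /=.
set A := (X in _ + X - _); set B := (X in _ - (_ + X)).
have -> : A = B.
  apply: eq_bigr => i _; apply: eq_bigr => j _.
  by rewrite mulrCA (pd_comm i j sf).
move: B => {A} B.
rewrite opprD addrACA subrr addr0 -sumrB.
by apply: eq_bigr => j _; rewrite mulrBl.
Qed.

Definition ext k (a : E R k) : jet R :=
  fun i => if insub i is Some j then a 0 j else 0.

Lemma trunc_ext k (a : E R k) : trunc k (ext a) = a.
Proof.
apply/rowP => i; rewrite !mxE /ext; case: insubP => [j _ ij|].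
  by congr (a 0 _); apply: val_inj.
by rewrite ltn_ord.
Qed.

Lemma jet_function_ext k (U : set (E R k)) f : jet_function U f ->
  smooth U (fun a => f (ext a)) /\
  forall t, U (trunc k t) -> f t = f (ext (trunc k t)).
Proof.
move=> [oU [g sg fg]]; split.
  apply/smooth_Ck => n; apply: Ck_eq (smoothCk n sg) => // a Ua.
  by rewrite fg trunc_ext.
by move=> t Ut; rewrite !fg ?trunc_ext.
Qed.

(** Maps of the jet space whose components are smooth of finite order pull back
    smooth functions of finite order, since such a function involves finitely many
    components. *)
Lemma chain_rule (Psi : jet R -> jet R) f s :
  (forall l, jsm s (fun s => Psi s l)) -> jsm (Psi s) f ->
  jsm s (fun s => f (Psi s)) /\ forall i, pd i (fun s => f (Psi s)) s =
    lie (fun l _ => pd i (fun s => Psi s l) s) f (Psi s).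
Proof.
move=> HP [k [U [Hf Us]]].
have [m [W [_ oW Ws _ HW]]] := @jsm_common _ (5 + k) 0 (fun l s => Psi s l) s setT
  (fun i _ => HP i) filterT.
have [oU [g sg fg]] := Hf.
pose G (l : 'I_(5 + k)) (a : E R m) := Psi (ext a) l.
have sG l : smooth W (G l) by case: (jet_function_ext (HW l (ltn_ord l))).
have GE (l : 'I_(5 + k)) t : W (trunc m t) -> Psi t l = G l (trunc m t).
  by case: (jet_function_ext (HW l (ltn_ord l))) => _ /(_ t).
have rE t : W (trunc m t) -> \row_l G l (trunc m t) = trunc k (Psi t).
  by move=> Wt; apply/rowP => l; rewrite !mxE -GE.
pose W' := W `&` (fun a => \row_l G l a) @^-1` U.
have dG a : W a -> forall l, differentiable (G l) a.
  by move=> Wa l; exact: smooth_differentiable (sG l) Wa.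
have oW' : open W'.
  rewrite openE => a [Wa Ua]; apply: filterI; first exact: open_nbhs_nbhs.
  have := differentiable_continuous (differentiable_row (dG a Wa)).
  by apply; exact: open_nbhs_nbhs.
have W's : W' (trunc m s) by split=> //=; rewrite rE.
have fE t : W' (trunc m t) -> f (Psi t) = g (\row_l G l (trunc m t)).
  by move=> [Wt /=]; rewrite rE // => Ut; exact: fg.
have sgG : smooth W' (fun a => g (\row_l G l a)).
  apply/smooth_Ck => n; apply: (Ck_comp (V := U)) => //.
  - by move=> a [].
  - exact: smoothCk.
  - by move=> l; apply: smoothCk; apply: smooth_sub (sG l) => a [].
split; first by exists m, W'; split=> //; split=> //; exists (fun a => g (\row_l G l a)).
move=> i; rewrite (lie_jet _ Hf Us (leqnn _)).
rewrite (pd_jet i oW' sgG fE W's).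
have pG (l : 'I_(5 + k)) : pd i (fun s => Psi s l) s =
    if insub i is Some i then 'D_(delta_mx 0 i) (G l) (trunc m s) else 0.
  exact: (pd_jet i oW (sG l) (GE l) Ws).
have pg (j : 'I_(5 + k)) : pd j f (Psi s) = 'D_(delta_mx 0 j) g (trunc k (Psi s)).
  rewrite (pd_jet j oU sg fg Us) (insubT (fun i => i < 5 + k)%N (ltn_ord j)).
  by congr (derive _ _ (delta_mx 0 _)); apply: val_inj.
case Ei : (insub i) => [oi|]; last first.
  by rewrite big1 // => j _; rewrite pG Ei mul0r.
rewrite derive_comp_row; [|exact: dG|]; last first.
  by rewrite rE //; exact: smooth_differentiable sg Us.
by apply: eq_bigr => j _; rewrite pG Ei pg rE.
Qed.

(** Continuity of such maps. *)
Lemma jnbhs_preimage (Psi : jet R -> jet R) s P :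
  (forall l, jsm s (fun s => Psi s l)) -> jnbhs (Psi s) P ->
  jnbhs s (fun s => P (Psi s)).
Proof.
move=> HP [k [U [oU Us UP]]].
have [m [W [_ oW Ws _ HW]]] := @jsm_common _ (5 + k) 0 (fun l s => Psi s l) s setT
  (fun i _ => HP i) filterT.
pose G (l : 'I_(5 + k)) (a : E R m) := Psi (ext a) l.
have sG l : smooth W (G l) by case: (jet_function_ext (HW l (ltn_ord l))).
have rE t : W (trunc m t) -> \row_l G l (trunc m t) = trunc k (Psi t).
  move=> Wt; apply/rowP => l; rewrite !mxE /G.
  by case: (jet_function_ext (HW l (ltn_ord l))) => _ /(_ t Wt).
exists m, (W `&` (fun a => \row_l G l a) @^-1` U); split.
- rewrite openE => a [Wa Ua]; apply: filterI; first exact: open_nbhs_nbhs.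
  have dG l : differentiable (G l) a by exact: smooth_differentiable (sG l) Wa.
  have := differentiable_continuous (differentiable_row dG).
  by apply; exact: open_nbhs_nbhs.
- by split=> //=; rewrite rE.
- by move=> t [Wt /=]; rewrite rE // => /UP.
Qed.

End Lie.

(** * The ring of jet functions *)

Section SmoothRing.
Variable R : realType.

(** Functions that are smooth of finite order near every jet.  Their order may
    vary from jet to jet.  They form a commutative ring with commuting derivations,
    in which the whole theory of symmetries takes place. *)
Definition finite_order : {pred jet R -> R} := fun f => `[< forall t, jsm t f >].

Lemma finite_order_subring : subring_closed finite_order.
Proof.
split.
- by apply/asboolP => t; exact: jsm_cst.
- move=> f g /asboolP Hf /asboolP Hg; apply/asboolP => t.
  by apply: jsmD => //; exact: jsmN.
- move=> f g /asboolP Hf /asboolP Hg; apply/asboolP => t.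
  exact: jsmM.
Qed.

HB.instance Definition _ := GRing.isSubringClosed.Build _ finite_order finite_order_subring.

Record jfun := JFun { jfun_val :> jet R -> R; _ : jfun_val \in finite_order }.

HB.instance Definition _ := [isSub for jfun_val].
HB.instance Definition _ := [Choice of jfun by <:].
HB.instance Definition _ := [SubChoice_isSubComNzRing of jfun by <:].

Implicit Types (f g : jfun) (X Y : nat -> jfun).

Lemma jfunP f t : jsm t f.
Proof. by case: f => f /= /asboolP. Qed.

Lemma jfun_ext f g : (forall t, f t = g t) -> f = g.
Proof. by move=> fg; apply: val_inj; apply/funext. Qed.

Definition mk_jfun (f : jet R -> R) (Hf : forall t, jsm t f) : jfun :=
  JFun (introT (asboolP _) Hf).

Definition sC c : jfun := mk_jfun (fun t => jsm_cst t c).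
Definition sX j : jfun := mk_jfun (fun t => jsm_coord t j).
Definition der X f : jfun := mk_jfun (fun t => jsm_lie (fun j => jfunP (X j) t) (jfunP f t)).

Lemma sfDE f g t : (f + g) t = f t + g t. Proof. by []. Qed.
Lemma sfNE f t : (- f) t = - f t. Proof. by []. Qed.
Lemma sfME f g t : (f * g) t = f t * g t. Proof. by []. Qed.
Lemma sf0E t : (0 : jfun) t = 0. Proof. by []. Qed.
Lemma sf1E t : (1 : jfun) t = 1. Proof. by []. Qed.
Definition sfE := (sfDE, sfNE, sfME, sf0E, sf1E).

Lemma sfXE f n t : (f ^+ n) t = f t ^+ n.
Proof. by elim: n => [|n IH] //; rewrite !exprS sfE IH. Qed.

Lemma sfnE n t : (n%:R : jfun) t = n%:R.
Proof. by elim: n => [|n IH] //; rewrite -!natr1 sfE IH. Qed.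

Lemma sf_sumE (I : Type) (r : seq I) (F : I -> jfun) t :
  (\sum_(i <- r) F i) t = \sum_(i <- r) F i t.
Proof. by elim: r => [|i r IH]; rewrite ?big_nil // !big_cons sfE IH. Qed.

Lemma derE X f t : der X f t = lie (fun j => X j) f t.
Proof. by []. Qed.

Lemma derD X f g : der X (f + g) = der X f + der X g.
Proof. by apply: jfun_ext => t; rewrite sfE !derE -lieD //; exact: jfunP. Qed.

Lemma derM X f g : der X (f * g) = der X f * g + f * der X g.
Proof. by apply: jfun_ext => t; rewrite !sfE !derE -lieM //; exact: jfunP. Qed.

Lemma der_sC X c : der X (sC c) = 0.
Proof. by apply: jfun_ext => t; rewrite derE lie_cst. Qed.

Lemma der0 X : der X 0 = 0. 
Proof. have <- : sC 0 = 0 by apply: jfun_ext. rewrite der_sC; by apply: jfun_ext. Qed.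

Lemma der1 X : der X 1 = 0. 
Proof. have <- : sC 1 = 1 by apply: jfun_ext. exact: der_sC. Qed.

Lemma derXn X f n : der X (f ^+ n.+1) = n.+1%:R * f ^+ n * der X f.
Proof.
elim: n => [|n IH]; first by rewrite expr1 expr0; ring.
rewrite exprS derM IH -(natr1 n.+1) exprS; ring.
Qed.

Lemma der_sX X j : der X (sX j) = X j.
Proof. by apply: jfun_ext => t; rewrite derE lie_coord. Qed.

Lemma der_eq X Y f : X =1 Y -> der X f = der Y f.
Proof. by move=> XY; apply: jfun_ext => t; apply: lie_ext => j; rewrite XY. Qed.

Lemma der_vecZ a X f : der (fun j => a * X j) f = a * der X f.
Proof.
apply: jfun_ext => t; rewrite sfE !derE -(lie_scale (a t) _ (jfunP f t)).
exact: lie_ext.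
Qed.

Lemma der_vec0 f : der (fun=> 0) f = 0.
Proof.
rewrite -[RHS](mul0r (der (fun=> 0) f)) -der_vecZ.
by apply: der_eq => j; rewrite mul0r.
Qed.

Lemma der_comm X Y f :
  der X (der Y f) = der Y (der X f) + der (fun j => der X (Y j) - der Y (X j)) f.
Proof.
apply: jfun_ext => t; rewrite sfE.
have := lie_commutator (fun j => jfunP (X j) t) (fun j => jfunP (Y j) t) (jfunP f t).
by move/eqP; rewrite subr_eq addrC => /eqP.
Qed.

Definition pder (i : nat) : jfun -> jfun := der (fun j => (j == i)%:R).
Local Notation d := pder.

Lemma pder_pd i f t : d i f t = pd i f t.
Proof.
have [N0 H] := lie_fin (jfunP f t); pose N := maxn N0 i.+1.
have iN : (i < N)%N by exact: leq_maxr.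
rewrite /pder derE (H _ N) ?leq_maxl // (bigD1 (Ordinal iN)) //= eqxx mul1r.
rewrite big1 ?addr0 // => j ji.
by move: ji; rewrite -val_eqE /= => /negbTE ->; rewrite mul0r.
Qed.

Lemma d_sX i j : d i (sX j) = (j == i)%:R. Proof. exact: der_sX. Qed.

Lemma der_fin n X f : (forall j, (n <= j)%N -> d j f = 0) ->
  der X f = \sum_(j < n) X j * d j f.
Proof.
move=> Hn; apply: jfun_ext => t; rewrite sf_sumE derE.
have [N0 H] := lie_fin (jfunP f t); pose N := maxn N0 n.
rewrite (H _ N) ?leq_maxl //.
rewrite (big_ord_widen N (fun j => (X j * d j f) t)) ?leq_maxr //.
rewrite [RHS]big_mkcond; apply: eq_bigr => j _.
rewrite -pder_pd; case: ltnP => // nj.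
by rewrite Hn // mulr0.
Qed.

Lemma d_comm i j f : d i (d j f) = d j (d i f).
Proof.
rewrite /pder der_comm [X in _ + X](_ : _ = 0) ?addr0 // -[RHS](der_vec0 f).
apply: der_eq => k.
by case: (k == j); case: (k == i); rewrite ?der0 ?der1 ?subrr.
Qed.

(** Division by integers is replaced by cancellation, so that identities remain in
    the scope of commutative rings. *)
Lemma jfun_natI n f g : (0 < n)%N -> n%:R * f = n%:R * g -> f = g.
Proof.
move=> n0 Efg; apply: jfun_ext => t; have : (n%:R * f) t = (n%:R * g) t by rewrite Efg.
rewrite !sfE !sfnE; apply: mulfI.
by rewrite pnatr_eq0 -lt0n.
Qed.

Definition tf (j : nat) : jfun :=
  match j with
  | 0 => 1
  | 1 => sX 2
  | 2 => sX 4
  | 3 => sX 4 ^+ 2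
  | i.+4 => sX (4 + i.+1)
  end.

Lemma tfE j t : tf j t = total_field j t.
Proof. by case: j => [|[|[|[|j]]]] //; rewrite sfXE. Qed.

Definition tder : jfun -> jfun := der tf.
Local Notation D := tder.

Lemma tder_Dx f t : D f t = Dx f t.
Proof. by rewrite /tder derE /Dx; apply: lie_ext => j; rewrite tfE. Qed.

End SmoothRing.

Global Opaque der sX sC.

(** * Abstract jet calculus *)

(** The laws of the partial and total derivatives that the classification of the
    symmetries uses.  The classification and the relative invariance of [R8] and
    [R10] hold over every model; in an abstract commutative ring they reduce to
    polynomial identities. *)
Record jet_calculus (A : comNzRingType) := JetCalculus {
  jd : nat -> A -> A;
  jD : A -> A;
  jx : nat -> A;
  jdD : forall i F G, jd i (F + G) = jd i F + jd i G;
  jdM : forall i F G, jd i (F * G) = jd i F * G + F * jd i G;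
  jdx : forall i j, jd i (jx j) = (j == i)%:R;
  jd_comm : forall i j F, jd i (jd j F) = jd j (jd i F);
  jDD : forall F G, jD (F + G) = jD F + jD G;
  jDM : forall F G, jD (F * G) = jD F * G + F * jD G;
  jDp : jD (jx 2) = jx 4;
  jDq : forall i, jD (jx (4 + i)) = jx (4 + i.+1);
  jD_base : forall F, (forall i, (5 <= i)%N -> jd i F = 0) ->
    jD F = jd 0 F + jx 2 * jd 1 F + jx 4 * jd 2 F + jx 4 ^+ 2 * jd 3 F
      + jx 5 * jd 4 F;
  jnatI : forall n (F G : A), (0 < n)%N -> n%:R * F = n%:R * G -> F = G;
  jhalf : exists h : A, 2 * h = 1;
  jthird : exists h : A, 3 * h = 1 }.

Section Derivation.
Variables (A : comNzRingType) (dd : A -> A).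
Hypothesis ddD : forall F G, dd (F + G) = dd F + dd G.
Hypothesis ddM : forall F G, dd (F * G) = dd F * G + F * dd G.
Implicit Types F G : A.

Lemma deriv0 : dd 0 = 0.
Proof. by apply: (addrI (dd 0)); rewrite -ddD !addr0. Qed.

Lemma deriv1 : dd 1 = 0.
Proof. by apply: (addrI (dd 1)); rewrite addr0 -[in RHS](mulr1 1) ddM mulr1 mul1r. Qed.

Lemma derivN F : dd (- F) = - dd F.
Proof. by apply/eqP; rewrite -addr_eq0 -ddD addNr deriv0. Qed.

Lemma derivB F G : dd (F - G) = dd F - dd G.
Proof. by rewrite ddD derivN. Qed.

Lemma deriv_nat n : dd n%:R = 0.
Proof. by elim: n => [|n IH]; rewrite ?deriv0 // -natr1 ddD IH deriv1 addr0. Qed.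

Lemma deriv_natl n F : dd (n%:R * F) = n%:R * dd F.
Proof. by rewrite ddM deriv_nat mul0r add0r. Qed.

Lemma derivXn F n : dd (F ^+ n.+1) = n.+1%:R * F ^+ n * dd F.
Proof.
elim: n => [|n IH]; first by rewrite expr1 expr0; ring.
rewrite exprS ddM IH -(natr1 n.+1) exprS; ring.
Qed.

End Derivation.

Section Algebra.
Variables (K : comNzRingType) (J : jet_calculus K).
Local Notation d := (jd J).
Local Notation D := (jD J).
Local Notation x := (jx J).
Local Notation p := (x 2).
Local Notation q := (x 4).
Local Notation q1 := (x 5).
Implicit Types F G : K.

Lemma DB F G : D (F - G) = D F - D G. Proof. exact/derivB/jDD. Qed.
Lemma DN F : D (- F) = - D F. Proof. exact/derivN/jDD. Qed.
Lemma Dn n F : D (n%:R * F) = n%:R * D F.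
Proof. by apply: deriv_natl; [exact: jDD|exact: jDM]. Qed.
Lemma DXn F n : D (F ^+ n.+1) = n.+1%:R * F ^+ n * D F.
Proof. by apply: derivXn; exact: jDM. Qed.
Lemma Dnat n : D n%:R = 0.
Proof. by apply: deriv_nat; [exact: jDD|exact: jDM]. Qed.
Lemma D0 : D 0 = 0. Proof. exact: (Dnat 0). Qed.
Lemma Dq0 : D q = q1. Proof. exact: (jDq J 0). Qed.
Lemma dB i F G : d i (F - G) = d i F - d i G. Proof. exact/derivB/jdD. Qed.
Lemma dN i F : d i (- F) = - d i F. Proof. exact/derivN/jdD. Qed.
Lemma dn i n F : d i (n%:R * F) = n%:R * d i F.
Proof. by apply: deriv_natl; [exact: jdD|exact: jdM]. Qed.
Lemma dXn i F n : d i (F ^+ n.+1) = n.+1%:R * F ^+ n * d i F.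
Proof. by apply: derivXn; exact: jdM. Qed.
Lemma dnat i n : d i n%:R = 0.
Proof. by apply: deriv_nat; [exact: jdD|exact: jdM]. Qed.
Lemma d0 i : d i 0 = 0. Proof. exact: (dnat i 0). Qed.

Definition dE := (dnat, dXn, dn, dB, dN, jdD, jdM, jdx).
Definition DE := (Dnat, DXn, Dn, DB, DN, jDD, jDM, jDp, Dq0).

(** The derivation [d_x + p d_y]: the part of the total derivative of a function of
    [x, y, p, z] that does not involve [q].  It is locked to remain an atom in
    polynomial identities. *)
Fact Tr_key : unit. Proof. exact: tt. Qed.
Definition Tr := locked_with Tr_key (fun F => d 0 F + p * d 1 F).

(** The functions of [x, y, p, z]. *)
Definition flat F := forall i, (4 <= i)%N -> d i F = 0.

Lemma TrE F : Tr F = d 0 F + p * d 1 F.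
Proof. by rewrite /Tr unlock. Qed.

Lemma TrD F G : Tr (F + G) = Tr F + Tr G.
Proof. by rewrite !TrE !jdD; ring. Qed.

Lemma Tr_natl n F : Tr (n%:R * F) = n%:R * Tr F.
Proof. by rewrite !TrE !dn; ring. Qed.

Lemma TrN F : Tr (- F) = - Tr F.
Proof. by rewrite !TrE !dN; ring. Qed.

Lemma Tr0 : Tr 0 = 0.
Proof. by rewrite !TrE !d0; ring. Qed.

Lemma d_Tr i F : d i (Tr F) = Tr (d i F) + (2 == i)%:R * d 1 F.
Proof. rewrite !TrE jdD jdM jdx !(jd_comm J i); ring. Qed.

Lemma d_d0 i F j : (forall i, (j <= i)%N -> d i F = 0) ->
  forall k, (j <= k)%N -> d k (d i F) = 0.
Proof. by move=> HF k jk; rewrite jd_comm HF // d0. Qed.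

Lemma flat_d i F : flat F -> flat (d i F).
Proof. exact: d_d0. Qed.

Lemma flat_Tr F : flat F -> flat (Tr F).
Proof.
move=> HF i i4; rewrite d_Tr HF // Tr0 (_ : 2 == i = false) ?mul0r ?addr0 //.
by case: i i4 => [|[|[|]]].
Qed.

Lemma flatD F G : flat F -> flat G -> flat (F + G).
Proof. by move=> fF fG i i4; rewrite jdD fF // fG // addr0. Qed.
Lemma flatN F : flat F -> flat (- F).
Proof. by move=> fF i i4; rewrite dN fF // oppr0. Qed.
Lemma flatn n F : flat F -> flat (n%:R * F).
Proof. by move=> fF i i4; rewrite dn fF // mulr0. Qed.
Lemma flat0 : flat 0.
Proof. by move=> i _; rewrite d0. Qed.

Lemma D_flat F : flat F -> D F = Tr F + q * d 2 F + q ^+ 2 * d 3 F.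
Proof.
move=> HF; rewrite jD_base => [|i i5]; last by rewrite HF // ltnW.
by rewrite (HF 4) // mulr0 addr0 TrE.
Qed.

(** Differentiate in [q] and use induction on the degree. *)
Lemma poly_q_eq0 n (c : nat -> K) : (forall i, d 4 (c i) = 0) ->
  \sum_(i < n) c i * q ^+ i = 0 -> forall i, (i < n)%N -> c i = 0.
Proof.
elim: n c => [|n IH] c Hc; first by [].
rewrite big_ord_recl expr0 mulr1 => E0.
have Hi i : (i < n)%N -> c i.+1 = 0.
  move=> i_n; apply: (@jnatI _ J i.+1) => //; rewrite mulr0.
  apply: (IH (fun i => i.+1%:R * c i.+1)) => // [j|].
    by rewrite dn Hc mulr0.
  have : d 4 (c 0%N + \sum_(i < n) c (lift ord0 i) * q ^+ lift ord0 i) = 0.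
    by rewrite E0 d0.
  rewrite jdD Hc add0r => H; rewrite -[RHS]H.
  elim: {H}(index_enum _) => [|j r IHr]; first by rewrite !big_nil d0.
  rewrite !big_cons IHr jdD jdM Hc mul0r add0r; congr (_ + _).
  by rewrite /= /bump /= add1n dXn jdx /=; ring.
case=> [_|i]; last by rewrite ltnS; exact: Hi.
move: E0; rewrite big1 ?addr0 // => i _.
by rewrite /= /bump /= add1n Hi // mul0r.
Qed.

End Algebra.

(** * The two potentials of a symmetry *)

Section Potentials.
Variables (K : comNzRingType) (J : jet_calculus K).
Local Notation d := (jd J).
Local Notation D := (jD J).
Local Notation x := (jx J).
Local Notation Tr := (Tr J).
Local Notation flat := (flat J).
Local Notation p := (x 2).
Local Notation q := (x 4).
Local Notation q1 := (x 5).
Implicit Types f g F G : K.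

(** [[v, Pi] \subset Pi] for a vector field with components [V 0, .., V 4]: the
    bracket with [d_q] gives the conditions on the [q]-derivatives, the one with the
    other generator those on the total derivatives. *)
Record sym_eqs (V : nat -> K) : Prop := SymEqs {
  sym_base : forall j i, (j < 5)%N -> (5 <= i)%N -> d i (V j) = 0;
  sym_q1 : d 4 (V 1%N) = p * d 4 (V 0%N);
  sym_q2 : d 4 (V 2) = q * d 4 (V 0%N);
  sym_q3 : d 4 (V 3) = q ^+ 2 * d 4 (V 0%N);
  sym_D1 : V 2 = D (V 1%N) - p * D (V 0%N);
  sym_D2 : V 4 = D (V 2) - q * D (V 0%N);
  sym_D3 : D (V 3) = q ^+ 2 * D (V 0%N) + 2 * q * V 4 }.

(** The determining equations of the symmetries, in terms of
    [f = v^y - p v^x] and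
    [g = 3 (v^z - q^2 v^x) - 3 q^2 f_p - 4 q^3 f_z]. *)
Record potentials f g : Prop := Potentials {
  pot_f : flat f;
  pot_g : flat g;
  pot_pp : 3 * d 2 (d 2 f) = - (8 * Tr (d 3 f));
  pot_pz : d 2 (d 3 f) = 0;
  pot_zz : d 3 (d 3 f) = 0;
  pot_gT : Tr g = 0;
  pot_gp : d 2 g = 6 * Tr (Tr f);
  pot_gz : d 3 g = 9 * Tr (d 2 f) + 6 * d 1 f }.

(** The vector field with the potentials [f] and [g]. *)
Record generated_by f g (V : nat -> K) : Prop := GeneratedBy {
  gen0 : V 0%N = - (d 2 f + 2 * q * d 3 f);
  gen1 : V 1%N = f + p * V 0%N;
  gen2 : V 2 = D f + q * V 0%N;
  gen3 : 3 * V 3 = g + 3 * q ^+ 2 * d 2 f + 4 * q ^+ 3 * d 3 f + 3 * q ^+ 2 * V 0%N;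
  gen4 : V 4 = D (D f) + q1 * V 0%N }.

Ltac flat_tac := match goal with
  | |- flat (_ + _) => apply: flatD; flat_tac
  | |- flat (- _) => apply: flatN; flat_tac
  | |- flat (_%:R * _) => apply: flatn; flat_tac
  | |- flat (Tr _) => apply: flat_Tr; flat_tac
  | |- flat (jd _ _ _) => apply: flat_d; flat_tac
  | |- flat _ => assumption
  end.

(** The bracket of [d_q] and [D] is [d_p + 2 q d_z] on functions of order 0. *)
Lemma d4_D_base F : (forall i, (5 <= i)%N -> d i F = 0) ->
  d 4 (D F) = D (d 4 F) + d 2 F + 2 * q * d 3 F.
Proof.
move=> HF; have HF4 i : (5 <= i)%N -> d i (d 4 F) = 0 by exact: (d_d0 _ HF).
rewrite !jD_base // !(dE) /= !(jd_comm J 4).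
ring.
Qed.

(** The equation [v^z_q = q^2 v^x_q] says that [g] does not depend on [q].  The last
    symmetry equation is then a polynomial of degree 5 in [q] whose coefficients
    are functions of [x, y, p, z]; their vanishing gives the equations for the
    potentials. *)
Lemma sym_potentials V : sym_eqs V ->
  exists f g, potentials f g /\ generated_by f g V.
Proof.
move=> [Vb e1 e2 e3 s1 s2 s3].
have [f f_def] : exists f, f = V 1%N - p * V 0%N by eexists.
have [phi phi_def] : exists phi, phi = V 3 - q ^+ 2 * V 0%N by eexists.
have Vb0 i : (5 <= i)%N -> d i (V 0%N) = 0 by exact: Vb.
have Vb1 i : (5 <= i)%N -> d i (V 1%N) = 0 by exact: Vb.
have Vb3 i : (5 <= i)%N -> d i (V 3) = 0 by exact: Vb.
have xb j i : (j < 5)%N -> (5 <= i)%N -> d i (x j) = 0.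
  by move=> j5 i5; rewrite jdx; case: eqP => // ji; move: j5; rewrite ji ltnNge i5.
have f5 i : (5 <= i)%N -> d i f = 0.
  by move=> i5; rewrite f_def dB jdM Vb0 // Vb1 // xb //; ring.
have fq : d 4 f = 0 by rewrite f_def !dE e1 /=; ring.
have ff : flat f by move=> i; rewrite leq_eqVlt => /predU1P[<-|/f5].
have Df : D f = V 2 - q * V 0%N.
  by rewrite f_def !DE s1; ring.
have V0 : V 0%N = - (d 2 f + 2 * q * d 3 f).
  have := d4_D_base f5; rewrite fq Df dB jdM jdx e2 /= D0 add0r => <-.
  ring.
have DDf : D (D f) = V 4 - q1 * V 0%N.
  by rewrite Df !DE s2; ring.
have phi5 i : (5 <= i)%N -> d i phi = 0.
  move=> i5; rewrite phi_def !(dnat, dXn, dn, dB, dN, jdD, jdM) Vb0 // Vb3 // xb //; ring.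
have phiq : d 4 phi = - (2 * q * V 0%N).
  by rewrite phi_def !dE e3 /=; ring.
have Dphi : D phi = 2 * q * D (D f).
  by rewrite phi_def !DE s3 DDf; ring.
have [A A_def] : exists A, A = d 3 f by eexists.
have [B B_def] : exists B, B = d 2 f by eexists.
have [C C_def] : exists C, C = d 1 f by eexists.
have fA : flat A by rewrite A_def; exact: flat_d.
have fB : flat B by rewrite B_def; exact: flat_d.
have fTf : flat (Tr f) by exact: flat_Tr.
have [g g_def] : exists g, g = 3 * phi - 3 * q ^+ 2 * B - 4 * q ^+ 3 * A by eexists.
have fg : flat g.
  move=> i; rewrite leq_eqVlt => /predU1P[<-|i5].
    rewrite g_def !dE /= phiq V0 (fA 4) // (fB 4) // -A_def -B_def.
    ring.
  rewrite g_def !(dnat, dXn, dn, dB, dN, jdD, jdM) xb // phi5 // fA ?(ltnW i5) // fB ?(ltnW i5) //.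
  ring.
have DA := D_flat fA; have DB' := D_flat fB.
have DTf := D_flat fTf.
have Df' := D_flat ff.
have dTp : d 2 (Tr f) = Tr B + C by rewrite d_Tr eqxx mul1r -B_def -C_def.
have dTz : d 3 (Tr f) = Tr A by rewrite d_Tr mul0r addr0 -A_def.
have Bz : d 3 B = d 2 A by rewrite B_def jd_comm -A_def.
have key : D g + 3 * q ^+ 2 * D B + 4 * q ^+ 3 * D A =
    6 * q * (D (Tr f) + q * D B + q ^+ 2 * D A).
  have E1 : 3 * D phi = D g + 6 * q * q1 * B + 3 * q ^+ 2 * D B
      + 12 * q ^+ 2 * q1 * A + 4 * q ^+ 3 * D A.
    rewrite g_def !DE; ring.
  have E2 : D (D f) = D (Tr f) + q1 * B + q * D B + 2 * q * q1 * A + q ^+ 2 * D A.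
    rewrite {1}Df' !DE -A_def -B_def; ring.
  move: E1; rewrite Dphi E2 => E1.
  apply/eqP; rewrite -subr_eq0; apply/eqP.
  move/eqP: E1; rewrite -subr_eq0 => /eqP E1.
  rewrite -[RHS]oppr0 -[in RHS]E1; ring.
rewrite (D_flat fg) DA DB' DTf dTp dTz Bz in key.
(* The coefficients of [key] as a polynomial in [q]. *)
pose c i := nth (0 : K) [:: Tr g; d 2 g - 6 * Tr (Tr f);
   d 3 g + 3 * Tr B - 6 * (2 * Tr B + C);
   3 * d 2 B + 4 * Tr A - 6 * (2 * Tr A + d 2 B);
   7 * d 2 A - 12 * d 2 A; 4 * d 3 A - 6 * d 3 A] i.
have cq i : d 4 (c i) = 0.
  have fC : flat C by rewrite C_def; exact: flat_d.
  suff : flat (c i) by apply.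
  rewrite /c; case: i => [|[|[|[|[|[|i]]]]]] /=; try by flat_tac.
  by rewrite nth_nil; exact: flat0.
have csum : \sum_(i < 6) c i * q ^+ i = 0.
  rewrite !big_ord_recl big_ord0 /= /bump /= /c /=.
  move/eqP: key; rewrite -subr_eq0 => /eqP key; rewrite -[RHS]key.
  ring.
have c0 := poly_q_eq0 cq csum.
exists f, g; split.
  split=> //.
  - have := c0 3 isT; rewrite /c /= => /eqP; rewrite -A_def -B_def => H.
    apply/eqP; rewrite -subr_eq0; apply/eqP.
    move/eqP: H => H; rewrite -[RHS]oppr0 -H; ring.
  - apply: (@jnatI _ J 5) => //; rewrite mulr0 -[RHS]oppr0 -(c0 4 isT) /c /= -A_def; ring.
  - apply: (@jnatI _ J 2) => //; rewrite mulr0 -[RHS]oppr0 -(c0 5 isT) /c /= -A_def; ring.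
  - exact: (c0 0%N isT).
  - by apply/eqP; rewrite -subr_eq0; apply/eqP; exact: (c0 1%N isT).
  - apply/eqP; rewrite -subr_eq0; apply/eqP; rewrite -[RHS](c0 2 isT) /c /= -B_def -C_def.
    ring.
split=> //.
- by rewrite f_def; ring.
- by rewrite Df; ring.
- by rewrite g_def phi_def -A_def -B_def; ring.
- by rewrite DDf; ring.
Qed.

End Potentials.

(** * The structure functions of a symmetry *)

Section Structure.
Variables (K : comNzRingType) (J : jet_calculus K).
Local Notation d := (jd J).
Local Notation D := (jD J).
Local Notation x := (jx J).
Local Notation Tr := (Tr J).
Local Notation flat := (flat J).
Local Notation p := (x 2).
Local Notation q := (x 4).
Local Notation q1 := (x 5).
Local Notation q2 := (x 6).
Local Notation q3 := (x 7).
Implicit Types f g F G : K.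

(** Linear deduction: [L = L'] follows if a positive multiple of the difference is
    a combination of known equations.  In the proofs below the combinations are
    assembled with the next two lemmas. *)
Lemma eq_of_multiple n (L L' M N : K) : (0 < n)%N -> M = N ->
  n%:R * (L - L') = M - N -> L = L'.
Proof.
move=> n0 -> e; apply: (@jnatI _ J n) => //.
by apply/eqP; rewrite -subr_eq0 -mulrBr e subrr.
Qed.

Lemma add_eq (a b c e : K) : a = b -> c = e -> a + c = b + e.
Proof. by move=> -> ->. Qed.

Lemma scale_eq (c a b : K) : a = b -> c * a = c * b.
Proof. by move=> ->. Qed.

(** The total derivatives of these eight functions are expressed through themselves
    and [q_2, q_3], so that the prolongation of the symmetry to every order is a
    combination of them with coefficients in the jet variables.  In terms of the
    potential, [3 a = f_z], and the successive total derivatives of [a] are [a1],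
    [a2], [a3] and [q_2 a4]. *)
Record structure_functions (f : K) (V : nat -> K) (al al1 be a a1 a2 a3 a4 : K) : Prop :=
  StructureFunctions {
  st_al : D (V 0%N) = 2 * al;
  st_a : d 3 f = 3 * a;
  st_be : 2 * be = 3 * Tr (d 2 f) + 2 * d 1 f - 6 * q * a1 + 6 * q1 * a;
  st_a4 : d 1 (d 3 f) = 3 * a4;
  st_Dal : D al = al1;
  st_Dal1 : D al1 = - (5 * q2 * a1 + 3 * q3 * a);
  st_Dbe : D be = 3 * q2 * a;
  st_Da : D a = a1;
  st_Da1 : D a1 = a2;
  st_Da2 : D a2 = a3;
  st_Da3 : D a3 = q2 * a4;
  st_Da4 : D a4 = 0;
  st_eta2 : D (D (V 4) - q1 * D (V 0%N)) - q2 * D (V 0%N) = (be - 5 * al) * q2 }.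

(** Cross differentiation of the equations for [g] shows that [f_yz] is constant,
    and expresses [f_yp] and [f_yy] through derivatives of [f_z] along [d_x + p
    d_y].  All the identities of [structure_functions] are linear combinations of
    the resulting equations. *)
Lemma structure_functions_exist f g V : potentials J f g -> generated_by J f g V ->
  exists al al1 be a a1 a2 a3 a4, structure_functions f V al al1 be a a1 a2 a3 a4.
Proof.
move=> [ff fg pp pz zz gT gp gz] [V0 _ _ _ V4].
have [A A_def] : exists A, A = d 3 f by eexists.
have [B B_def] : exists B, B = d 2 f by eexists.
have [C C_def] : exists C, C = d 1 f by eexists.
have [A4 A4_def] : exists A4, A4 = d 1 A by eexists.
rewrite -A_def -B_def -?C_def in pp pz zz gp gz V0 *.
have fA : flat A by rewrite A_def; exact: flat_d.
have fB : flat B by rewrite B_def; exact: flat_d.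
have fC : flat C by rewrite C_def; exact: flat_d.
have fA4 : flat A4 by rewrite A4_def; exact: flat_d.
have TT F : flat F -> flat (Tr F) by exact: flat_Tr.
have dT i F : i != 2 -> d i (Tr F) = Tr (d i F).
  by move=> /negbTE i2; rewrite d_Tr eq_sym i2 mul0r addr0.
have d2T F : d 2 (Tr F) = Tr (d 2 F) + d 1 F by rewrite d_Tr eqxx mul1r.
have Bz : d 3 B = 0 by rewrite B_def jd_comm -A_def.
have By : d 1 B = d 2 C by rewrite B_def jd_comm -C_def.
have Cz : d 3 C = A4 by rewrite C_def jd_comm -A_def.
have TT3 F n : Tr (n%:R * F) = n%:R * Tr F by exact: Tr_natl.
have ppT : 3 * Tr (d 2 B) = - (8 * Tr (Tr A)) by rewrite -TT3 pp TrN TT3.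
have ppTT : 3 * Tr (Tr (d 2 B)) = - (8 * Tr (Tr (Tr A))).
  by rewrite -TT3 ppT TrN TT3.
(* The compatibility conditions of the three equations for [g]. *)
have gpz : d 3 (d 2 g) = 6 * Tr (Tr A) by rewrite gp dn !dT // -A_def.
have gzp : d 2 (d 3 g) = 9 * (Tr (d 2 B) + d 1 B) + 6 * d 2 C.
  by rewrite gz jdD !dn d2T.
have Cp : d 2 C = 2 * Tr (Tr A).
  apply: (@eq_of_multiple 15 _ _ _ _ _ (add_eq gpz (add_eq (esym gzp) (scale_eq 3 (esym ppT))))) => //.
  rewrite By (jd_comm J 3); ring.
have A4T : Tr A4 = 0.
  have e1 : d 2 (d 2 C) = 4 * Tr A4.
    rewrite Cp dn !d2T dT // -A4_def pz Tr0 add0r; ring.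
  have e2 : 3 * d 2 (d 2 C) = - (8 * Tr A4).
    rewrite -By (jd_comm J 2) -dn pp dN dn dT // -A4_def; ring.
  apply: (@eq_of_multiple 20 _ _ _ _ _ (add_eq (scale_eq 3 (esym e1)) e2)) => //; ring.
have A4p : d 2 A4 = 0 by rewrite A4_def jd_comm pz d0.
have A4z : d 3 A4 = 0 by rewrite A4_def jd_comm zz d0.
have TA2p : d 2 (Tr (Tr A)) = 0.
  by rewrite !d2T pz Tr0 add0r dT // -A4_def A4T addr0.
have TA2z : d 3 (Tr (Tr A)) = 0 by rewrite !dT // zz !Tr0.
have TA3p : d 2 (Tr (Tr (Tr A))) = 0.
  by rewrite d2T TA2p Tr0 add0r !dT // -A4_def A4T Tr0.
have TA3z : d 3 (Tr (Tr (Tr A))) = 0 by rewrite dT // TA2z Tr0.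
have gb : 9 * Tr (Tr B) + 6 * Tr C = 0.
  by rewrite -(TT3 (Tr B)) -(TT3 C) -TrD -gz -dT // gT d0.
have bC : 3 * Tr (Tr B) + 2 * Tr C = 0.
  apply: (@eq_of_multiple 3 _ _ _ _ _ gb) => //; ring.
have Cy : d 1 C = - (4 * Tr (Tr (Tr A))).
  have e1 : d 2 (3 * Tr (Tr B) + 2 * Tr C) = 0 by rewrite bC d0.
  have e2 : d 2 (3 * Tr (Tr B) + 2 * Tr C) = 3 * Tr (Tr (d 2 B)) +
     12 * Tr (Tr (Tr A)) + 4 * Tr (Tr (Tr A)) + 2 * d 1 C.
    rewrite jdD !dn !d2T TrD dT // By Cp !TT3; ring.
  apply: (@eq_of_multiple 2 _ _ _ _ _ (add_eq (esym e2) (add_eq e1 (esym ppTT)))) => //.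
  ring.
have A3T : Tr (Tr (Tr (Tr A))) = 0.
  have e1 : d 1 (3 * Tr (Tr B) + 2 * Tr C) = 0 by rewrite bC d0.
  have e2 : d 1 (3 * Tr (Tr B) + 2 * Tr C) = - (2 * Tr (Tr (Tr (Tr A)))).
    rewrite jdD !dn !dT // By Cp Cy TrN !TT3; ring.
  apply: (@eq_of_multiple 2 _ _ _ _ _ (add_eq (esym e1) e2)) => //; ring.
have gy : d 1 g = - (6 * Tr (Tr (Tr f))).
  have e1 := d2T g; rewrite gT gp TT3 in e1.
  have e2 : d 2 (0 : K) = 0 by rewrite d0.
  apply: (@eq_of_multiple 1 _ _ _ _ _ (add_eq (esym e1) e2)) => //; ring.
have T4f : Tr (Tr (Tr (Tr f))) = 0.
  have e1 : Tr (d 1 g) = 0 by rewrite -dT // gT d0.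
  rewrite gy TrN TT3 in e1.
  apply: (@eq_of_multiple 6 _ _ _ _ _ (esym e1)) => //; ring.
have T2f_p : d 2 (Tr (Tr f)) = Tr (Tr B) + 2 * Tr C.
  rewrite !d2T TrD dT // -B_def -C_def; ring.
have T3f_p : d 2 (Tr (Tr (Tr f))) = Tr (Tr (Tr B)) + 3 * Tr (Tr C).
  rewrite d2T T2f_p TrD TT3 !dT // -C_def; ring.
have [T3B TTC] : Tr (Tr (Tr B)) = 0 /\ Tr (Tr C) = 0.
  have e1 : 6 * Tr (Tr C) = - (6 * (Tr (Tr (Tr B)) + 3 * Tr (Tr C))).
    by rewrite -T3f_p -dn -dN -gy (jd_comm J 2) gp dn !dT // -C_def.
  have e2 : 3 * Tr (Tr (Tr B)) + 2 * Tr (Tr C) = 0.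
    by rewrite -(TT3 (Tr (Tr B))) -(TT3 (Tr C)) -TrD bC Tr0.
  have e3 : Tr (Tr C) = 0.
    apply: (@eq_of_multiple 20 _ _ _ _ _ (add_eq e1 (scale_eq 2 (esym e2)))) => //; ring.
  split=> //; rewrite e3 in e2.
  apply: (@eq_of_multiple 3 _ _ _ _ _ e2) => //; ring.
(* The total derivatives of all the functions that occur. *)
have DA : D A = Tr A by rewrite D_flat // pz zz; ring.
have DA1 : D (Tr A) = Tr (Tr A) + q * A4.
  rewrite D_flat; last exact: TT.
  rewrite d2T pz Tr0 dT // zz Tr0 -A4_def; ring.
have DTTA : D (Tr (Tr A)) = Tr (Tr (Tr A)).
  rewrite D_flat; last exact/TT/TT.
  rewrite TA2p TA2z; ring.
have DT3A : D (Tr (Tr (Tr A))) = 0.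
  rewrite D_flat; last exact/TT/TT/TT.
  rewrite TA3p TA3z A3T; ring.
have DA4 : D A4 = 0.
  rewrite D_flat // A4p A4z A4T; ring.
have TBp : 3 * d 2 (Tr B) = - (2 * Tr (Tr A)).
  rewrite d2T By Cp; apply: (@eq_of_multiple 1 _ _ _ _ _ ppT) => //; ring.
have TBz : d 3 (Tr B) = 0 by rewrite dT // Bz Tr0.
have DTB : 3 * D (Tr B) = 3 * Tr (Tr B) - 2 * q * Tr (Tr A).
  rewrite D_flat; last exact: TT.
  rewrite TBz; apply: (@eq_of_multiple 1 _ _ _ _ _ (scale_eq q TBp)) => //; ring.
have DB' : 3 * D B = 3 * Tr B - 8 * q * Tr A.
  rewrite D_flat // Bz; apply: (@eq_of_multiple 1 _ _ _ _ _ (scale_eq q pp)) => //; ring.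
have TTBp : 3 * d 2 (Tr (Tr B)) = 4 * Tr (Tr (Tr A)).
  have e : 3 * d 2 (Tr (Tr B)) = Tr (3 * d 2 (Tr B)) + 3 * Tr (d 1 B).
    rewrite TT3 (d2T (Tr B)) (dT 1%N) //; ring.
  rewrite e TBp TrN TT3 By Cp TT3; ring.
have DTTB : 3 * D (Tr (Tr B)) = 4 * q * Tr (Tr (Tr A)).
  rewrite D_flat; last exact/TT/TT.
  have -> : d 3 (Tr (Tr B)) = 0 by rewrite dT // TBz Tr0.
  rewrite T3B; apply: (@eq_of_multiple 1 _ _ _ _ _ (scale_eq q TTBp)) => //; ring.
have DC : D C = Tr C + 2 * q * Tr (Tr A) + q ^+ 2 * A4.
  rewrite D_flat // Cp Cz; ring.
have DTC : D (Tr C) = - (2 * q * Tr (Tr (Tr A))).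
  apply: (@eq_of_multiple 2 _ _ _ _ _ (_ : D (3 * Tr (Tr B) + 2 * Tr C) = 0)) => //.
    by rewrite bC D0.
  rewrite jDD !Dn DTTB; ring.
have DTTf : D (Tr (Tr f)) = Tr (Tr (Tr f)) + q * (Tr (Tr B) + 2 * Tr C)
     + q ^+ 2 * Tr (Tr A).
  rewrite D_flat; last exact/TT/TT.
  by rewrite T2f_p !dT // -A_def.
have DT3f : D (Tr (Tr (Tr f))) = q ^+ 2 * Tr (Tr (Tr A)).
  rewrite D_flat; last exact/TT/TT/TT.
  rewrite T4f T3f_p T3B TTC !dT // -A_def; ring.
have Df : D f = Tr f + q * B + q ^+ 2 * A by rewrite D_flat // -A_def -B_def.
have DTf : D (Tr f) = Tr (Tr f) + q * (Tr B + C) + q ^+ 2 * Tr A.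
  rewrite D_flat; last exact: TT.
  by rewrite d2T !dT // -A_def -B_def -C_def.
have D2f : 3 * V 4 = 3 * Tr (Tr f) + 6 * q * Tr B + 3 * q * C - 2 * q ^+ 2 * Tr A.
  apply: (@eq_of_multiple 1 _ _ _ _ _ (scale_eq q DB')) => //.
  rewrite V4 V0 Df !DE DTf DA; ring.
have DV4 : 3 * D (V 4) = 3 * Tr (Tr (Tr f)) + 9 * q * Tr (Tr B) + 9 * q * Tr C
    + 3 * q ^+ 2 * Tr (Tr A) + 6 * q1 * Tr B + 3 * q1 * C - 4 * q * q1 * Tr A
    + q ^+ 3 * A4.
  rewrite -Dn D2f !DE DTTf DC DA1.
  apply: (@eq_of_multiple 1 _ _ _ _ _ (scale_eq (2 * q) DTB)) => //; ring.
have DDV4 : 3 * D (D (V 4)) = 9 * q1 * Tr (Tr B) + 9 * q1 * Tr C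
    + 6 * q2 * Tr B + 6 * q1 * Tr (Tr B) + 3 * q2 * C + 3 * q1 * Tr C
    + 4 * q * q1 * Tr (Tr A) + 2 * q ^+ 2 * q1 * A4
    - 4 * q1 ^+ 2 * Tr A - 4 * q * q2 * Tr A.
  rewrite -Dn DV4 !DE (jDq J 1) DT3f DTC DC DTTA DA1 DA4.
  apply: (@eq_of_multiple 1 _ _ _ _ _ (add_eq (scale_eq (3 * q) DTTB) (scale_eq (2 * q1) DTB))) => //; ring.
have DV0 : 3 * D (V 0%N) = 2 * q * Tr A - 3 * Tr B - 6 * q1 * A.
  rewrite V0 !DE DA.
  apply: (@eq_of_multiple 1 _ _ _ _ _ (scale_eq (-1) DB')) => //; ring.
have DDV0 : 3 * D (D (V 0%N)) = 4 * q * Tr (Tr A) + 2 * q ^+ 2 * A4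
    - 3 * Tr (Tr B) - 4 * q1 * Tr A - 6 * q2 * A.
  rewrite -Dn DV0 !DE (jDq J 1) DA DA1.
  apply: (@eq_of_multiple 1 _ _ _ _ _ (scale_eq (-1) DTB)) => //; ring.
have DDDV0 : 3 * D (D (D (V 0%N))) = - (10 * q2 * Tr A) - 6 * q3 * A.
  rewrite -Dn DDV0 !DE (jDq J 1) (jDq J 2) DA DA1 DTTA DA4.
  apply: (@eq_of_multiple 1 _ _ _ _ _ (scale_eq (-1) DTTB)) => //; ring.
have [h h2] := jhalf J; have [k h3] := jthird J.
have kE F : 3 * (k * F) = F by rewrite mulrA h3 mul1r.
have hE F : 2 * (h * F) = F by rewrite mulrA h2 mul1r.
have Dk F : D (k * F) = k * D F.
  apply: (@jnatI _ J 3) => //; by rewrite -Dn !kE.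
have Dh F : D (h * F) = h * D F.
  apply: (@jnatI _ J 2) => //; by rewrite -Dn !hE.
have T3A4 : D (Tr (Tr A) + q * A4) = Tr (Tr (Tr A)) + q1 * A4.
  rewrite !DE DTTA DA4; ring.
exists (h * D (V 0%N)), (h * D (D (V 0%N))),
  (h * (3 * Tr B + 2 * C - 2 * q * Tr A + 2 * q1 * A)), (k * A), (k * Tr A),
  (k * (Tr (Tr A) + q * A4)), (k * (Tr (Tr (Tr A)) + q1 * A4)), (k * A4).
split; rewrite -?A_def -?A4_def ?hE ?kE ?Dh ?Dk //.
- rewrite -B_def -C_def.
  have -> : 6 * q * (k * Tr A) = 2 * q * (3 * (k * Tr A)) by ring.
  have -> : 6 * q1 * (k * A) = 2 * q1 * (3 * (k * A)) by ring.
  by rewrite !kE.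
- apply: (@eq_of_multiple 6 _ _ _ _ _ DDDV0) => //.
  have -> : 6 * (h * D (D (D (V 0%N))) - - (5 * q2 * (k * Tr A) + 3 * q3 * (k * A)))
    = 3 * (2 * (h * D (D (D (V 0%N))))) + 10 * q2 * (3 * (k * Tr A))
      + 6 * q3 * (3 * (k * A)) by ring.
  rewrite hE !kE; ring.
- rewrite !DE (jDq J 1) DC DA DA1.
  apply: (@eq_of_multiple 2 _ _ _ _ _ (add_eq DTB bC)) => //.
  set Y := 3 * D (Tr B) + _ - _ + _.
  have -> : 2 * (h * Y - 3 * q2 * (k * A)) = 2 * (h * Y) - 2 * q2 * (3 * (k * A)) by ring.
  rewrite hE kE /Y; ring.
- by rewrite DA.
- by rewrite DA1.
- by rewrite T3A4.
- rewrite !DE (jDq J 1) DT3A DA4; ring.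
- by rewrite DA4 mulr0.
apply: (@eq_of_multiple 6 _ _ _ _ _ (add_eq (scale_eq 2 DDV4) (add_eq (scale_eq (- 2 * q1) DDV0)
  (add_eq (scale_eq q2 DV0) (scale_eq (12 * q1) bC))))) => //.
set Y := 3 * Tr B + _ - _ + _.
rewrite !DE (jDq J 1).
have -> : 6 * (D (D (V 4)) - (q2 * D (V 0%N) + q1 * D (D (V 0%N))) -
    q2 * D (V 0%N) - (h * Y - 5 * (h * D (V 0%N))) * q2) =
  6 * D (D (V 4)) - 6 * (q2 * D (V 0%N) + q1 * D (D (V 0%N))) -
    6 * q2 * D (V 0%N) - 3 * (2 * (h * Y) - 5 * (2 * (h * D (V 0%N)))) * q2 by ring.
rewrite !hE /Y.
ring.
Qed.

End Structure.

(** * Relative invariance of R8 and R10 *)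

Section RelativeInvariants.
Variables (K : comNzRingType) (J : jet_calculus K).
Local Notation D := (jD J).
Local Notation x := (jx J).
Local Notation q1 := (x 5).
Local Notation q2 := (x 6).
Local Notation q3 := (x 7).
Local Notation q4 := (x 8).
Local Notation q5 := (x 9).
Local Notation q6 := (x 10).
Local Notation q7 := (x 11).
Local Notation q8 := (x 12).
Implicit Types F G : K.

Fixpoint etaK (V : nat -> K) (i : nat) : K :=
  if i is i'.+1 then D (etaK V i') - x (4 + i) * D (V 0%N) else V 4.

Definition prolongK (V : nat -> K) (j : nat) : K :=
  if j is i.+4 then etaK V i else V j.

Definition R8K : K :=
  196%N%:R * q2 ^+ 5 * q8 - 2352%N%:R * q2 ^+ 4 * q3 * q7
  - 5040%N%:R * q2 ^+ 4 * q4 * q6 - 3255%N%:R * q2 ^+ 4 * q5 ^+ 2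
  + 16632%N%:R * q2 ^+ 3 * q3 ^+ 2 * q6
  + 59598%N%:R * q2 ^+ 3 * q3 * q4 * q5 + 13772%N%:R * q2 ^+ 3 * q4 ^+ 3
  - 83160%N%:R * q2 ^+ 2 * q3 ^+ 3 * q5
  - 174735%N%:R * q2 ^+ 2 * q3 ^+ 2 * q4 ^+ 2
  + 297000%N%:R * q2 * q3 ^+ 4 * q4 - 118800%N%:R * q3 ^+ 6.

(** Four times [R10], which has integral coefficients. *)
Definition R10K : K :=
  84 * q2 * R8K * D (q2 * D R8K) - 91 * (q2 * D R8K) ^+ 2
  + 36 * R8K ^+ 2 * (13 * q3 ^+ 2 - 19 * q2 * q4).

Lemma Dq2 : D q2 = q3. Proof. exact: (jDq J 2). Qed.
Lemma Dq3 : D q3 = q4. Proof. exact: (jDq J 3). Qed.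
Lemma Dq4 : D q4 = q5. Proof. exact: (jDq J 4). Qed.
Lemma Dq5 : D q5 = q6. Proof. exact: (jDq J 5). Qed.
Lemma Dq6 : D q6 = q7. Proof. exact: (jDq J 6). Qed.
Lemma Dq7 : D q7 = q8. Proof. exact: (jDq J 7). Qed.
Definition DqE := (Dq2, Dq3, Dq4, Dq5, Dq6, Dq7).

Section Eta.
Variables (f : K) (V : nat -> K) (al al1 be a a1 a2 a3 a4 : K).
Hypothesis H : structure_functions J f V al al1 be a a1 a2 a3 a4.

Lemma etaS i : etaK V i.+1 = D (etaK V i) - x (4 + i.+1) * (2 * al).
Proof. by rewrite /= (st_al H). Qed.

Definition stE := (st_Dal H, st_Dal1 H, st_Dbe H, st_Da H, st_Da1 H, st_Da2 H,
  st_Da3 H, st_Da4 H).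

(** From here on each coefficient of the prolongation is the total derivative of
    the previous one, corrected by [2 al] times the jet variable. *)
Lemma eta2 : etaK V 2 = (be - 5 * al) * q2.
Proof. exact: (st_eta2 H). Qed.

Lemma eta3 : etaK V 3 = 3 * a * q2 ^+ 2 + (be - 7 * al) * q3 - 5 * al1 * q2.
Proof. rewrite etaS eta2 !(DE, stE, DqE); ring. Qed.

Lemma eta4 : etaK V 4 = 28 * a1 * q2 ^+ 2 + 24 * a * q2 * q3 - 12 * al1 * q3
  + (be - 9 * al) * q4.
Proof. rewrite etaS eta3 !(DE, stE, DqE); ring. Qed.

Lemma eta5 : etaK V 5 = 28 * a2 * q2 ^+ 2 + 140 * a1 * q2 * q3
  + a * (27 * q2 * q4 + 60 * q3 ^+ 2) - 21 * al1 * q4 + (be - 11 * al) * q5.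
Proof. rewrite etaS eta4 !(DE, stE, DqE); ring. Qed.

Lemma eta6 : etaK V 6 = 28 * a3 * q2 ^+ 2 + 196 * a2 * q2 * q3
  + a1 * (272 * q2 * q4 + 200 * q3 ^+ 2) + a * (30 * q2 * q5 + 210 * q3 * q4)
  - 32 * al1 * q5 + (be - 13 * al) * q6.
Proof.
rewrite etaS eta5 !(DE, stE, DqE); ring.
Qed.

Lemma eta7 : etaK V 7 = 28 * a4 * q2 ^+ 3 + 252 * a3 * q2 * q3
  + a2 * (468 * q2 * q4 + 396 * q3 ^+ 2)
  + a1 * (462 * q2 * q5 + 882 * q3 * q4)
  + a * (33 * q2 * q6 + 336 * q3 * q5 + 210 * q4 ^+ 2)
  - 45 * al1 * q6 + (be - 15 * al) * q7.
Proof.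
rewrite etaS eta6 !(DE, stE, DqE); ring.
Qed.

Lemma eta8 : etaK V 8 = 336 * a4 * q2 ^+ 2 * q3
  + a3 * (720 * q2 * q4 + 648 * q3 ^+ 2)
  + a2 * (930 * q2 * q5 + 2142 * q3 * q4)
  + a1 * (720 * q2 * q6 + 1680 * q3 * q5 + 1092 * q4 ^+ 2)
  + a * (36 * q2 * q7 + 504 * q3 * q6 + 756 * q4 * q5)
  - 60 * al1 * q7 + (be - 17 * al) * q8.
Proof.
rewrite etaS eta7 !(DE, stE, DqE); ring.
Qed.

Variable v : K -> K.
Hypothesis vD : forall F G, v (F + G) = v F + v G.
Hypothesis vM : forall F G, v (F * G) = v F * G + F * v G.
Hypothesis vx : forall j, v (x j) = prolongK V j.
Hypothesis v_comm : forall F, v (D F) = D (v F) - D (V 0%N) * D F.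

Definition vE := (fun n => deriv_nat vD vM n, fun F n => derivXn vM F n,
  fun n F => deriv_natl vD vM n F, derivB vD, derivN vD, vD, vM, vx).

(** A polynomial identity in the jet variables and the structure functions. *)
Lemma v_R8 : v R8K = (6 * be - 42 * al) * R8K.
Proof.
rewrite /R8K !vE /prolongK eta2 eta3 eta4 eta5 eta6 eta7 eta8.
ring.
Qed.

(** The factor of [R8] is differentiated along [D] using the equations of the
    structure functions; [R8] itself enters only through its factor. *)
Lemma v_R10 : v R10K = (14 * be - 98 * al) * R10K.
Proof.
have [r rE] : exists r, r = R8K by eexists.
have vr : v r = (6 * be - 42 * al) * r by rewrite rE v_R8.
have vDr : v (D r) = D (v r) - 2 * al * D r by rewrite v_comm (st_al H).
have vDDr : v (D (D r)) = D (v (D r)) - 2 * al * D (D r) by rewrite v_comm (st_al H).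
rewrite vDr vr in vDDr; rewrite vr in vDr.
rewrite /R10K -rE !DE Dq2 !vE vDDr vDr vr /prolongK eta2 eta3 eta4.
rewrite !(DE, stE, DqE); ring.
Qed.

End Eta.
End RelativeInvariants.

(** * Symmetries of the distribution as solutions of the symmetry equations *)

Section Bridge.
Variable R : realType.
Local Notation jfun := (jfun R).
Implicit Types t : jet R.

Lemma tder_q i : tder (sX R (4 + i)) = sX R (4 + i.+1).
Proof. exact: der_sX. Qed.

Lemma tder_base (F : jfun) : (forall i, (5 <= i)%N -> pder i F = 0) ->
  tder F = pder 0 F + sX R 2 * pder 1 F + sX R 4 * pder 2 F
    + sX R 4 ^+ 2 * pder 3 F + sX R 5 * pder 4 F.
Proof.
move=> HF; rewrite /tder (der_fin _ HF) !big_ord_recl big_ord0 addr0 !addrA.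
rewrite -[in RHS](mul1r (pder 0 F)). reflexivity.
Qed.

Lemma sC_invn n : (0 < n)%N -> n%:R * sC (n%:R^-1) = 1 :> jfun.
Proof.
move=> n0; apply: jfun_ext => t; rewrite sfE sfnE sf1E.
rewrite [sC _ t](_ : _ = n%:R^-1) // divff //.
by rewrite pnatr_eq0 -lt0n.
Qed.

Definition jfun_calculus : jet_calculus jfun := {|
  jd := @pder R;
  jD := @tder R;
  jx := sX R;
  jdD := fun i => derD _;
  jdM := fun i => derM _;
  jdx := @d_sX R;
  jd_comm := @d_comm R;
  jDD := derD _;
  jDM := derM _;
  jDp := der_sX _ 2;
  jDq := tder_q;
  jD_base := tder_base;
  jnatI := @jfun_natI R;
  jhalf := ex_intro _ _ (sC_invn (ltn0Sn 1));
  jthird := ex_intro _ _ (sC_invn (ltn0Sn 2)) |}.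

Lemma jsm_base (phi : E R 0 -> R) : smooth setT phi ->
  forall t, jsm t (fun t => phi (trunc 0 t)).
Proof.
move=> sp t; exists 0%N, setT; split=> //; split; first exact: openT.
by exists phi.
Qed.

Definition jbase (phi : E R 0 -> R) (sp : smooth setT phi) : jfun :=
  mk_jfun (jsm_base sp).

Lemma pder_jbase phi (sp : smooth setT phi) (j : 'I_5) t :
  pder j (jbase sp) t = 'D_(delta_mx 0 j) phi (trunc 0 t).
Proof.
rewrite pder_pd (@pd_jet _ 0 setT phi _ t j openT sp) // .
rewrite (insubT (fun i => i < 5)%N (ltn_ord j)).
by congr (derive _ _ (delta_mx 0 _)); apply: val_inj.
Qed.

Lemma pder_jbase_high phi (sp : smooth setT phi) j : (5 <= j)%N ->
  pder j (jbase sp) = 0.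
Proof.
move=> j5; apply: jfun_ext => t.
rewrite pder_pd (@pd_high _ 0 setT) //.
by split; [exact: openT|exists phi].
Qed.

Lemma Pi1E (m : E R 0) k : (k < 5)%N ->
  Pi1 m 0 (inord k) = [:: 1; m 0 (inord 2); m 0 (inord 4); m 0 (inord 4) ^+ 2; 0]`_k.
Proof. by move=> k5; rewrite mxE inordK. Qed.

Lemma Pi2E (m : E R 0) k : (k < 5)%N -> Pi2 m 0 (inord k) = (k == 4)%:R.
Proof.
move=> k5; rewrite mxE eqxx; congr (_%:R); congr nat_of_bool.
by rewrite andTb; apply/eqP/eqP => [/(congr1 val) /=|->//]; rewrite !inordK.
Qed.

Lemma row5P (v w : E R 0) :
  (forall k, (k < 5)%N -> v 0 (inord k) = w 0 (inord k)) -> v = w.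
Proof.
by move=> vw; apply/rowP => j; have := vw j (ltn_ord j); rewrite inord_val.
Qed.

(** The distribution is the common kernel of [dy - p dx], [dp - q dx] and
    [dz - q^2 dx]. *)
Lemma in_PiP (m w : E R 0) : in_Pi m w <->
  [/\ w 0 (inord 1) = m 0 (inord 2) * w 0 (inord 0),
      w 0 (inord 2) = m 0 (inord 4) * w 0 (inord 0) &
      w 0 (inord 3) = m 0 (inord 4) ^+ 2 * w 0 (inord 0)].
Proof.
have cE (a b : R) k : (k < 5)%N -> (a *: Pi1 m + b *: Pi2 m) 0 (inord k) =
    a * [:: 1; m 0 (inord 2); m 0 (inord 4); m 0 (inord 4) ^+ 2; 0]`_k
    + b * (k == 4)%:R.
  by move=> k5; rewrite mxE [X in X + _]mxE [X in _ + X]mxE Pi1E // Pi2E.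
split=> [[a [b ->]]|[e1 e2 e3]].
  by rewrite !cE //=; split; ring.
exists (w 0 (inord 0)), (w 0 (inord 4)); apply: row5P => k k5; rewrite cE //.
case: k k5 => [|[|[|[|[|//]]]]] _ /=; rewrite ?e1 ?e2 ?e3; ring.
Qed.

Lemma derive_rV n m (F : 'rV[R]_n -> 'rV[R]_m) a u j :
  (forall j, differentiable (fun a => F a 0 j) a) ->
  'D_u F a 0 j = 'D_u (fun a => F a 0 j) a.
Proof.
move=> dF; rewrite derive_mx ?mxE //; apply: diff_derivable.
rewrite (_ : F = fun a => \row_j F a 0 j); first exact: differentiable_row.
by apply/funext => b; apply/rowP => i; rewrite mxE.
Qed.

Lemma derive_coordv n (w m : 'rV[R]_n) j : 'D_w (fun a : 'rV[R]_n => a 0 j : R) m = w 0 j.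
Proof.
rewrite derive_row; last exact: differentiable_coord.
rewrite (bigD1 j) //= derive_coord eqxx mulr1 big1 ?addr0 // => i ij.
by rewrite derive_coord (negbTE ij) mulr0.
Qed.

Lemma sqr_coordE n (j : 'I_n) : (fun m : 'rV[R]_n => m 0 j ^+ 2) =
  (fun m : 'rV[R]_n => m 0 j : R) ^+ 2.
Proof. by apply/funext => a; rewrite !expr2. Qed.

Lemma differentiable_Pi1 (m : E R 0) j : differentiable (fun m => Pi1 m 0 j : R) m.
Proof.
have -> : (fun m => Pi1 m 0 j) = (fun m : E R 0 =>
    [:: 1; m 0 (inord 2); m 0 (inord 4); m 0 (inord 4) ^+ 2; 0]`_j).
  by apply/funext => a; rewrite mxE.
case: j => [] [|[|[|[|[|//]]]]] /= _.
- exact: differentiable_cst.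
- exact: differentiable_coord.
- exact: differentiable_coord.
- by rewrite sqr_coordE; apply: differentiableX; exact: differentiable_coord.
- exact: differentiable_cst.
Qed.

Lemma derive_Pi1 (w m : E R 0) k : (k < 5)%N -> 'D_w (@Pi1 R) m 0 (inord k) =
  [:: 0; w 0 (inord 2); w 0 (inord 4); 2 * m 0 (inord 4) * w 0 (inord 4); 0]`_k.
Proof.
move=> k5; rewrite derive_rV; last by move=> j; exact: differentiable_Pi1.
have -> : (fun m => Pi1 m 0 (inord k)) = (fun m : E R 0 =>
    [:: 1; m 0 (inord 2); m 0 (inord 4); m 0 (inord 4) ^+ 2; 0]`_k).
  by apply/funext => a; rewrite Pi1E.
case: k k5 => [|[|[|[|[|//]]]]] _ /=.
- exact: derive_cst.
- exact: derive_coordv.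
- exact: derive_coordv.
- rewrite sqr_coordE deriveX; last by apply: diff_derivable; exact: differentiable_coord.
  by rewrite derive_coordv /= expr1 -mulr_natl.
- exact: derive_cst.
Qed.

Lemma bracketE (v w : E R 0 -> E R 0) m j :
  bracket v w m 0 j = 'D_(v m) w m 0 j - 'D_(w m) v m 0 j.
Proof. by rewrite mxE [X in _ + X]mxE. Qed.

Section OneField.
Variable v : E R 0 -> E R 0.
Hypothesis sv : forall j : 'I_5, smooth setT (fun m => v m 0 j).

Definition Vj (j : nat) : jfun := jbase (sv (inord j)).

Lemma VjE j t : Vj j t = base_coef v j t. Proof. by []. Qed.

Lemma Vj_high j i : (5 <= i)%N -> pder i (Vj j) = 0.
Proof. exact: pder_jbase_high. Qed.

(** The generator [d_x + p d_y + q d_p + q^2 d_z] as a derivation. *)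
Definition X0 (F : jfun) : jfun :=
  pder 0 F + sX R 2 * pder 1 F + sX R 4 * pder 2 F + sX R 4 ^+ 2 * pder 3 F.

Lemma trunc0E t k : (k < 5)%N -> trunc 0 t 0 (inord k) = t k.
Proof. by move=> k5; rewrite mxE inordK. Qed.

Lemma sXE j t : sX R j t = t j. Proof. by []. Qed.

Lemma derive_v_Pi1 t k :
  'D_(Pi1 (trunc 0 t)) v (trunc 0 t) 0 (inord k) = X0 (Vj k) t.
Proof.
have dv j : differentiable (fun m => v m 0 j) (trunc 0 t).
  exact: (smooth_differentiable (sv j)).
rewrite derive_rV // derive_row //.
under eq_bigr => i _ do rewrite -(pder_jbase (sv (inord k)) i t) -[i in Pi1 _ 0 i]inord_val Pi1E //.
rewrite !big_ord_recl big_ord0 !trunc0E // /X0 !(sfXE, sfDE, sfME) !sXE.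
transitivity (1 * pder 0 (Vj k) t + (t 2%N * pder 1 (Vj k) t + (t 4%N * pder 2 (Vj k) t
  + (t 4%N ^+ 2 * pder 3 (Vj k) t + (0 * pder 4 (Vj k) t + 0))))); last by ring.
reflexivity.
Qed.

Lemma derive_v_Pi2 t k :
  'D_(Pi2 (trunc 0 t)) v (trunc 0 t) 0 (inord k) = pder 4 (Vj k) t.
Proof.
have dv j : differentiable (fun m => v m 0 j) (trunc 0 t).
  exact: (smooth_differentiable (sv j)).
have e4 : (inord 4 : 'I_5) = 4 :> nat by rewrite inordK.
by rewrite derive_rV // -(pder_jbase (sv (inord k)) (inord 4) t) e4.
Qed.

Lemma X0E F : (forall i, (5 <= i)%N -> pder i F = 0) ->
  X0 F = tder F - sX R 5 * pder 4 F.
Proof. by move=> /tder_base ->; rewrite addrK. Qed.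

Lemma symmetry_eqs : symmetry v <-> sym_eqs jfun_calculus Vj.
Proof.
have subE (a c y y' : R) : a - y = c * (0 - y') -> y = a + c * y'.
  by move=> e; rewrite sub0r mulrN in e; rewrite -[c * y']opprK -e; ring.
have oppE (c y y' : R) : - y = c * - y' -> y = c * y'.
  by rewrite mulrN => /oppr_inj.
have b1 t k : (k < 5)%N -> bracket v (@Pi1 R) (trunc 0 t) 0 (inord k) =
   [:: 0; Vj 2 t; Vj 4 t; 2 * t 4%N * Vj 4 t; 0]`_k - X0 (Vj k) t.
  move=> k5; rewrite bracketE derive_v_Pi1 derive_Pi1 //.
  by rewrite trunc0E //; case: k k5 => [|[|[|[|[|//]]]]].
have b2 t k : (k < 5)%N -> bracket v (@Pi2 R) (trunc 0 t) 0 (inord k) =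
   - pder 4 (Vj k) t.
  move=> k5; rewrite bracketE derive_v_Pi2.
  by rewrite derive_cst mxE add0r.
have hi k : forall i, (5 <= i)%N -> pder i (Vj k) = 0 by exact: Vj_high.
split=> [[_ H]|H].
  have H1 t : [/\ X0 (Vj 1) t = Vj 2 t + t 2%N * X0 (Vj 0) t,
      X0 (Vj 2) t = Vj 4 t + t 4%N * X0 (Vj 0) t &
      X0 (Vj 3) t = 2 * t 4%N * Vj 4 t + t 4%N ^+ 2 * X0 (Vj 0) t].
    have [/in_PiP] := H (trunc 0 t); rewrite !b1 // !trunc0E // => -[e1 e2 e3] _.
    by split; [exact: subE e1|exact: subE e2|exact: subE e3].
  have H2 t : [/\ pder 4 (Vj 1) t = t 2%N * pder 4 (Vj 0) t,
      pder 4 (Vj 2) t = t 4%N * pder 4 (Vj 0) t &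
      pder 4 (Vj 3) t = t 4%N ^+ 2 * pder 4 (Vj 0) t].
    have [_ /in_PiP] := H (trunc 0 t); rewrite !b2 // !trunc0E // => -[e1 e2 e3].
    by split; [exact: oppE e1|exact: oppE e2|exact: oppE e3].
  have e1 : pder 4 (Vj 1) = sX R 2 * pder 4 (Vj 0).
    by apply: jfun_ext => t; case: (H2 t).
  have e2 : pder 4 (Vj 2) = sX R 4 * pder 4 (Vj 0).
    by apply: jfun_ext => t; case: (H2 t).
  have e3 : pder 4 (Vj 3) = sX R 4 ^+ 2 * pder 4 (Vj 0).
    by apply: jfun_ext => t; rewrite !(sfXE, sfME); case: (H2 t).
  have x1 : X0 (Vj 1) = Vj 2 + sX R 2 * X0 (Vj 0).
    by apply: jfun_ext => t; case: (H1 t).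
  have x2 : X0 (Vj 2) = Vj 4 + sX R 4 * X0 (Vj 0).
    by apply: jfun_ext => t; case: (H1 t).
  have x3 : X0 (Vj 3) = 2 * sX R 4 * Vj 4 + sX R 4 ^+ 2 * X0 (Vj 0).
    by apply: jfun_ext => t; rewrite !(sfXE, sfnE, sfDE, sfME); case: (H1 t).
  move: x1 x2 x3; rewrite (X0E (hi 0%N)) (X0E (hi 1%N)) (X0E (hi 2)) (X0E (hi 3)).
  rewrite e1 e2 e3 => x1 x2 x3.
  have rE (T1 w c d0 V2 T0 : jfun) : T1 - w * (c * d0) = V2 + c * (T0 - w * d0) ->
      T1 = V2 + c * T0.
    move=> e; rewrite -[T1](subrK (w * (c * d0))) e; ring.
  have {}x1 := rE _ _ _ _ _ _ x1; have {}x2 := rE _ _ _ _ _ _ x2.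
  have {}x3 := rE _ _ _ _ _ _ x3.
  have s1 : Vj 2 = tder (Vj 1) - sX R 2 * tder (Vj 0) by rewrite x1 addrK.
  have s2 : Vj 4 = tder (Vj 2) - sX R 4 * tder (Vj 0) by rewrite x2 addrK.
  have s3 : tder (Vj 3) = sX R 4 ^+ 2 * tder (Vj 0) + 2 * sX R 4 * Vj 4.
    by rewrite x3 addrC.
  by split=> // j i _; exact: hi.
split=> // m; rewrite -(trunc_ext m); set t := ext m.
have e1 : pder 4 (Vj 1) = sX R 2 * pder 4 (Vj 0) := sym_q1 H.
have e2 : pder 4 (Vj 2) = sX R 4 * pder 4 (Vj 0) := sym_q2 H.
have e3 : pder 4 (Vj 3) = sX R 4 ^+ 2 * pder 4 (Vj 0) := sym_q3 H.
have s1 : Vj 2 = tder (Vj 1) - sX R 2 * tder (Vj 0) := sym_D1 H.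
have s2 : Vj 4 = tder (Vj 2) - sX R 4 * tder (Vj 0) := sym_D2 H.
have s3 : tder (Vj 3) = sX R 4 ^+ 2 * tder (Vj 0) + 2 * sX R 4 * Vj 4 := sym_D3 H.
have x1 : X0 (Vj 1) = Vj 2 + sX R 2 * X0 (Vj 0).
  by rewrite (X0E (hi 0%N)) (X0E (hi 1%N)) e1 s1; ring.
have x2 : X0 (Vj 2) = Vj 4 + sX R 4 * X0 (Vj 0).
  by rewrite (X0E (hi 0%N)) (X0E (hi 2%N)) e2 s2; ring.
have x3 : X0 (Vj 3) = 2 * sX R 4 * Vj 4 + sX R 4 ^+ 2 * X0 (Vj 0).
  by rewrite (X0E (hi 0%N)) (X0E (hi 3%N)) e3 s3; ring.
have subE' (a c y y' : R) : y = a + c * y' -> a - y = c * (0 - y').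
  by move=> ->; ring.
have oppE' (c y y' : R) : y = c * y' -> - y = c * - y' by move=> ->; rewrite mulrN.
split; apply/in_PiP.
  rewrite !b1 // !trunc0E //.
  have y1 : X0 (Vj 1) t = Vj 2 t + t 2%N * X0 (Vj 0) t by rewrite x1.
  have y2 : X0 (Vj 2) t = Vj 4 t + t 4%N * X0 (Vj 0) t by rewrite x2.
  have y3 : X0 (Vj 3) t = 2 * t 4%N * Vj 4 t + t 4%N ^+ 2 * X0 (Vj 0) t.
    by rewrite x3 !(sfXE, sfnE, sfDE, sfME).
  by split; [exact: subE' y1|exact: subE' y2|exact: subE' y3].
rewrite !b2 // !trunc0E //.
have y1 : pder 4 (Vj 1) t = t 2%N * pder 4 (Vj 0) t by rewrite e1.
have y2 : pder 4 (Vj 2) t = t 4%N * pder 4 (Vj 0) t by rewrite e2.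
have y3 : pder 4 (Vj 3) t = t 4%N ^+ 2 * pder 4 (Vj 0) t by rewrite e3 !(sfXE, sfME).
by split; [exact: oppE' y1|exact: oppE' y2|exact: oppE' y3].
Qed.

End OneField.

End Bridge.

(** * Infinitesimal factors and orders of jet functions *)

Section Weights.
Context {R : realType}.
Implicit Types (t : jet R) (f g : jet R -> R) (X : nat -> jet R -> R).

(** Infinitesimal factors add under products, so that the invariance of a quotient
    of relative invariants is an identity between factors.  A factor may vary with
    the jet; only its value at [t] is recorded. *)
Definition weight X t f (w : R) := jsm t f /\ lie X f t = w * f t.

Lemma weightM X t f g w w' : weight X t f w -> weight X t g w' ->
  weight X t (fun t => f t * g t) (w + w').
Proof.
move=> [sf ef] [sg eg]; split; first exact: jsmM.
by rewrite lieM // ef eg; ring.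
Qed.

Lemma weightX X t f w n : weight X t f w ->
  weight X t (fun t => f t ^+ n) (n%:R * w).
Proof.
move=> Hf; elim: n => [|n IH].
  by split; [exact: jsm_cst|rewrite lie_cst !mul0r].
have -> : (fun t => f t ^+ n.+1) = (fun t => f t * f t ^+ n).
  by apply/funext => s; rewrite exprS.
by rewrite -natr1 mulrDl mul1r addrC; exact: weightM.
Qed.

Lemma weightV X t f w : f t != 0 -> weight X t f w ->
  weight X t (fun t => (f t)^-1) (- w).
Proof.
move=> f0 [sf ef]; have sV := jsmV f0 sf; split=> //.
have : lie X (fun t => f t * (f t)^-1) t = 0.
  rewrite -[RHS](lie_cst X t 1); apply: lie_near_eq.
  by apply: filterS (jsm_neq0 sf f0) => s s0; rewrite divff.
rewrite lieM // ef -mulrA mulfV // mulr1 => /eqP; rewrite addrC addr_eq0 => /eqP e.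
by apply: (mulfI f0); rewrite e; rewrite mulrCA mulfV // mulr1.
Qed.

Lemma weight_abs_powR X t f w r : f t != 0 -> weight X t f w ->
  weight X t (fun t => `|f t| `^ r) (r * w).
Proof.
move=> f0 [sf ef]; have sp := jsm_abs_powR r f0 sf; split=> //.
rewrite (@lie_comp1 _ X t f (fun y => `|y| `^ r) _ sf sp (is_derive_abs_powR r f0)) ef.
by rewrite [w * f t]mulrC mulrA divfK // mulrAC.
Qed.

End Weights.

Section Order.
Context {R : realType}.
Implicit Types (t : jet R) (f g : jet R -> R) (X : nat -> jet R -> R).

Lemma jet_functionD k (U : set (E R k)) f g :
  jet_function U f -> jet_function U g -> jet_function U (fun t => f t + g t).
Proof.
move=> [oU [a sa fa]] [_ [b sb gb]]; split=> //; exists (fun x => a x + b x).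
  by apply/smooth_Ck => n; apply: CkD => //; exact: smoothCk.
by move=> t Ut; rewrite fa // gb.
Qed.

Lemma jet_functionM k (U : set (E R k)) f g :
  jet_function U f -> jet_function U g -> jet_function U (fun t => f t * g t).
Proof.
move=> [oU [a sa fa]] [_ [b sb gb]]; split=> //; exists (fun x => a x * b x).
  by apply/smooth_Ck => n; apply: CkM => //; exact: smoothCk.
by move=> t Ut; rewrite fa // gb.
Qed.

Lemma jet_function_cst k (U : set (E R k)) c : open U -> jet_function U (fun=> c).
Proof.
move=> oU; split=> //; exists (fun=> c) => //.
by apply/smooth_Ck => n; exact: Ck_cst.
Qed.

Lemma jet_function_coord k (U : set (E R k)) j : open U -> (j < 5 + k)%N ->
  jet_function U (fun t => t j).
Proof.
move=> oU jk; split=> //; exists (fun a => a 0 (Ordinal jk)).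
  by apply/smooth_Ck => n; exact: Ck_coord.
by move=> t _; rewrite mxE.
Qed.

Lemma jet_functionX k (U : set (E R k)) f n :
  jet_function U f -> jet_function U (fun t => f t ^+ n).
Proof.
move=> Hf; elim: n => [|n IH]; first by apply: jet_function_cst; case: Hf.
rewrite (_ : (fun t => _) = fun t => f t * f t ^+ n); first exact: jet_functionM.
by apply/funext => t; rewrite exprS.
Qed.

Lemma jet_functionN k (U : set (E R k)) f :
  jet_function U f -> jet_function U (fun t => - f t).
Proof.
move=> Hf; rewrite (_ : (fun t => - f t) = fun t => (-1) * f t).
  by apply: jet_functionM => //; apply: jet_function_cst; case: Hf.
by apply/funext => t; rewrite mulN1r.
Qed.

Lemma jet_functionV k (U : set (E R k)) f : jet_function U f ->
  (forall t, U (trunc k t) -> f t != 0) -> jet_function U (fun t => (f t)^-1).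
Proof.
move=> [oU [a sa fa]] f0; split=> //; exists (fun x => (a x)^-1).
  apply/smooth_Ck => n; apply: CkV => //; last exact: smoothCk.
  by move=> x Ux; rewrite -(trunc_ext x) -fa ?f0 ?trunc_ext.
by move=> t Ut; rewrite fa.
Qed.

Lemma jet_function_abs_powR k (U : set (E R k)) f r : jet_function U f ->
  (forall t, U (trunc k t) -> f t != 0) ->
  jet_function U (fun t => `|f t| `^ r).
Proof.
move=> [oU [a sa fa]] f0; split=> //; exists (fun x => `|a x| `^ r).
  apply/smooth_Ck => n; apply: Ck_abs_powR => //; last exact: smoothCk.
  by move=> x Ux; rewrite -(trunc_ext x) -fa ?f0 ?trunc_ext.
by move=> t Ut; rewrite fa.
Qed.

Lemma jet_function_sum k (U : set (E R k)) (I : Type) (r : seq I) (F : I -> jet R -> R) :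
  open U -> (forall i, jet_function U (F i)) ->
  jet_function U (fun t => \sum_(i <- r) F i t).
Proof.
move=> oU HF; elim: r => [|i r IH].
  rewrite (_ : (fun t => _) = fun=> 0); first exact: jet_function_cst.
  by apply/funext => t; rewrite big_nil.
rewrite (_ : (fun t => _) = fun t => F i t + \sum_(j <- r) F j t).
  exact: jet_functionD.
by apply/funext => t; rewrite big_cons.
Qed.

Lemma jet_function_eq k (U : set (E R k)) f g :
  (forall t, U (trunc k t) -> f t = g t) -> jet_function U f -> jet_function U g.
Proof.
move=> fg [oU [a sa fa]]; split=> //; exists a => // t Ut.
by rewrite -fg // fa.
Qed.

Lemma jet_function_Dx k (U : set (E R k)) f : jet_function U f ->
  jet_function (proj (leqnSn k) @^-1` U) (Dx f).
Proof.
move=> Hf; set V := _ @^-1` U.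
have oV : open V by apply: open_preim_proj; case: Hf.
apply: (@jet_function_eq k.+1 V
    (fun t => \sum_(j < 5 + k) total_field j t * pd j f t)).
  move=> t; rewrite /V /= proj_trunc => Ut.
  by rewrite /Dx (lie_jet _ Hf Ut (leqnn _)).
apply: jet_function_sum => // j; apply: jet_functionM; last first.
  exact/jet_function_raise/jet_function_pd.
have cf i : (i < 5 + k.+1)%N -> jet_function V (fun t => t i).
  exact: jet_function_coord.
case: j => [] [|[|[|[|j]]]] /= jk.
- exact: jet_function_cst.
- exact: cf.
- exact: cf.
- by apply: jet_functionX; exact: cf.
- by apply: cf; rewrite addnS ltnS.
Qed.

Lemma jet_function_dep k (U : set (E R k)) f t t' : jet_function U f ->
  U (trunc k t) -> trunc k t = trunc k t' -> f t = f t'.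
Proof. by move=> [_ [g _ fg]] Ut tt'; rewrite !fg -?tt'. Qed.

End Order.

Section Symmetry.
Variable R : realType.
Local Notation jfun := (jfun R).
Local Notation J := (jfun_calculus R).
Implicit Types (t : jet R) (f : jet R -> R).

Section OneSymmetry.
Variable v : E R 0 -> E R 0.
Hypothesis sv : forall j : 'I_5, smooth setT (fun m => v m 0 j).
Hypothesis symv : symmetry v.
Local Notation V := (Vj sv).

Definition PrJ (j : nat) : jfun := prolongK J V j.

Lemma etaE i t : etaK J V i t = eta v i t.
Proof.
suff -> : etaK J V i = eta v i :> (jet R -> R) by [].
elim: i => [|i IH] //; apply/funext => s.
have -> : etaK J V i.+1 = tder (etaK J V i) - sX R (4 + i.+1) * tder (V 0%N) by [].
by rewrite sfDE sfNE sfME !tder_Dx IH.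
Qed.

Lemma PrJE j t : PrJ j t = prolong v j t.
Proof. by case: j => [|[|[|[|j]]]] //; exact: etaE. Qed.

(** A prolonged symmetry preserves the line field of the total derivative: its
    bracket with [Dx] is a multiple of [Dx].  On the coordinates of [M] this is the
    system of symmetry equations, on the [q_i] it is the prolongation formula. *)
Lemma PrJ_tf j : der PrJ (tf R j) - tder (PrJ j) = - tder (V 0%N) * tf R j.
Proof.
have H := (symmetry_eqs sv).1 symv.
have [s1 s2 s3] := And3 (sym_D1 H) (sym_D2 H) (sym_D3 H).
have e1 : V 2 = tder (V 1%N) - sX R 2 * tder (V 0%N) by exact: s1.
have e2 : V 4 = tder (V 2%N) - sX R 4 * tder (V 0%N) by exact: s2.
have e3 : tder (V 3) = sX R 4 ^+ 2 * tder (V 0%N) + 2 * sX R 4 * V 4 by exact: s3.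
case: j => [|[|[|[|j]]]].
- have -> : tf R 0 = 1 by [].
  by rewrite der1 mulr1 sub0r.
- have -> : tf R 1%N = sX R 2 by [].
  rewrite der_sX (_ : PrJ 2 = V 2) // e1 (_ : PrJ 1%N = V 1%N) //; ring.
- have -> : tf R 2 = sX R 4 by [].
  rewrite der_sX (_ : PrJ 4 = V 4) // e2 (_ : PrJ 2 = V 2%N) //; ring.
- have -> : tf R 3 = sX R 4 ^+ 2 by [].
  rewrite derXn der_sX (_ : PrJ 4 = V 4) // (_ : PrJ 3 = V 3) // e3; ring.
- have -> : tf R j.+4 = sX R (4 + j.+1) by [].
  rewrite der_sX.
  have -> : PrJ (4 + j.+1) = tder (PrJ j.+4) - sX R (4 + j.+1) * tder (V 0%N) by [].
  ring.
Qed.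

Lemma PrJ_comm (F : jfun) :
  der PrJ (tder F) = tder (der PrJ F) - tder (V 0%N) * tder F.
Proof.
rewrite {1}/tder der_comm -/(tder _); congr (_ + _).
rewrite (der_eq F PrJ_tf) der_vecZ mulNr; reflexivity.
Qed.

Lemma lie_prolong_Dx t f : jsm t f ->
  lie (prolong v) (Dx f) t =
  Dx (lie (prolong v) f) t - tder (V 0%N) t * Dx f t.
Proof.
move=> sf.
have eP g s : lie (prolong v) g s = lie (fun j => PrJ j) g s.
  by apply: lie_ext => j; rewrite PrJE.
have eT g s : Dx g s = lie (fun j => tf R j) g s.
  by apply: lie_ext => j; rewrite tfE.
have fP g : lie (prolong v) g = lie (fun j => PrJ j) g by apply/funext => s.
have fT g : Dx g = lie (fun j => tf R j) g by apply/funext => s.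
rewrite !fP !fT.
have sP j : jsm t (PrJ j) by exact: jfunP.
have sT j : jsm t (tf R j) by exact: jfunP.
have e := lie_commutator sP sT sf.
have e2 := lie_scale (- tder (V 0%N) t) (fun j => tf R j) sf.
have e3 : lie (fun j t => lie (fun j => PrJ j) (tf R j) t - lie (fun j => tf R j) (PrJ j) t) f t
    = lie (fun j s => - tder (V 0%N) t * tf R j s) f t.
  apply: lie_ext => j.
  have := congr1 (fun F : jfun => F t) (PrJ_tf j).
  by rewrite sfDE sfNE sfME sfNE.
rewrite e3 e2 mulNr in e.
by move/eqP: e; rewrite subr_eq [X in _ == X]addrC => /eqP.
Qed.

End OneSymmetry.
End Symmetry.

(** * Invariance of I10 and of the derivation *)

Section Invariance.
Variable R : realType.
Local Notation jfun := (jfun R).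
Local Notation J := (jfun_calculus R).
Implicit Types (t : jet R) (f : jet R -> R).

Ltac jet_order := lazymatch goal with
  | |- jet_function _ (fun t => @?f t + @?g t) => apply: jet_functionD; jet_order
  | |- jet_function _ (fun t => - @?f t) => apply: jet_functionN; jet_order
  | |- jet_function _ (fun t => @?f t * @?g t) => apply: jet_functionM; jet_order
  | |- jet_function _ (fun t => @?f t ^+ _) => apply: jet_functionX; jet_order
  | |- _ => solve [auto]
  end.

Lemma R8_order : jet_function (setT : set (E R 8)) (@R8 R).
Proof.
have c j : (j < 13)%N -> jet_function (setT : set (E R 8)) (fun t => t j).
  by move=> j13; apply: jet_function_coord => //; exact: openT.
have k a : jet_function (setT : set (E R 8)) (fun=> a).
  by apply: jet_function_cst; exact: openT.
by cbv beta zeta delta [R8 jq]; jet_order.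
Qed.

Lemma jet_function_DxT k f : jet_function (setT : set (E R k)) f ->
  jet_function (setT : set (E R k.+1)) (Dx f).
Proof. by move=> /jet_function_Dx; rewrite preimage_setT. Qed.

Lemma jet_function_raiseT k l f : (k <= l)%N ->
  jet_function (setT : set (E R k)) f -> jet_function (setT : set (E R l)) f.
Proof. by move=> kl /(jet_function_raise kl); rewrite preimage_setT. Qed.

Lemma jet_functionT k j (U : set (E R k)) f : open U -> (j <= k)%N ->
  jet_function (setT : set (E R j)) f -> jet_function U f.
Proof. by move=> oU jk /(jet_function_raiseT jk); exact: jet_functionW. Qed.

Lemma DR8_order : jet_function (setT : set (E R 9)) (derivation (jq 2) (@R8 R)).
Proof.
apply: jet_functionM; first by apply: jet_function_coord => //; exact: openT.
exact/jet_function_DxT/R8_order.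
Qed.

Lemma R10_order : jet_function (setT : set (E R 10)) (@R10 R).
Proof.
have c j : (j < 15)%N -> jet_function (setT : set (E R 10)) (fun t => t j).
  by move=> j13; apply: jet_function_coord => //; exact: openT.
have k a : jet_function (setT : set (E R 10)) (fun=> a).
  by apply: jet_function_cst; exact: openT.
have r8 : jet_function (setT : set (E R 10)) (@R8 R).
  exact: (jet_function_raiseT _ R8_order).
have dr8 : jet_function (setT : set (E R 10)) (derivation (jq 2) (@R8 R)).
  exact: (jet_function_raiseT _ DR8_order).
have ddr8 : jet_function (setT : set (E R 10)) (Dx (derivation (jq 2) (@R8 R))).
  exact/jet_function_DxT/DR8_order.
by cbv beta zeta delta [R10 jq]; jet_order.
Qed.

(** The images of the regular jets, which are the domains of [I10] and of the
    derivation. *)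
Definition Reg k : set (E R k) := trunc k @` @regular R.
Arguments Reg : clear implicits.

Lemma RegP k t : (8 <= k)%N -> Reg k (trunc k t) <-> regular t.
Proof.
move=> k8; split=> [[t' rt' tt']|rt]; last by exists t.
rewrite /regular /= -(jet_function_dep (jet_function_raiseT k8 R8_order) _ tt') //.
Qed.

Lemma Reg_open k : (8 <= k)%N -> open (Reg k).
Proof.
move=> k8.
have [sg gE] := jet_function_ext (jet_function_raiseT k8 R8_order).
have -> : Reg k = [set a | R8 (ext a) != 0].
  apply/seteqP; split=> a Ha; last by rewrite -(trunc_ext a); exact/(RegP _ k8).
  by move: Ha; rewrite -{1}(trunc_ext a) => /(RegP _ k8).
rewrite openE => a /= a0.
have C := differentiable_continuous (smooth_differentiable sg (I : setT a)).
have N : nbhs (R8 (ext a)) [set x | x != 0] by exact: open_nbhs_nbhs.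
exact: (C _ N).
Qed.

Lemma I10_order : jet_function (Reg 10) (@I10 R).
Proof.
have o := @Reg_open 10 isT.
apply: jet_functionM.
  by apply: jet_functionX; exact: jet_functionT R10_order.
apply: jet_functionV; last by move=> t /RegP rt; rewrite expf_eq0 /=; exact: rt.
by apply: jet_functionX; exact: jet_functionT R8_order.
Qed.

Lemma box_order : jet_function (Reg 8) (@box_coef R).
Proof.
have o := @Reg_open 8 isT.
apply: jet_functionM; first exact: jet_function_coord.
apply: jet_functionV.
  apply: jet_function_abs_powR; first exact: jet_functionT R8_order.
  by move=> t /RegP; apply.
by move=> t /RegP rt; rewrite gt_eqF // powR_gt0 // normr_gt0; exact: rt.
Qed.

Lemma jsm_jet_function k (U : set (E R k)) f t : jet_function U f ->
  U (trunc k t) -> jsm t f.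
Proof. by move=> Hf Ut; exists k, U. Qed.

Lemma jsm_Dx f t : jsm t f -> jsm t (Dx f).
Proof.
apply: jsm_lie => j.
rewrite (_ : total_field j = tf R j); first exact: jfunP.
by apply/funext => s; rewrite tfE.
Qed.

(** Evaluation at a jet is a ring morphism; the coefficients stay symbolic. *)
Lemma eval_R8_shape (c1 c2 c3 c4 c5 c6 c7 c8 c9 c10 c11 : nat)
    (q2 q3 q4 q5 q6 q7 q8 : jfun) t :
  (c1%:R * q2 ^+ 5 * q8 - c2%:R * q2 ^+ 4 * q3 * q7
  - c3%:R * q2 ^+ 4 * q4 * q6 - c4%:R * q2 ^+ 4 * q5 ^+ 2
  + c5%:R * q2 ^+ 3 * q3 ^+ 2 * q6
  + c6%:R * q2 ^+ 3 * q3 * q4 * q5 + c7%:R * q2 ^+ 3 * q4 ^+ 3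
  - c8%:R * q2 ^+ 2 * q3 ^+ 3 * q5
  - c9%:R * q2 ^+ 2 * q3 ^+ 2 * q4 ^+ 2
  + c10%:R * q2 * q3 ^+ 4 * q4 - c11%:R * q3 ^+ 6) t =
  c1%:R * q2 t ^+ 5 * q8 t - c2%:R * q2 t ^+ 4 * q3 t * q7 t
  - c3%:R * q2 t ^+ 4 * q4 t * q6 t - c4%:R * q2 t ^+ 4 * q5 t ^+ 2
  + c5%:R * q2 t ^+ 3 * q3 t ^+ 2 * q6 t
  + c6%:R * q2 t ^+ 3 * q3 t * q4 t * q5 t + c7%:R * q2 t ^+ 3 * q4 t ^+ 3
  - c8%:R * q2 t ^+ 2 * q3 t ^+ 3 * q5 t
  - c9%:R * q2 t ^+ 2 * q3 t ^+ 2 * q4 t ^+ 2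
  + c10%:R * q2 t * q3 t ^+ 4 * q4 t - c11%:R * q3 t ^+ 6.
Proof. by rewrite !(sfXE, sfnE, sfDE, sfNE, sfME). Qed.

Lemma R8KE t : (R8K J : jfun) t = R8 t.
Proof. exact: eval_R8_shape. Qed.

Lemma eval_R10_shape (c1 c2 c3 c4 c5 : nat) (q2 q3 q4 r h h' : jfun) t :
  (c1%:R * q2 * r * h' - c2%:R * h ^+ 2
    + c3%:R * r ^+ 2 * (c4%:R * q3 ^+ 2 - c5%:R * q2 * q4)) t =
  c1%:R * q2 t * r t * h' t - c2%:R * h t ^+ 2
    + c3%:R * r t ^+ 2 * (c4%:R * q3 t ^+ 2 - c5%:R * q2 t * q4 t).
Proof. by rewrite !(sfXE, sfnE, sfDE, sfNE, sfME). Qed.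

Lemma R10KE t : (R10K J : jfun) t = 4 * R10 t.
Proof.
have R8e : R8K J = @R8 R :> (jet R -> R) by apply/funext => s; exact: R8KE.
have DR8e : sX R 6 * tder (R8K J) = derivation (jq 2) (@R8 R) :> (jet R -> R).
  by apply/funext => s; rewrite sfME tder_Dx R8e.
have e1 : (tder (sX R 6 * tder (R8K J))) t = Dx (derivation (jq 2) (@R8 R)) t.
  by rewrite tder_Dx DR8e.
have e2 : (sX R 6 * tder (R8K J)) t = derivation (jq 2) (@R8 R) t by rewrite DR8e.
have -> : (R10K J : jfun) t = 84 * jq 2 t * R8 t * Dx (derivation (jq 2) (@R8 R)) t
    - 91 * derivation (jq 2) (@R8 R) t ^+ 2
    + 36 * R8 t ^+ 2 * (13 * jq 3 t ^+ 2 - 19 * jq 2 t * jq 4 t).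
  rewrite -R8KE -e1 -e2; exact: eval_R10_shape.
by rewrite /R10 /=; move: (derivation _ _ t) (Dx _ t) (R8 t) => y1 y2 y3; field.
Qed.

Section OneSymmetry.
Variable v : E R 0 -> E R 0.
Hypothesis symv : symmetry v.

(** Here [b] and [l] are the values at [t] of the structure functions [be] and
    [al]. *)
Lemma symmetry_weights t : exists b l : R,
  [/\ forall f, jsm t f -> lie (prolong v) (Dx f) t =
        Dx (lie (prolong v) f) t - 2 * l * Dx f t,
      weight (prolong v) t (jq 2) (b - 5 * l),
      weight (prolong v) t (@R8 R) (6 * b - 42 * l) &
      weight (prolong v) t (@R10 R) (14 * b - 98 * l)].
Proof.
have sv := symv.1.
have [f [g [pot gen]]] := sym_potentials ((symmetry_eqs sv).1 symv).
have [al [al1 [be [a [a1 [a2 [a3 [a4 st]]]]]]]] := structure_functions_exist pot gen.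
exists (be t), (al t).
have wE (m n : nat) : (m%:R * be - n%:R * al) t = m%:R * be t - n%:R * al t.
  by rewrite sfDE sfNE !sfME !sfnE.
have Dal : tder (Vj sv 0%N) = 2 * al := st_al st.
have eP h s : lie (prolong v) h s = lie (fun j => PrJ sv j) h s.
  by apply: lie_ext => j; rewrite PrJE.
have vM : forall F G : jfun, der (PrJ sv) (F * G) =
  der (PrJ sv) F * G + F * der (PrJ sv) G by move=> F G; exact: derM.
have vD : forall F G : jfun, der (PrJ sv) (F + G) =
  der (PrJ sv) F + der (PrJ sv) G by move=> F G; exact: derD.
have vx : forall j, der (PrJ sv) (sX R j) = PrJ sv j by move=> j; exact: der_sX.
have vcomm := PrJ_comm sv symv.
split.
- move=> h sh; rewrite (lie_prolong_Dx sv symv sh) Dal.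
  by rewrite sfME sfnE.
- split; first exact: jsm_coord.
  rewrite eP lie_coord.
  have -> : PrJ sv (4 + 2) = (be - 5 * al) * sX R 6 := eta2 st.
  by rewrite !(sfME, sfDE, sfNE, sfnE).
- have e := v_R8 st vD vM vx.
  have R8e : R8K J = @R8 R :> (jet R -> R) by apply/funext => s; exact: R8KE.
  split; first by rewrite -R8e; exact: jfunP.
  rewrite eP -R8e -derE e sfME wE; reflexivity.
- have e := v_R10 st vD vM vx vcomm.
  have R10e : (fun t => 4^-1 * R10K J t) = @R10 R.
    by apply/funext => s; rewrite R10KE mulKf // pnatr_eq0.
  rewrite -R10e -[14 * _ - _]add0r; apply: weightM.
    by split; [exact: jsm_cst|rewrite lie_cst mul0r].
  split; first exact: jfunP.
  rewrite eP -derE e sfME wE; reflexivity.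
Qed.

End OneSymmetry.

(** The factors cancel: [3 (14 b - 98 l) = 7 (6 b - 42 l)]. *)
Lemma I10_invariant : diff_invariant (Reg 10) (@I10 R).
Proof.
split; first exact: I10_order.
move=> v symv t /RegP rt; have {}rt : regular t by exact: rt.
have [b [l [_ _ w8 w10]]] := symmetry_weights symv t.
have r8 : R8 t ^+ 7 != 0 by rewrite expf_eq0 /=; exact: rt.
have [_ ->] := weightM (weightX 3 w10) (weightV r8 (weightX 7 w8)).
ring.
Qed.

(** The factors cancel: [(b - 5 l) - (6 b - 42 l) / 6 = 2 l], which compensates the
    bracket of the symmetry with [Dx]. *)
Lemma box_invariant : invariant_derivation (Reg 8) (@box_coef R).
Proof.
split; first exact: box_order.
move=> v symv l W f Wf t /RegP rt Wt; have {}rt : regular t by exact: rt.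
have sf := jsm_jet_function Wf Wt.
have [b [al [comm w2 w8 _]]] := symmetry_weights symv t.
have p0 : `|R8 t| `^ (6^-1) != 0 by rewrite gt_eqF // powR_gt0 // normr_gt0; exact: rt.
have [sh eh] := weightM w2 (weightV p0 (weight_abs_powR (6^-1) rt w8)).
have sD := jsm_Dx sf.
rewrite [LHS](lieM _ sh sD) eh comm // /derivation.
rewrite -/(box_coef t).
by move: (box_coef t) (Dx (lie _ _) t) (Dx f t) => h y z; field.
Qed.

End Invariance.

(** * From potentials back to symmetries *)

Section Family.
Variables (K : comNzRingType) (J : jet_calculus K).
Local Notation d := (jd J).
Local Notation D := (jD J).
Local Notation x := (jx J).
Local Notation Tr := (Tr J).
Local Notation flat := (flat J).
Local Notation p := (x 2).
Local Notation q := (x 4).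
Local Notation q1 := (x 5).
Local Notation q2 := (x 6).
Implicit Types f g F G : K.

(** The computation of [sym_potentials] read backwards. *)
Lemma potentials_sym f g V : potentials J f g -> generated_by J f g V ->
  sym_eqs J V.
Proof.
move=> [ff fg pp pz zz gT gp gz] [V0 V1 V2 V3 V4].
have [A A_def] : exists A, A = d 3 f by eexists.
have [B B_def] : exists B, B = d 2 f by eexists.
have [C C_def] : exists C, C = d 1 f by eexists.
rewrite -A_def -B_def -?C_def in pp pz zz gp gz V0 V3 *.
have fA : flat A by rewrite A_def; exact: flat_d.
have fB : flat B by rewrite B_def; exact: flat_d.
have fC : flat C by rewrite C_def; exact: flat_d.
have TT F : flat F -> flat (Tr F) by exact: flat_Tr.
have fTf := TT _ ff.
have Bz : d 3 B = 0 by rewrite B_def jd_comm -A_def.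
have d2Tf : d 2 (Tr f) = Tr B + C by rewrite d_Tr eqxx mul1r -B_def -C_def.
have d3Tf : d 3 (Tr f) = Tr A by rewrite d_Tr mul0r addr0 -A_def.
have DA : D A = Tr A by rewrite D_flat // pz zz; ring.
have DB' : 3 * D B = 3 * Tr B - 8 * q * Tr A.
  rewrite D_flat // Bz; apply: (@eq_of_multiple K J 1 _ _ _ _ _ (scale_eq q pp)) => //; ring.
have Df : D f = Tr f + q * B + q ^+ 2 * A by rewrite D_flat // -A_def -B_def.
have DTf : D (Tr f) = Tr (Tr f) + q * (Tr B + C) + q ^+ 2 * Tr A.
  by rewrite D_flat // d2Tf d3Tf.
have D2f : 3 * V 4 = 3 * Tr (Tr f) + 6 * q * Tr B + 3 * q * C - 2 * q ^+ 2 * Tr A.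
  apply: (@eq_of_multiple K J 1 _ _ _ _ _ (scale_eq q DB')) => //.
  rewrite V4 V0 Df !DE DTf DA; ring.
have fl F i : flat F -> (5 <= i)%N -> d i F = 0 by move=> fF i5; rewrite fF // ltnW.
have xb j i : (j < 5)%N -> (5 <= i)%N -> d i (x j) = 0.
  by move=> j5 i5; rewrite jdx; case: eqP => // ji; move: j5; rewrite ji ltnNge i5.
have V0b i : (5 <= i)%N -> d i (V 0%N) = 0.
  by move=> i5; rewrite V0 !(dnat, dXn, dn, dB, dN, jdD, jdM) xb // !fl //; ring.
split.
- move=> j i j5 i5; case: j j5 => [|[|[|[|[|//]]]]] _.
  + exact: V0b.
  + by rewrite V1 jdD jdM xb // V0b // fl //; ring.
  + by rewrite V2 Df !(dnat, dXn, dn, dB, dN, jdD, jdM) xb // V0b // !fl //; ring.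
  + apply: (@jnatI _ J 3) => //; rewrite -dn V3.
    by rewrite !(dnat, dXn, dn, dB, dN, jdD, jdM) xb // V0b // !fl //; ring.
  + apply: (@jnatI _ J 3) => //; rewrite -dn D2f.
    rewrite !(dnat, dXn, dn, dB, dN, jdD, jdM) xb // !fl //; try ring.
    * exact: TT.
    * exact: TT.
    * exact: TT.
- by rewrite V1 !dE /= (ff 4%N) //; ring.
- rewrite V2 Df !dE /= (fA 4%N) // (fB 4%N) // (fTf 4%N) // V0.
  ring.
- apply: (@jnatI _ J 3) => //; rewrite -dn V3 !dE /= (fg 4%N) // (fA 4%N) // (fB 4%N) //.
  apply: (@eq_of_multiple K J 1 _ _ _ _ _ (scale_eq (6 * q) V0)) => //; ring.
- by rewrite V1 V2 !DE; ring.
- by rewrite V2 V4 !DE; ring.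
- have e : 3 * D (V 3) = 6 * q * V 4 + 3 * q ^+ 2 * D (V 0%N).
    rewrite -Dn V3 !DE.
    apply: (@eq_of_multiple K J 1 _ _ _ _ _ (add_eq (scale_eq (6 * q * q1) V0)
      (add_eq (scale_eq (q ^+ 2) DB') (scale_eq (- 2 * q) D2f)))) => //.
    rewrite DA (D_flat fg) gT gp gz; ring.
  apply: (@eq_of_multiple K J 3 _ _ _ _ _ e) => //; ring.
Qed.

End Family.

(** * An explicit 14-parameter family of symmetries *)

Section ExplicitFamily.
Variables (K : comNzRingType) (J : jet_calculus K).
Local Notation d := (jd J).
Local Notation D := (jD J).
Local Notation x := (jx J).
Local Notation Tr := (Tr J).
Local Notation flat := (flat J).
Local Notation p := (x 2).
Local Notation q := (x 4).
Local Notation q1 := (x 5).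
Local Notation q2 := (x 6).
(* [c 0, .., c 13] are the parameters; [c 14], [c 15], [c 16] are the coordinates
   [x], [y], [z] of the base point around which the potentials are expanded. *)
Variable c : nat -> K.
Hypothesis dc : forall i j, d i (c j) = 0.
Local Notation a0 := (c 0).
Local Notation a1 := (c 1).
Local Notation a2 := (c 2).
Local Notation a3 := (c 3).
Local Notation a4 := (c 4).
Local Notation c0 := (c 5).
Local Notation c1 := (c 6).
Local Notation c2 := (c 7).
Local Notation e0 := (c 8).
Local Notation k0 := (c 9).
Local Notation k1 := (c 10).
Local Notation k2 := (c 11).
Local Notation k3 := (c 12).
Local Notation e1 := (c 13).
Local Notation X := (x 0 - c 14).
Local Notation Y := (x 1 - c 15).
Local Notation Z := (x 3 - c 16).

(** A third of [f_z]: the determining equations make it cubic in [x] and linear in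
    [y]. *)
Definition famA := a0 + 3 * a1 * X + 3 * a2 * X ^+ 2 + 3 * a3 * X ^+ 3 + 3 * a4 * Y.

(** A polynomial solution of the determining equations.  The terms of degree 2 and 3
    in [p] come from [3 f_pp = - 8 (d_x + p d_y) f_z], the other parameters are
    integration constants. *)
Definition famf : K := 3 * famA * Z
  - 12 * (a1 + 2 * a2 * X + 3 * a3 * X ^+ 2) * p ^+ 2 - 4 * a4 * p ^+ 3
  + ((36 * a2 + 108 * a3 * X) * Y + c0 + 2 * c1 * X + 2 * c2 * X ^+ 2) * p
  - 108 * a3 * Y ^+ 2 - (3 * c1 + 6 * c2 * X) * Y + e0 * Y
  + k0 + k1 * X + k2 * X ^+ 2 + k3 * X ^+ 3.

(** A third of the potential [g]. *)
Definition famg : K := 2 * (18 * a2 + 54 * a3 * X) * Z * p - 48 * a3 * p ^+ 3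
  - 8 * c2 * p ^+ 2 + 2 * (2 * k2 + 6 * k3 * X) * p
  + (2 * e0 - 108 * a3 * Y) * Z + 9 * a4 * Z ^+ 2 - 12 * k3 * Y + e1.

Definition famV (j : nat) : K :=
  let V0 := - (d 2 famf + 2 * q * d 3 famf) in
  match j with
  | 0 => V0
  | 1 => famf + p * V0
  | 2 => D famf + q * V0
  | 3 => famg + q ^+ 2 * d 2 famf + 4 * q ^+ 3 * famA + q ^+ 2 * V0
  | _ => D (D famf) + q1 * V0
  end.

Lemma Dc j : D (c j) = 0.
Proof. by rewrite jD_base => [|i _]; rewrite !dc; ring. Qed.

Lemma Dx0 : D (x 0) = 1.
Proof. by rewrite jD_base => [|[|[|[|[|[|i]]]]] //]; rewrite ?jdx //=; ring. Qed.

Lemma Dx1 : D (x 1) = p.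
Proof. by rewrite jD_base => [|[|[|[|[|[|i]]]]] //]; rewrite ?jdx //=; ring. Qed.

Lemma Dx3 : D (x 3) = q ^+ 2.
Proof. by rewrite jD_base => [|[|[|[|[|[|i]]]]] //]; rewrite ?jdx //=; ring. Qed.

Definition dcE := (dnat, dXn, dn, dB, dN, jdD, jdM, jdx, dc).
Definition DcE := (Dnat, DXn, Dn, DB, DN, jDD, jDM, jDp, Dq0, Dx0, Dx1, Dx3, Dc).

Lemma famf_p : d 2 famf = - (24 * (a1 + 2 * a2 * X + 3 * a3 * X ^+ 2) * p)
  - 12 * a4 * p ^+ 2 + ((36 * a2 + 108 * a3 * X) * Y + c0 + 2 * c1 * X + 2 * c2 * X ^+ 2).
Proof. rewrite /famf /famA !dcE /=; ring. Qed.

Lemma famf_z : d 3 famf = 3 * famA.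
Proof. rewrite /famf /famA !dcE /=; ring. Qed.

Lemma famf_y : d 1 famf = 9 * a4 * Z + (36 * a2 + 108 * a3 * X) * p - 216 * a3 * Y
   - (3 * c1 + 6 * c2 * X) + e0.
Proof. rewrite /famf /famA !dcE /=; ring. Qed.

Lemma famf_x : d 0 famf = (9 * a1 + 18 * a2 * X + 27 * a3 * X ^+ 2) * Z
  - 12 * (2 * a2 + 6 * a3 * X) * p ^+ 2
  + (108 * a3 * Y + 2 * c1 + 4 * c2 * X) * p - 6 * c2 * Y
  + k1 + 2 * k2 * X + 3 * k3 * X ^+ 2.
Proof. rewrite /famf /famA !dcE /=; ring. Qed.

Lemma flat_x j : (j < 4)%N -> flat (x j).
Proof.
by move=> j4 i i4; rewrite jdx; case: eqP => // ji; move: j4; rewrite ji ltnNge i4.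
Qed.

Lemma flat_c j : flat (c j). Proof. by move=> i _; exact: dc. Qed.

Lemma flatM F G : flat F -> flat G -> flat (F * G).
Proof. by move=> fF fG i i4; rewrite jdM fF // fG // mulr0 mul0r addr0. Qed.

Lemma flatX F n : flat F -> flat (F ^+ n.+1).
Proof. by move=> fF i i4; rewrite dXn fF // mulr0. Qed.

Lemma flat_nat n : flat n%:R.
Proof. by move=> i _; rewrite dnat. Qed.

Ltac flatp := lazymatch goal with
  | |- flat (_ + _) => apply: flatD; flatp
  | |- flat (- _) => apply: flatN; flatp
  | |- flat (_%:R) => apply: flat_nat
  | |- flat (_ * _) => apply: flatM; flatp
  | |- flat (_ ^+ _) => apply: flatX; flatp
  | |- flat (c _) => apply: flat_c
  | |- flat (x _) => exact: flat_x
  end.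

Lemma fam_potentials : potentials J famf (3 * famg).
Proof.
have Tf : Tr famf = (9 * a1 + 18 * a2 * X + 27 * a3 * X ^+ 2) * Z
  + 9 * a4 * Z * p + (12 * a2 + 36 * a3 * X) * p ^+ 2
  - (108 * a3 * Y + c1 + 2 * c2 * X) * p - 6 * c2 * Y + e0 * p
  + k1 + 2 * k2 * X + 3 * k3 * X ^+ 2.
  rewrite TrE famf_x famf_y; ring.
have TTf : Tr (Tr famf) = (18 * a2 + 54 * a3 * X) * Z - 72 * a3 * p ^+ 2
   - 8 * c2 * p + 2 * k2 + 6 * k3 * X.
  rewrite Tf TrE !dcE /=; ring.
split.
- rewrite /famf /famA; flatp.
- rewrite /famg; flatp.
- rewrite famf_p famf_z /famA TrE !dcE /=; ring.
- rewrite famf_z /famA !dcE /=; ring.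
- rewrite famf_z /famA !dcE /=; ring.
- rewrite /famg TrE !dcE /=; ring.
- rewrite TTf /famg !dcE /=; ring.
- rewrite famf_p famf_y /famg TrE !dcE /=; ring.
Qed.

Lemma fam_generated : generated_by J famf (3 * famg) famV.
Proof.
split=> //.
rewrite [famV 3](_ : _ = famg + q ^+ 2 * d 2 famf + 4 * q ^+ 3 * famA
  + q ^+ 2 * famV 0%N) // famf_z.
move: (d 2 famf) famg famA (famV 0%N) => F2 G F3 V0; ring.
Qed.

Lemma fam_sym : sym_eqs J famV.
Proof. exact: potentials_sym fam_potentials fam_generated. Qed.

Lemma famV0 : famV 0%N = 24 * (a1 + 2 * a2 * X + 3 * a3 * X ^+ 2) * p
  + 12 * a4 * p ^+ 2 - ((36 * a2 + 108 * a3 * X) * Y + c0 + 2 * c1 * X + 2 * c2 * X ^+ 2)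
  - 6 * q * famA.
Proof. rewrite /famV famf_p famf_z; ring. Qed.

Lemma D_famA : D famA = 3 * a1 + 6 * a2 * X + 9 * a3 * X ^+ 2 + 3 * a4 * p.
Proof. rewrite /famA !DcE; ring. Qed.

Lemma D_famf : D famf = (9 * a1 + 18 * a2 * X + 27 * a3 * X ^+ 2) * Z
  + 9 * a4 * Z * p + (12 * a2 + 36 * a3 * X) * p ^+ 2
  - (108 * a3 * Y + c1 + 2 * c2 * X) * p - 6 * c2 * Y + e0 * p
  + k1 + 2 * k2 * X + 3 * k3 * X ^+ 2
  + q * d 2 famf + 3 * q ^+ 2 * famA.
Proof. rewrite famf_p /famf /famA !DcE; ring. Qed.

Lemma famV4 : famV 4 = 12 * a2 * p * q - 72 * a3 * p ^+ 2 + 36 * X * a3 * p * q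
  - 8 * c2 * p - 6 * a4 * p * q ^+ 2 + 9 * Z * a4 * q + c1 * q + 2 * X * c2 * q
  + e0 * q - 6 * a1 * q ^+ 2 - 12 * X * a2 * q ^+ 2 - 18 * X ^+ 2 * a3 * q ^+ 2
  + 18 * Z * a2 + 54 * X * Z * a3 + 2 * k2 + 6 * X * k3.
Proof.
have -> : famV 4 = D (D famf) + q1 * famV 0 by [].
rewrite famV0 D_famf famf_p /famA !DcE; ring.
Qed.

Lemma fam_eta1 : D (famV 4) - q1 * D (famV 0%N) =
  - (18 * (a4 * p + a1 + 2 * a2 * X + 3 * a3 * X ^+ 2) * q * q1)
  + (3 * c1 + 6 * c2 * X + 9 * a4 * Z + e0 + 108 * a3 * Y) * q1
  - 108 * a3 * p * q + 54 * a3 * Z + 6 * k3 + (18 * a2 + 54 * a3 * X) * q ^+ 2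
  - 6 * c2 * q + 3 * a4 * q ^+ 3 + 6 * famA * q1 ^+ 2.
Proof. rewrite famV4 famV0 /famA !DcE; ring. Qed.

Definition fam_al : K := - (3 * q1 * famA) + (6 * a2 + 18 * a3 * X) * p
  + 3 * a4 * p * q - 54 * a3 * Y - c1 - 2 * c2 * X
  + (3 * a1 + 6 * a2 * X + 9 * a3 * X ^+ 2) * q.

(** [al], [be] and the [b_i] are determined by [f] through the first equations of
    [structure_functions] and by differentiation, as integer multiples can be
    cancelled. *)
Lemma fam_structure_functions al al1 be b0 b1 b2 b3 b4 :
  structure_functions J famf famV al al1 be b0 b1 b2 b3 b4 ->
  [/\ b0 = famA,
      b1 = 3 * a1 + 6 * a2 * X + 9 * a3 * X ^+ 2 + 3 * a4 * p,
      b2 = 6 * a2 + 18 * a3 * X + 3 * a4 * q,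
      b3 = 18 * a3 + 3 * a4 * q1 &
      b4 = 3 * a4] /\
  [/\ al = fam_al,
      al1 = - (6 * q1 * (a4 * p + a1 + 2 * a2 * X + 3 * a3 * X ^+ 2)) - 36 * a3 * p
        - 2 * c2 + (12 * a2 + 36 * a3 * X) * q - 3 * q2 * famA + 3 * a4 * q ^+ 2 &
      be = (18 * a2 + 54 * a3 * X) * p - 54 * a3 * Y + 9 * a4 * Z + e0
        - 9 * (a4 * p + a1 + 2 * a2 * X + 3 * a3 * X ^+ 2) * q + 3 * q1 * famA].
Proof.
move=> st.
have eA : b0 = famA by apply: (@jnatI _ J 3) => //; rewrite -(st_a st) famf_z.
have e1 : b1 = 3 * a1 + 6 * a2 * X + 9 * a3 * X ^+ 2 + 3 * a4 * p.
  by rewrite -(st_Da st) eA D_famA.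
have e2 : b2 = 6 * a2 + 18 * a3 * X + 3 * a4 * q.
  by rewrite -(st_Da1 st) e1 !DcE; ring.
have e3 : b3 = 18 * a3 + 3 * a4 * q1.
  by rewrite -(st_Da2 st) e2 !DcE; ring.
have e4 : b4 = 3 * a4.
  by apply: (@jnatI _ J 3) => //; rewrite -(st_a4 st) famf_z /famA !dcE /=; ring.
have eal : al = fam_al.
  apply: (@jnatI _ J 2) => //; rewrite -(st_al st) famV0 /fam_al /famA !DcE; ring.
split; split=> //.
  rewrite -(st_Dal st) eal /fam_al /famA !DcE (jDq J 1).
  rewrite (_ : x (4 + 2) = q2) //; ring.
apply: (@jnatI _ J 2) => //.
rewrite (st_be st) eA e1 TrE famf_p famf_y /famA !dcE /=; ring.
Qed.

End ExplicitFamily.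

(** * Symmetries with prescribed structure functions at a jet *)

Section Realize.
Variable R : realType.
Local Notation jfun := (jfun R).
Local Notation J := (jfun_calculus R).
Implicit Types (t : jet R) (f : jet R -> R) (F G : jfun).

(** The functions that come from [M], such as the components of a vector field. *)
Definition ord0 F := jet_function (setT : set (E R 0)) F.

Lemma ord0D F G : ord0 F -> ord0 G -> ord0 (F + G).
Proof. exact: jet_functionD. Qed.
Lemma ord0M F G : ord0 F -> ord0 G -> ord0 (F * G).
Proof. exact: jet_functionM. Qed.
Lemma ord0N F : ord0 F -> ord0 (- F).
Proof. exact: jet_functionN. Qed.
Lemma ord0_sC c : ord0 (sC c).
Proof. by apply: jet_function_cst; exact: openT. Qed.
Lemma ord0_sX j : (j < 5)%N -> ord0 (sX R j).
Proof. by move=> j5; apply: jet_function_coord => //; exact: openT. Qed.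
Lemma ord0_nat n : ord0 n%:R.
Proof.
apply: jet_function_eq (ord0_sC n%:R) => t _; by rewrite sfnE.
Qed.
Lemma ord0X F n : ord0 F -> ord0 (F ^+ n).
Proof.
move=> HF; apply: jet_function_eq (jet_functionX n HF) => t _; by rewrite sfXE.
Qed.

Ltac ord0_tac := lazymatch goal with
  | |- ord0 (_ + _) => apply: ord0D; ord0_tac
  | |- ord0 (- _) => apply: ord0N; ord0_tac
  | |- ord0 (_%:R) => apply: ord0_nat
  | |- ord0 (_ * _) => apply: ord0M; ord0_tac
  | |- ord0 (_ ^+ _) => apply: ord0X; ord0_tac
  | |- ord0 (sC _) => apply: ord0_sC
  | |- ord0 (sX _ _) => exact: ord0_sX
  | |- ord0 (jx _ _) => exact: ord0_sX
  end.

Lemma sym_eqs_ext (V V' : nat -> jfun) : (forall j, (j < 5)%N -> V j = V' j) ->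
  sym_eqs J V -> sym_eqs J V'.
Proof.
move=> e [b q1 q2 q3 D1 D2 D3].
rewrite !e // in q1 q2 q3 D1 D2 D3.
by split=> // j i j5 i5; rewrite -e // b.
Qed.

Lemma symmetry_of_eqs (V : nat -> jfun) : (forall j, (j < 5)%N -> ord0 (V j)) ->
  sym_eqs J V ->
  exists (v : E R 0 -> E R 0) (sv : forall j : 'I_5, smooth setT (fun m => v m 0 j)),
    symmetry v /\ forall j, (j < 5)%N -> Vj sv j = V j.
Proof.
move=> oV eV.
pose v (m : E R 0) : E R 0 := \row_(j < 5) V j (ext m).
have sv (j : 'I_5) : smooth setT (fun m => v m 0 j).
  have [s _] := jet_function_ext (oV j (ltn_ord j)).
  rewrite (_ : (fun m => v m 0 j) = (fun a => V j (ext a))) //.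
  by apply/funext => m; rewrite mxE.
have e j : (j < 5)%N -> Vj sv j = V j.
  move=> j5; apply: jfun_ext => t; rewrite VjE /base_coef mxE inordK //.
  by have [_ /(_ t I) ->] := jet_function_ext (oV j j5).
exists v, sv; split=> //; apply/(symmetry_eqs sv).
by apply: sym_eqs_ext eV => j j5; rewrite e.
Qed.

(* The parameters are now real constants, and [k 14], [k 15], [k 16] are the
   coordinates [x], [y], [z] of [t], so that all powers of the increments vanish at
   [t]. *)
Section Values.
Variables (t : jet R) (k : nat -> R).
Hypotheses (k14 : k 14 = t 0%N) (k15 : k 15 = t 1%N) (k16 : k 16 = t 3%N).
Let c j : jfun := sC (k j).
Let dc i j : jd J i (c j) = 0. Proof. exact: der_sC. Qed.
Local Notation p := (t 2%N).
Local Notation q := (t 4%N).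
Local Notation q1 := (t 5%N).
Local Notation q2 := (t 6%N).

Lemma sCE a : (sC a : jfun) t = a. Proof. by []. Qed.
Definition evE := (sfXE, sfnE, sfDE, sfNE, sfME, sCE, sXE).

Lemma famA_at : famA J c t = k 0%N.
Proof. by rewrite /famA !evE ?k14 ?k15; ring. Qed.

Lemma famf_p_at : pder 2 (famf J c) t =
  - (24 * k 1%N * p) - 12 * k 4 * p ^+ 2 + k 5.
Proof.
have -> : pder 2 (famf J c) = _ := famf_p dc.
rewrite !evE ?k14 ?k15; ring.
Qed.

Lemma famV0_at : famV J c 0 t = 24 * k 1%N * p + 12 * k 4 * p ^+ 2 - k 5 - 6 * q * k 0%N.
Proof.
rewrite (famV0 dc); move: famA_at; move: (famA J c) => A eA.
rewrite !evE eA ?k14 ?k15; ring.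
Qed.

Lemma famf_at : famf J c t = - (12 * k 1%N * p ^+ 2) - 4 * k 4 * p ^+ 3 + k 5 * p + k 9.
Proof.
rewrite /famf; move: famA_at; move: (famA J c) => A eA.
rewrite !evE eA ?k14 ?k15 ?k16; ring.
Qed.

Lemma famV1_at : famV J c 1 t = - (12 * k 1%N * p ^+ 2) - 4 * k 4 * p ^+ 3 + k 5 * p + k 9
  + p * famV J c 0 t.
Proof.
have -> : famV J c 1 = famf J c + sX R 2 * famV J c 0 by [].
by rewrite sfDE sfME famf_at.
Qed.

Lemma famV2_at : famV J c 2 t = 12 * k 2 * p ^+ 2 - k 6 * p + k 8 * p + k 10
  + q * (k 5 - 24 * k 1%N * p - 12 * k 4 * p ^+ 2) + 3 * q ^+ 2 * k 0%N
  + q * famV J c 0 t.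
Proof.
have -> : famV J c 2 = tder (famf J c) + sX R 4 * famV J c 0 by [].
have -> : tder (famf J c) = _ := D_famf dc.
move: famA_at; move: (famA J c) => A eA.
move: famf_p_at; rewrite -[jd J 2 _]/(pder 2 _); move: (pder 2 (famf J c)) => B eB.
move: (famV J c 0) => V0.
rewrite !evE eA eB ?k14 ?k15 ?k16; ring.
Qed.

Lemma famV3_at : famV J c 3 t = - (48 * k 3 * p ^+ 3) - 8 * k 7 * p ^+ 2 + 4 * k 11 * p + k 13
  + q ^+ 2 * (k 5 - 24 * k 1%N * p - 12 * k 4 * p ^+ 2) + 4 * q ^+ 3 * k 0%N
  + q ^+ 2 * famV J c 0 t.
Proof.
have -> : famV J c 3 = famg J c + sX R 4 ^+ 2 * pder 2 (famf J c)
  + 4 * sX R 4 ^+ 3 * famA J c + sX R 4 ^+ 2 * famV J c 0 by [].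
rewrite /famg.
move: famA_at; move: (famA J c) => A eA.
move: famf_p_at; move: (pder 2 (famf J c)) => B eB.
move: (famV J c 0) => V0.
rewrite !evE eA eB ?k14 ?k15 ?k16; ring.
Qed.

Lemma famV4_at : famV J c 4 t = 12 * k 2 * p * q - 72 * k 3 * p ^+ 2
  - 8 * k 7 * p - 6 * k 4 * p * q ^+ 2 + k 6 * q
  + k 8 * q - 6 * k 1%N * q ^+ 2 + 2 * k 11.
Proof. rewrite (famV4 dc) !evE ?k14 ?k15 ?k16; ring. Qed.

Lemma fam_eta1_at : (etaK J (famV J c) 1) t =
  - (18 * (k 4 * p + k 1%N) * q * q1) + (3 * k 6 + k 8) * q1
  - 108 * k 3 * p * q + 6 * k 12 + 18 * k 2 * q ^+ 2
  - 6 * k 7 * q + 3 * k 4 * q ^+ 3 + 6 * k 0%N * q1 ^+ 2.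
Proof.
have -> : etaK J (famV J c) 1 = _ := fam_eta1 dc.
move: famA_at; move: (famA J c) => A eA.
rewrite !evE eA ?k14 ?k15 ?k16; ring.
Qed.

Lemma fam_structure_functions_at al al1 be b0 b1 b2 b3 b4 :
  structure_functions J (famf J c) (famV J c) al al1 be b0 b1 b2 b3 b4 ->
  [/\ b0 t = k 0%N, b1 t = 3 * k 1%N + 3 * k 4 * p, b2 t = 6 * k 2 + 3 * k 4 * q,
      b3 t = 18 * k 3 + 3 * k 4 * q1 & b4 t = 3 * k 4] /\
  [/\ al t = - (3 * q1 * k 0%N) + 6 * k 2 * p + 3 * k 4 * p * q - k 6 + 3 * k 1%N * q,
      al1 t = - (6 * q1 * (k 4 * p + k 1%N)) - 36 * k 3 * p
        - 2 * k 7 + 12 * k 2 * q - 3 * q2 * k 0%N + 3 * k 4 * q ^+ 2 &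
      be t = 18 * k 2 * p + k 8 - 9 * (k 4 * p + k 1%N) * q + 3 * q1 * k 0%N].
Proof.
move=> /(fam_structure_functions dc) [[-> -> -> -> ->] [-> -> ->]].
rewrite /fam_al; move: famA_at; move: (famA J c) => A eA.
by split; split; rewrite ?eA // !evE ?eA ?k14 ?k15 ?k16 //; ring.
Qed.

Ltac ord0_fam := lazymatch goal with
  | |- ord0 (_ + _) => apply: ord0D; ord0_fam
  | |- ord0 (- _) => apply: ord0N; ord0_fam
  | |- ord0 (_%:R) => apply: ord0_nat
  | |- ord0 (_ * _) => apply: ord0M; ord0_fam
  | |- ord0 (_ ^+ _) => apply: ord0X; ord0_fam
  | |- ord0 (c _) => apply: ord0_sC
  | |- ord0 (sX _ _) => exact: ord0_sX
  | |- ord0 (jx _ _) => exact: ord0_sX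
  | |- _ => assumption
  end.

Lemma fam_ord0 j : (j < 5)%N -> ord0 (famV J c j).
Proof.
have [A eA] : exists A, A = famA J c by eexists.
have oA : ord0 A by rewrite eA /famA; ord0_fam.
have [B eB] : exists B, B = pder 2 (famf J c) by eexists.
have oB : ord0 B.
  rewrite eB; have -> : pder 2 (famf J c) = _ := famf_p dc; ord0_fam.
have [F eF] : exists F, F = famf J c by eexists.
have oF : ord0 F by rewrite eF /famf -eA; ord0_fam.
have [V0 eV0] : exists V0, V0 = famV J c 0 by eexists.
have o0 : ord0 V0 by rewrite eV0 (famV0 dc) -eA; ord0_fam.
case: j => [|[|[|[|[|//]]]]] _.
- by rewrite -eV0.
- have -> : famV J c 1 = famf J c + sX R 2 * famV J c 0 by [].
  rewrite -eF -eV0; ord0_fam.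
- have -> : famV J c 2 = tder (famf J c) + sX R 4 * famV J c 0 by [].
  have -> : tder (famf J c) = _ := D_famf dc.
  rewrite -[jd J 2 _]/(pder 2 _) -eA -eB -eV0; ord0_fam.
- have -> : famV J c 3 = famg J c + sX R 4 ^+ 2 * pder 2 (famf J c)
    + 4 * sX R 4 ^+ 3 * famA J c + sX R 4 ^+ 2 * famV J c 0 by [].
  rewrite /famg -eA -eB -eV0; ord0_fam.
- rewrite (famV4 dc); ord0_fam.
Qed.

End Values.

(** Fourteen values at a jet for fourteen parameters.  With the family expanded
    around the base point of [t] the system is triangular. *)
Lemma realize_structure_functions t (u : nat -> R) (al al1 be b0 b1 b2 b3 b4 : R) :
  exists (v : E R 0 -> E R 0) (sv : forall j : 'I_5, smooth setT (fun m => v m 0 j)),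
  [/\ symmetry v, forall j, (j < 6)%N -> PrJ sv j t = u j &
    exists f al' al1' be' b0' b1' b2' b3' b4' : jfun,
    [/\ structure_functions J f (Vj sv) al' al1' be' b0' b1' b2' b3' b4',
       [/\ al' t = al, al1' t = al1 & be' t = be] &
       [/\ b0' t = b0, b1' t = b1, b2' t = b2, b3' t = b3 & b4' t = b4]]].
Proof.
set p := t 2%N; set q := t 4%N; set q1 := t 5%N; set q2 := t 6%N.
(* [k0, .., k4], [k6, .., k8] solve the equations for the structure functions, and
   then [k5] and [k9, .., k13] those for the components of the field. *)
pose k0 := b0; pose k4 := b4 / 3; pose k1 := b1 / 3 - k4 * p.
pose k2 := (b2 - b4 * q) / 6; pose k3 := (b3 - b4 * q1) / 18.
pose k6 := - (3 * q1 * k0) + 6 * k2 * p + 3 * k4 * p * q + 3 * k1 * q - al.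
pose k7 := (- (6 * q1 * (k4 * p + k1)) - 36 * k3 * p + 12 * k2 * q
  - 3 * q2 * k0 + 3 * k4 * q ^+ 2 - al1) / 2.
pose k8 := be - 18 * k2 * p + 9 * (k4 * p + k1) * q - 3 * q1 * k0.
pose k5 := 24 * k1 * p + 12 * k4 * p ^+ 2 - 6 * q * k0 - u 0%N.
pose k9 := u 1%N - p * u 0%N + 12 * k1 * p ^+ 2 + 4 * k4 * p ^+ 3 - k5 * p.
pose k10 := u 2 - q * u 0%N - 12 * k2 * p ^+ 2 + k6 * p - k8 * p
  - q * (k5 - 24 * k1 * p - 12 * k4 * p ^+ 2) - 3 * q ^+ 2 * k0.
pose k11 := (u 4 - (12 * k2 * p * q - 72 * k3 * p ^+ 2
  - 8 * k7 * p - 6 * k4 * p * q ^+ 2 + k6 * q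
  + k8 * q - 6 * k1 * q ^+ 2)) / 2.
pose k12 := (u 5 - (- (18 * (k4 * p + k1) * q * q1) + (3 * k6 + k8) * q1
  - 108 * k3 * p * q + 18 * k2 * q ^+ 2
  - 6 * k7 * q + 3 * k4 * q ^+ 3 + 6 * k0 * q1 ^+ 2)) / 6.
pose k13 := u 3 - (- (48 * k3 * p ^+ 3) - 8 * k7 * p ^+ 2 + 4 * k11 * p
  + q ^+ 2 * (k5 - 24 * k1 * p - 12 * k4 * p ^+ 2) + 4 * q ^+ 3 * k0
  + q ^+ 2 * u 0%N).
pose k := nth 0 [:: k0; k1; k2; k3; k4; k5; k6; k7; k8; k9; k10; k11; k12; k13;
  t 0%N; t 1%N; t 3%N].
have e14 : k 14 = t 0%N by []. have e15 : k 15 = t 1%N by [].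
have e16 : k 16 = t 3%N by [].
pose c j : jfun := sC (k j).
have dc i j : jd J i (c j) = 0 by exact: der_sC.
have [v [sv [symv eV]]] := symmetry_of_eqs (fam_ord0 k) (fam_sym dc).
exists v, sv.
have V0e : famV J c 0 t = u 0%N.
  by rewrite (famV0_at e14 e15) -/p -/q /k /= /k5; ring.
have eta1e : etaK J (Vj sv) 1 = etaK J (famV J c) 1 by rewrite /= !eV.
have P1 : PrJ sv 1%N = famV J c 1 := eV 1%N isT.
have P2 : PrJ sv 2 = famV J c 2 := eV 2 isT.
have P3 : PrJ sv 3 = famV J c 3 := eV 3 isT.
have P4 : PrJ sv 4 = famV J c 4 := eV 4 isT.
have P5 : PrJ sv 5 = etaK J (famV J c) 1 := eta1e.
have P0 : PrJ sv 0%N = famV J c 0 := eV 0%N isT.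
split; first exact: symv.
  case=> [|[|[|[|[|[|j]]]]]] j6; last by [].
  - by rewrite P0.
  - rewrite P1 (famV1_at e14 e15 e16) V0e -/p -/q /k /= /k9; ring.
  - rewrite P2 (famV2_at e14 e15 e16) V0e -/p -/q /k /= /k10; ring.
  - rewrite P3 (famV3_at e14 e15 e16) V0e -/p -/q /k /= /k13; ring.
  - by rewrite P4 (famV4_at e14 e16) -/p -/q /k /= /k11; field.
  - by rewrite P5 (fam_eta1_at e14 e15 e16) -/p -/q -/q1 /k /= /k12; field.
have [al' [al1' [be' [b0' [b1' [b2' [b3' [b4' st]]]]]]]] :=
  structure_functions_exist (fam_potentials dc) (fam_generated dc).
have [[f0 f1 f2 f3 f4] [e1 e2 e3]] := fam_structure_functions_at e14 e15 e16 st.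
exists (famf J c), al', al1', be', b0', b1', b2', b3', b4'.
have {}st : structure_functions J (famf J c) (Vj sv) al' al1' be' b0' b1' b2' b3' b4'.
  by case: st => *; split; rewrite ?(eV 0%N) ?(eV 4%N).
split; first exact: st.
  rewrite e1 e2 e3 -/p -/q -/q1 -/q2 /k /=; split.
  - rewrite /k6; ring.
  - by rewrite /k7; field.
  - rewrite /k8; ring.
have K1 : k 1%N = b1 / 3 - b4 / 3 * p by [].
have K2 : k 2 = (b2 - b4 * q) / 6 by [].
have K3 : k 3 = (b3 - b4 * q1) / 18 by [].
have K4 : k 4 = b4 / 3 by [].
split.
- exact: f0.
- by rewrite f1 K1 K4 -/p; field.
- by rewrite f2 K2 K4 -/q; field.
- by rewrite f3 K3 K4 -/q1; field.
- by rewrite f4 K4; field.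
Qed.

End Realize.

(** * Transitivity on jets of order 9 *)

Section Transitivity.
Variable R : realType.
Local Notation jfun := (jfun R).
Local Notation J := (jfun_calculus R).
Implicit Types (t : jet R) (f : jet R -> R) (F G : jfun).

(** The part of the total derivative without the new highest coordinate, in which
    [Dx f] is affine. *)
Definition lower_Dx k f t : R :=
  \sum_(j < 4 + k) total_field j t * pd j f t.

Lemma Dx_affine k (U : set (E R k)) f t : jet_function U f -> U (trunc k t) ->
  Dx f t = t (5 + k)%N * pd (4 + k) f t + lower_Dx k f t.
Proof.
by move=> Hf Ut; rewrite /Dx (lie_jet _ Hf Ut (leqnn _)) big_ord_recr addrC.
Qed.

Lemma jet_function_lower_Dx k (U : set (E R k)) f : jet_function U f ->
  jet_function U (lower_Dx k f).
Proof.
move=> Hf; have oU : open U by case: Hf.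
apply: jet_function_sum => // j; apply: jet_functionM; last exact: jet_function_pd.
have cf i : (i < 5 + k)%N -> jet_function U (fun t => t i).
  exact: jet_function_coord.
case: j => [] [|[|[|[|j]]]] /= jk.
- exact: jet_function_cst.
- exact: cf.
- exact: cf.
- by apply: jet_functionX; exact: cf.
- exact: cf.
Qed.

Lemma pd_top_Dx k (U : set (E R k)) f t : jet_function U f -> U (trunc k t) ->
  pd (5 + k) (Dx f) t = pd (4 + k) f t.
Proof.
move=> Hf Ut.
have oU : open U by case: Hf.
have sp : jsm t (pd (4 + k) f) := jsm_jet_function (jet_function_pd (4 + k) Hf) Ut.
have sl : jsm t (lower_Dx k f) := jsm_jet_function (jet_function_lower_Dx Hf) Ut.
rewrite (@pd_near_eq _ t _ (fun t => t (5 + k)%N * pd (4 + k) f t + lower_Dx k f t)).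
  rewrite pdD //; last by apply: jsmM => //; exact: jsm_coord.
  rewrite pdM //; last exact: jsm_coord.
  rewrite pd_coord eqxx mul1r (pd_high (jet_function_pd _ Hf) Ut (leqnn _)).
  by rewrite (pd_high (jet_function_lower_Dx Hf) Ut (leqnn _)) mulr0 !addr0.
by apply: (jnbhs_jet oU Ut) => s Us; exact: Dx_affine Hf Us.
Qed.

Lemma R8_affine t x : R8 (upd t 12 x) =
  196%N%:R * jq 2 t ^+ 5 * x + R8 (upd t 12 0).
Proof.
(* An identity in the coefficients, which are kept symbolic. *)
rewrite /R8; move: (196%N%:R : R) (2352%N%:R : R) (5040%N%:R : R) (3255%N%:R : R)
  (16632%N%:R : R) (59598%N%:R : R) (13772%N%:R : R) (83160%N%:R : R)
  (174735%N%:R : R) (297000%N%:R : R) (118800%N%:R : R).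
move=> c1 c2 c3 c4 c5 c6 c7 c8 c9 c10 c11.
rewrite /jq !updE /=; ring.
Qed.

Lemma pd12_R8 t : pd 12 (@R8 R) t = 196%N%:R * jq 2 t ^+ 5.
Proof.
rewrite /pd derive1E.
have -> : (fun s : R => R8 [eta t with 12 |-> s]) =
    (fun s => 196%N%:R * jq 2 t ^+ 5 *: s + R8 (upd t 12 0)).
  by apply/funext => s; exact: R8_affine.
rewrite deriveD // derive_cst addr0 deriveZ // derive_id.
exact: mulr1.
Qed.

Lemma pd13_DR8 t : pd 13 (Dx (@R8 R)) t = 196%N%:R * jq 2 t ^+ 5.
Proof. by rewrite (pd_top_Dx (@R8_order R) I) pd12_R8. Qed.

(** If two vectors agree below the order of [f] and give [f] the same derivative,
    then they agree in the highest coordinate of [f], provided that [f] depends on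
    it. *)
Lemma lie_eq_top k (U : set (E R k)) f (X Y : nat -> jet R -> R) t :
  jet_function U f -> U (trunc k t) ->
  (forall j, (j < 4 + k)%N -> X j t = Y j t) -> lie X f t = lie Y f t ->
  pd (4 + k) f t != 0 -> X (4 + k)%N t = Y (4 + k)%N t.
Proof.
move=> Hf Ut XY.
have S Z : lie Z f t =
    \sum_(j < 4 + k) Z j t * pd j f t + Z (4 + k)%N t * pd (4 + k) f t.
  by rewrite (lie_jet _ Hf Ut (leqnn _)) big_ord_recr.
rewrite !S (eq_bigr (fun j : 'I_(4 + k) => Y j t * pd j f t)); last first.
  by move=> j _; rewrite XY.
by move=> /addrI e f0; apply: (mulIf f0).
Qed.

(** Local transitivity.  The values of [al] and [be] are determined by the factors
    of [q_2] and [R8], namely by [mu = b - 5 l] and [lam = 6 b - 42 l].  The equation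
    for the component of [q_3] and the derivative of [Dx R8] are two linear equations
    for the values of [al1] and [a].  The components of [q_4, .., q_7] then give
    [a1, .., a4] successively, each multiplied by a power of [q_2].  The components
    of [q_8] and [q_9] are correct by [lie_eq_top] applied to [R8] and [Dx R8]. *)
Lemma symmetry_through t (u : nat -> R) : jq 2 t != 0 -> R8 t != 0 ->
  exists2 v, symmetry v & forall j, (j < 14)%N -> prolong v j t = u j.
Proof.
move=> q20 r0.
pose U (j : nat) (_ : jet R) := u j.
set q2 := jq 2 t in q20; pose q3 := jq 3 t; pose q4 := jq 4 t.
pose q5 := jq 5 t; pose q6 := jq 6 t; pose q7 := jq 7 t.
pose r8 := R8 t; pose dr := Dx (@R8 R) t.
(* The prescribed factors of [q_2] and [R8]. *)
pose mu := u 6 / q2; pose lam := lie U (@R8 R) t / r8.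
pose l := (6 * mu - lam) / 12; pose b := mu + 5 * l.
(* The prescribed derivative of the factor of [R8], read off from [Dx R8]. *)
pose lam1 := (lie U (Dx (@R8 R)) t - (lam - 2 * l) * dr) / r8.
pose r := u 7 - (b - 7 * l) * q3.
pose l1 := (6 * r / q2 - lam1) / 12.
pose b0 := (lam1 + 42 * l1) / (18 * q2).
pose b1 := (u 8 - 24 * b0 * q2 * q3 + 12 * l1 * q3 - (b - 9 * l) * q4) / (28 * q2 ^+ 2).
pose b2 := (u 9 - 140 * b1 * q2 * q3 - b0 * (27 * q2 * q4 + 60 * q3 ^+ 2)
  + 21 * l1 * q4 - (b - 11 * l) * q5) / (28 * q2 ^+ 2).
pose b3 := (u 10 - 196 * b2 * q2 * q3 - b1 * (272 * q2 * q4 + 200 * q3 ^+ 2)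
  - b0 * (30 * q2 * q5 + 210 * q3 * q4) + 32 * l1 * q5 - (b - 13 * l) * q6)
  / (28 * q2 ^+ 2).
pose b4 := (u 11 - 252 * b3 * q2 * q3 - b2 * (468 * q2 * q4 + 396 * q3 ^+ 2)
  - b1 * (462 * q2 * q5 + 882 * q3 * q4)
  - b0 * (33 * q2 * q6 + 336 * q3 * q5 + 210 * q4 ^+ 2)
  + 45 * l1 * q6 - (b - 15 * l) * q7) / (28 * q2 ^+ 3).
have [v [sv [symv low [f [al [al1 [be [a0 [a1 [a2 [a3 [a4
  [st [eal eal1 ebe] [e0 e1 e2 e3 e4]]]]]]]]]]]]]] :=
  realize_structure_functions t u l l1 b b0 b1 b2 b3 b4.
exists v => //.
have P6 : PrJ sv 6 t = u 6.
  have -> : PrJ sv 6 = _ := eta2 st.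
  by rewrite !evE eal ebe -[t 6]/q2 /b /mu; field.
have P7 : PrJ sv 7 t = u 7.
  have -> : PrJ sv 7 = _ := eta3 st.
  rewrite !evE eal ebe eal1 e0 -[t 6]/q2 -[t 7]/q3 /b0 /l1 /r; by field.
have P8 : PrJ sv 8 t = u 8.
  have -> : PrJ sv 8 = _ := eta4 st.
  rewrite !evE eal ebe eal1 e0 e1 -[t 6]/q2 -[t 7]/q3 -[t 8]/q4 /b1.
  by field.
have P9 : PrJ sv 9 t = u 9.
  have -> : PrJ sv 9 = _ := eta5 st.
  rewrite !evE eal ebe eal1 e0 e1 e2 -[t 6]/q2 -[t 7]/q3 -[t 8]/q4 -[t 9]/q5 /b2.
  by field.
have P10 : PrJ sv 10 t = u 10.
  have -> : PrJ sv 10 = _ := eta6 st.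
  rewrite !evE eal ebe eal1 e0 e1 e2 e3 -[t 6]/q2 -[t 7]/q3 -[t 8]/q4 -[t 9]/q5
    -[t 10]/q6 /b3.
  by field.
have P11 : PrJ sv 11 t = u 11.
  have -> : PrJ sv 11 = _ := eta7 st.
  rewrite !evE eal ebe eal1 e0 e1 e2 e3 e4 -[t 6]/q2 -[t 7]/q3 -[t 8]/q4 -[t 9]/q5
    -[t 10]/q6 -[t 11]/q7 /b4.
  by field.
have P j : (j < 12)%N -> prolong v j t = U j t.
  rewrite -PrJE; case: (ltnP j 6) => [/low //|].
  by case: j => [|[|[|[|[|[|[|[|[|[|[|[|j]]]]]]]]]]]].
have vM : forall F G : jfun, der (PrJ sv) (F * G) =
  der (PrJ sv) F * G + F * der (PrJ sv) G by move=> F G; exact: derM.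
have vD : forall F G : jfun, der (PrJ sv) (F + G) =
  der (PrJ sv) F + der (PrJ sv) G by move=> F G; exact: derD.
have vx : forall j, der (PrJ sv) (sX R j) = PrJ sv j by move=> j; exact: der_sX.
have R8e : R8K J = @R8 R :> (jet R -> R) by apply/funext => s; exact: R8KE.
have [r8K eK] : exists F : jfun, F = R8K J by eexists.
have vr : der (PrJ sv) r8K = (6 * be - 42 * al) * r8K.
  rewrite eK; exact: (v_R8 st vD vM vx).
have eP h : lie (prolong v) h t = lie (fun j => PrJ sv j) h t.
  by apply: lie_ext => j; rewrite PrJE.
rewrite -eK in R8e.
have q25 : 196%N%:R * jq 2 t ^+ 5 != 0 by rewrite mulf_neq0 ?expf_neq0 // pnatr_eq0.
have P12 : prolong v 12 t = U 12 t.
  apply: (lie_eq_top (@R8_order R) I P); last by rewrite pd12_R8.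
  rewrite eP -R8e -derE vr !evE eal ebe R8e -/r8 /b.
  have -> : lie U (@R8 R) t = lam * r8 by rewrite /lam divfK.
  by rewrite /l; field.
have P13 : prolong v 13 t = U 13 t.
  apply: (lie_eq_top (jet_function_DxT (@R8_order R)) I); last by rewrite pd13_DR8.
    move=> j; rewrite leq_eqVlt => /predU1P[[->] //|]; exact: P.
  have -> : Dx (@R8 R) = tder r8K by apply/funext => s; rewrite tder_Dx R8e.
  rewrite eP -derE (PrJ_comm sv symv) vr.
  have -> : tder (Vj sv 0%N) = 2 * al := st_al st.
  have Dal : tder al = al1 := st_Dal st.
  have Dbe : tder be = 3 * sX R 6 * a0 := st_Dbe st.
  have -> : tder ((6 * be - 42 * al) * r8K) =
      (6 * (3 * sX R 6 * a0) - 42 * al1) * r8K + (6 * be - 42 * al) * tder r8K.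
    rewrite -Dal -Dbe -[@tder R]/(jD J) (jDM J) DB !Dn; reflexivity.
  have -> : lie U (tder r8K) t = lam1 * r8 + (lam - 2 * l) * tder r8K t.
    have -> : tder r8K = Dx (@R8 R) :> (jet R -> R).
      by apply/funext => s; rewrite tder_Dx R8e.
    by rewrite /lam1 divfK // subrK.
  rewrite !evE eal ebe eal1 e0 R8e -[t 6]/q2 -/r8 /b0 /b.
  by rewrite /l; field.
move=> j; rewrite !ltnS leq_eqVlt => /predU1P[->|]; first exact: P13.
by rewrite ltnS leq_eqVlt => /predU1P[->|]; [exact: P12|exact: P].
Qed.

End Transitivity.

(** * Iterated derivatives of I10 at generic jets *)

Section Iterates.
Variable R : realType.
Implicit Types (t s : jet R) (f : jet R -> R).
Local Notation Reg k := (@Reg R k).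

Lemma trunc_upd_high k t j x : (5 + k <= j)%N -> trunc k (upd t j x) = trunc k t.
Proof.
move=> kj; apply/rowP => i; rewrite !mxE updE; case: eqP => // ij.
by move: (ltn_ord i); rewrite ij ltnNge kj.
Qed.

Lemma jet_function_upd k (U : set (E R k)) f t j x : jet_function U f ->
  U (trunc k t) -> (5 + k <= j)%N -> f (upd t j x) = f t.
Proof.
by move=> Hf Ut kj; apply/esym/(jet_function_dep Hf Ut); rewrite trunc_upd_high.
Qed.

Lemma regular_upd t j x : (13 <= j)%N -> regular (upd t j x) <-> regular t.
Proof.
by move=> j13; rewrite /regular /= (jet_function_upd x (@R8_order R) (I : setT _)).
Qed.

(** The condition [R10 t != 0] is needed because [I10] is the cube of [R10] up to a
    factor of lower order, hence has a critical point in [q_10] where [R10]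
    vanishes. *)
Definition generic : set (jet R) :=
  [set t | [/\ jq 2 t != 0, R8 t != 0 & R10 t != 0]].

Lemma jsm_jq i t : jsm t (jq i). Proof. exact: jsm_coord. Qed.
Lemma jsm_R8 t : jsm t (@R8 R). Proof. exact: jsm_jet_function (@R8_order R) I. Qed.
Lemma jsm_R10 t : jsm t (@R10 R). Proof. exact: jsm_jet_function (@R10_order R) I. Qed.

Lemma generic_near t : generic t -> jnbhs t generic.
Proof.
move=> [q r8 r10].
have h1 := jsm_neq0 (jsm_jq 2 t) q; have h2 := jsm_neq0 (jsm_R8 t) r8.
have h3 := jsm_neq0 (jsm_R10 t) r10.
by apply: filterS (filterI h1 (filterI h2 h3)) => s [? []].
Qed.

Lemma generic_upd t j x : (15 <= j)%N -> generic (upd t j x) <-> generic t.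
Proof.
move=> j15; rewrite /generic /= /jq updE.
rewrite (jet_function_upd x (@R8_order R) (I : setT _)); last exact: ltn_trans j15.
rewrite (jet_function_upd x (@R10_order R) (I : setT _)) //.
by rewrite (_ : (4 + 2 == j)%N = false) // ltn_eqF // (leq_trans _ j15).
Qed.

Lemma generic_regular t : generic t -> regular t.
Proof. by case. Qed.

Lemma regular_near t : regular t -> jnbhs t (@regular R).
Proof. by move=> rt; exact: jsm_neq0 (jsm_R8 t) rt. Qed.

(** [R10 = top10 * q_10 + low10], with [top10] and [low10] of order 9. *)
Definition top10 t : R := 21 * jq 2 t * R8 t * (jq 2 t * (196%N%:R * jq 2 t ^+ 5)).
Definition low10 t : R := 21 * jq 2 t * R8 t * lower_Dx 9 (derivation (jq 2) (@R8 R)) t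
  - 91 / 4 * derivation (jq 2) (@R8 R) t ^+ 2
  + 9 * R8 t ^+ 2 * (13 * jq 3 t ^+ 2 - 19 * jq 2 t * jq 4 t).

Lemma top10_order : jet_function (setT : set (E R 9)) top10.
Proof.
have q2 : jet_function (setT : set (E R 9)) (jq 2).
  by apply: jet_function_coord => //; exact: openT.
have c a : jet_function (setT : set (E R 9)) (fun=> a).
  by apply: jet_function_cst; exact: openT.
have r8 : jet_function (setT : set (E R 9)) (@R8 R).
  exact: (jet_function_raiseT _ (@R8_order R)).
apply: jet_functionM; first by apply: jet_functionM => //; apply: jet_functionM.
apply: jet_functionM => //; apply: jet_functionM => //; exact: jet_functionX.
Qed.

Lemma low10_order : jet_function (setT : set (E R 9)) low10.
Proof.
have q j : (j < 10)%N -> jet_function (setT : set (E R 9)) (jq j).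
  by move=> j10; apply: jet_function_coord => //; exact: openT.
have c a : jet_function (setT : set (E R 9)) (fun=> a).
  by apply: jet_function_cst; exact: openT.
have r8 : jet_function (setT : set (E R 9)) (@R8 R).
  exact: (jet_function_raiseT _ (@R8_order R)).
have d8 := @DR8_order R.
apply: jet_functionD; first apply: jet_functionD.
- apply: jet_functionM; last exact: jet_function_lower_Dx.
  by apply: jet_functionM => //; apply: jet_functionM => //; exact: q.
- apply: jet_functionN; apply: jet_functionM => //; exact: jet_functionX.
- apply: jet_functionM.
    by apply: jet_functionM => //; exact: jet_functionX.
  apply: jet_functionD; first by apply: jet_functionM => //; apply: jet_functionX; exact: q.
  by apply: jet_functionN; apply: jet_functionM; [apply: jet_functionM => //|]; exact: q.
Qed.

Lemma R10_affine t : R10 t = top10 t * t 14 + low10 t.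
Proof.
have pdD8 : pd 13 (derivation (jq 2) (@R8 R)) t = jq 2 t * (196%N%:R * jq 2 t ^+ 5).
  rewrite /derivation pdM; [|exact: jsm_jq|exact/jsm_Dx/jsm_R8].
  by rewrite pd13_DR8 /jq pd_coord mul0r add0r.
rewrite /R10 /top10 /low10.
rewrite (Dx_affine (@DR8_order R) I) -[(5 + 9)%N]/14%N -[(4 + 9)%N]/13%N pdD8.
move: (196%N%:R : R) (lower_Dx _ _ _) (R8 t) (derivation _ _ _) => a b c d.
by ring.
Qed.

Lemma top10_neq0 t : generic t -> top10 t != 0.
Proof.
by move=> [q r _]; rewrite /top10 !mulf_neq0 ?expf_neq0 // pnatr_eq0.
Qed.

Lemma pd14_R10 t : pd 14 (@R10 R) t = top10 t.
Proof.
have -> : @R10 R = (fun t => top10 t * t 14%N + low10 t).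
  by apply/funext => s; exact: R10_affine.
have s1 : jsm t top10 := jsm_jet_function top10_order I.
have s2 : jsm t low10 := jsm_jet_function low10_order I.
rewrite pdD //; last by apply: jsmM => //; exact: jsm_coord.
rewrite pdM //; last exact: jsm_coord.
rewrite (pd_high top10_order I) // (pd_high low10_order I) // pd_coord eqxx.
by rewrite mul0r add0r mulr1 addr0.
Qed.

Definition iterate i : jet R -> R := iter i (derivation (@box_coef R)) (@I10 R).

Lemma iterateS i t : iterate i.+1 t = box_coef t * Dx (iterate i) t.
Proof. by []. Qed.

Lemma box_order_Reg k : (8 <= k)%N -> jet_function (Reg k) (@box_coef R).
Proof.
move=> k8; have := jet_function_raise k8 (@box_order R).
apply: jet_functionW; first exact: Reg_open.
by move=> a [t rt <-]; rewrite /= proj_trunc; exists t.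
Qed.

Lemma iterate_order i : jet_function (Reg (10 + i)) (iterate i).
Proof.
elim: i => [|i IH]; first exact: I10_order.
have o : open (Reg (10 + i.+1)) by exact: Reg_open.
apply: jet_functionM; first exact: box_order_Reg.
apply: jet_functionW o _ (jet_function_Dx IH).
by move=> a [t rt <-]; rewrite /= proj_trunc; exists t.
Qed.

Lemma trunc_Reg k t : regular t -> Reg k (trunc k t).
Proof. by exists t. Qed.

Lemma jsm_iterate i t : regular t -> jsm t (iterate i).
Proof. by move=> rt; exact: jsm_jet_function (iterate_order i) (trunc_Reg _ rt). Qed.

(** An invariant derivation preserves invariants. *)
Lemma iterate_invariant i v t : symmetry v -> regular t ->
  lie (prolong v) (iterate i) t = 0.
Proof.
move=> symv; elim: i t => [|i IH] t rt.
  by case: (@I10_invariant R) => _ /(_ v symv t); apply; exact: trunc_Reg.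
case: (@box_invariant R) => _ /(_ v symv _ _ _ (iterate_order i) t) e.
rewrite [LHS]e; [|exact: trunc_Reg|exact: trunc_Reg].
rewrite /derivation (_ : Dx _ t = 0) ?mulr0 //.
rewrite -[RHS](lie_cst (@total_field R) t 0); apply: lie_near_eq.
by apply: filterS (regular_near rt) => s; exact: IH.
Qed.

Lemma box_neq0 t : generic t -> box_coef t != 0.
Proof.
move=> [q r _]; rewrite mulf_neq0 // invr_eq0 gt_eqF // powR_gt0 // normr_gt0.
exact: r.
Qed.

(** The total derivative carries the derivative in the highest coordinate to the one
    in the next coordinate ([pd_top_Dx]), and the coefficient of the derivation has
    lower order. *)
Lemma pd_top_iterate i t : generic t -> pd (14 + i) (iterate i) t != 0.
Proof.
move=> gt; have rt := generic_regular gt.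
elim: i => [|i IH].
  have sR := jsm_R10 t.
  have r7 : R8 t ^+ 7 != 0 by rewrite expf_eq0 /=; exact: rt.
  have sV : jsm t (fun t => (R8 t ^+ 7)^-1).
    by apply: jsmV => //; apply: jsmX; exact: jsm_R8.
  have oV : jet_function (Reg 8) (fun t => (R8 t ^+ 7)^-1).
    apply: jet_functionV.
      apply: jet_functionX; apply: jet_functionT (@R8_order R) => //; exact: Reg_open.
    by move=> s /RegP rs; rewrite expf_eq0 /=; exact: rs.
  have -> : iterate 0 = (fun t => R10 t * (R10 t * R10 t) * (R8 t ^+ 7)^-1).
    by apply/funext => s.
  have s2 := jsmM sR sR.
  rewrite pdM //; last exact: jsmM.
  rewrite (pd_high oV (trunc_Reg _ rt)) // mulr0 addr0 !pdM // pd14_R10.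
  have -> : top10 t * (R10 t * R10 t) + R10 t * (top10 t * R10 t + R10 t * top10 t)
    = 3 * top10 t * R10 t ^+ 2 by ring.
  have [_ _ r10] := gt.
  apply: mulf_neq0; last by rewrite invr_eq0.
  apply: mulf_neq0; last exact: expf_neq0.
  by apply: mulf_neq0; [rewrite pnatr_eq0|exact: top10_neq0].
have -> : iterate i.+1 = (fun t => box_coef t * Dx (iterate i) t) by [].
have sb : jsm t (@box_coef R) := jsm_jet_function (@box_order R) (trunc_Reg _ rt).
rewrite pdM //; last exact/jsm_Dx/jsm_iterate.
rewrite (pd_high (@box_order R) (trunc_Reg _ rt)) // mul0r add0r.
rewrite mulf_neq0 ?box_neq0 //.
have -> : (14 + i.+1 = 5 + (10 + i))%N by rewrite !addnS.
by rewrite (pd_top_Dx (iterate_order i) (trunc_Reg _ rt)).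
Qed.

Lemma near_neq_affine (c A B : R) (P : set R) : A != 0 -> nbhs c P ->
  exists2 x, P x & A * x + B != 0.
Proof.
move=> A0 Pc; have [e|n] := eqVneq (A * c + B) 0; last first.
  by exists c => //; exact: nbhs_singleton.
have /nbhs_ballP[r /= r0 rP] := Pc; exists (c + r / 2).
  apply: rP; rewrite /ball /= opprD addNKr normrN gtr0_norm ?divr_gt0 //.
  by rewrite ltr_pdivrMr // ltr_pMr // ltr1n.
rewrite mulrDr addrAC e add0r mulf_neq0 // gt_eqF //.
by rewrite divr_gt0.
Qed.

Definition Gen : set (E R 10) := [set a | generic (ext a)].

Lemma GenP t : Gen (trunc 10 t) <-> generic t.
Proof.
have st : trunc 10 (ext (trunc 10 t)) = trunc 10 t by rewrite trunc_ext.
rewrite /Gen /=; move: (ext _) st => s st.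
have e : jq 2 s = jq 2 t by move/rowP: st => /(_ (Ordinal (isT : (6 < 15)%N))); rewrite !mxE.
rewrite /generic /= e (jet_function_dep (@R10_order R) I st).
by rewrite (jet_function_dep (jet_function_raiseT _ (@R8_order R)) I st).
Qed.

Lemma open_jet_neq0 k f : jet_function (setT : set (E R k)) f ->
  open [set a : E R k | f (ext a) != 0].
Proof.
move=> Hf; have [sg gE] := jet_function_ext Hf.
rewrite openE => a /= a0.
have C := differentiable_continuous (smooth_differentiable sg (I : setT a)).
have N : nbhs (f (ext a)) [set x | x != 0] by exact: open_nbhs_nbhs.
exact: (C _ N).
Qed.

Lemma Gen_open : open Gen.
Proof.
have q2 : jet_function (setT : set (E R 10)) (jq 2).
  by apply: jet_function_coord => //; exact: openT.
have -> : Gen = [set a | jq 2 (ext a) != 0] `&` ([set a | R8 (ext a) != 0]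
    `&` [set a | R10 (ext a) != 0]).
  by apply/seteqP; split=> a [? //] [].
apply: openI; first exact: open_jet_neq0.
apply: openI; apply: open_jet_neq0; last exact: R10_order.
exact: (jet_function_raiseT _ (@R8_order R)).
Qed.

(** Perturb [q_2], then [q_8], then [q_10]: the three conditions are on functions
    that are affine in these coordinates, with leading coefficients that are nonzero
    by the previous steps. *)
Lemma Gen_dense : dense Gen.
Proof.
move=> O [a Oa] oO.
pose t0 := ext a.
have Ot0 : O (trunc 10 t0) by rewrite trunc_ext.
have [x Ox /=] := near_neq_affine 0 (oner_neq0 R) (nbhs_upd 6 oO Ot0).
rewrite mul1r addr0 => x0; pose t1 := upd t0 6 x.
have q1 : jq 2 t1 != 0 by [].
have A1 : 196%N%:R * jq 2 t1 ^+ 5 != 0 :> R.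
  by rewrite mulf_neq0 ?expf_neq0 // pnatr_eq0.
have [y Oy /=] := near_neq_affine (R8 (upd t1 12 0)) A1 (nbhs_upd 12 oO Ox).
rewrite -R8_affine; set t2 := upd t1 12 y => r2.
have A2 : top10 t2 != 0.
  by rewrite /top10 !mulf_neq0 ?expf_neq0 // pnatr_eq0.
have [z Oz /=] := near_neq_affine (low10 t2) A2 (nbhs_upd 14 oO Oy).
rewrite -[z in _ * z]/(upd t2 14 z 14).
rewrite -(jet_function_upd z top10_order I (isT : (14 <= 14)%N)).
rewrite -(jet_function_upd z low10_order I (isT : (14 <= 14)%N)) -R10_affine => r3.
exists (trunc 10 (upd t2 14 z)); split=> //; apply/GenP; split=> //.
Qed.

End Iterates.

(** * The iterates as local coordinates *)

Section Coordinates.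
Variable R : realType.
Implicit Types (t s : jet R) (f : jet R -> R).
Local Notation Reg k := (@Reg R k).
Local Notation iterate := (@iterate R).

Lemma upd_upd t j x y : upd (upd t j x) j y = upd t j y.
Proof. by apply/funext => i; rewrite !updE; case: eqP. Qed.

Lemma jsm_upd t j f : jsm t f -> forall l, jsm t (fun t => upd t j (f t) l).
Proof.
move=> Hf l; case: (eqVneq l j) => [->|lj].
  rewrite (_ : (fun t => _) = f) //.
  by apply/funext => s; rewrite updE eqxx.
rewrite (_ : (fun t => _) = fun t => t l); first exact: jsm_coord.
by apply/funext => s; rewrite updE (negbTE lj).
Qed.

Lemma iterate_upd i t j x : regular t -> (15 + i <= j)%N ->
  iterate i (upd t j x) = iterate i t.
Proof. by move=> rt; exact: jet_function_upd _ (iterate_order R i) (trunc_Reg _ rt). Qed.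

Lemma jsm_sub t f g : jsm t f -> jsm t g -> jsm t (fun t => f t - g t).
Proof. by move=> sf sg; apply: jsmD => //; exact: jsmN. Qed.

(** [sigma] is a local inverse, in the highest coordinate, of the substitution of
    [iterate n] for that coordinate. *)
Definition solves n t (sigma : jet R -> R) :=
  let w t := upd t (14 + n) (iterate n t) in
  [/\ jnbhs (w t) (fun s => jsm s sigma),
      jnbhs (w t) (fun s => iterate n (upd s (14 + n) (sigma s)) = s (14 + n)%N) &
      jnbhs t (fun s => sigma (w s) = s (14 + n)%N)].

(** A later iterate is affine in its highest coordinate. *)
Lemma solve_iterateS n t : generic t -> exists sigma, solves n.+1 t sigma.
Proof.
move=> gt.
pose A s := box_coef s * pd (4 + (10 + n)) (iterate n) s.
pose B s := box_coef s * lower_Dx (10 + n) (iterate n) s.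
have oU : open (Reg (10 + n)) by exact: Reg_open.
have oA : jet_function (Reg (10 + n)) A.
  apply: jet_functionM; first exact: box_order_Reg.
  exact/jet_function_pd/iterate_order.
have oB : jet_function (Reg (10 + n)) B.
  apply: jet_functionM; first exact: box_order_Reg.
  exact/jet_function_lower_Dx/iterate_order.
have AB s : regular s -> iterate n.+1 s = A s * s (14 + n.+1)%N + B s.
  move=> rs; rewrite iterateS (Dx_affine (iterate_order R n) (trunc_Reg _ rs)).
  have -> : (14 + n.+1 = 5 + (10 + n))%N by rewrite !addnS.
  rewrite /A /B; ring.
have A0 s : generic s -> A s != 0.
  by move=> gs; rewrite mulf_neq0 ?box_neq0 //; exact: (pd_top_iterate n gs).
have jl : (5 + (10 + n) <= 14 + n.+1)%N by rewrite !addnS.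
have Au s x : regular s -> A (upd s (14 + n.+1) x) = A s.
  by move=> rs; apply: jet_function_upd _ oA (trunc_Reg _ rs) jl.
have Bu s x : regular s -> B (upd s (14 + n.+1) x) = B s.
  by move=> rs; apply: jet_function_upd _ oB (trunc_Reg _ rs) jl.
exists (fun s => (s (14 + n.+1)%N - B s) * (A s)^-1).
pose w s := upd s (14 + n.+1) (iterate n.+1 s).
have gw : generic (w t) by apply/generic_upd => //; rewrite addnS leq_addr.
split.
- apply: filterS (generic_near gw) => s gs.
  have rs := generic_regular gs.
  apply: jsmM; last by apply: jsmV; [exact: A0|exact: jsm_jet_function oA (trunc_Reg _ rs)].
  apply: jsm_sub; first exact: jsm_coord.
  exact: jsm_jet_function oB (trunc_Reg _ rs).
- apply: filterS (generic_near gw) => s gs.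
  have rs := generic_regular gs.
  rewrite AB; last by apply/regular_upd => //; rewrite addnS.
  by rewrite Au // Bu // updE eqxx mulrC mulfVK ?subrK ?A0.
- apply: filterS (generic_near gt) => s gs.
  have rs := generic_regular gs.
  by rewrite Au // Bu // updE eqxx AB // addrK mulrC mulKf ?A0.
Qed.

Lemma abs_powR_cube (x : R) : (`|x| ^+ 3) `^ (3^-1) = `|x|.
Proof.
rewrite -powR_mulrn ?normr_ge0 // -powRrM divff ?pnatr_eq0 // powRr1 //.
Qed.

Lemma cube_abs_powR (x : R) : (`|x| `^ (3^-1)) ^+ 3 = `|x|.
Proof.
by rewrite -powR_mulrn ?powR_ge0 // -powRrM mulVf ?pnatr_eq0 // powRr1 // normr_ge0.
Qed.

(** [I10 = y] means [R10^3 = y R8^7], where [R10] is affine in [q_10].  The real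
    cube root is smooth away from zero; its sign is that of [R10] at [t]. *)
Lemma solve_I10 t : generic t -> exists sigma, solves 0 t sigma.
Proof.
move=> gt; have [q2 r8 r10] := gt.
pose e := Num.sg (R10 t).
have e2 : e * e = 1 by rewrite -expr2 sqr_sg r10.
have abs_e x : 0 < e * x -> `|x| = e * x.
  move=> ex; rewrite -[x in LHS]mul1r -e2 -mulrA normrM (gtr0_norm ex).
  by rewrite normr_sg r10 mul1r.
pose C s : R := s 14%N * R8 s ^+ 7.
pose sigma s := (e * `|C s| `^ (3^-1) - low10 s) * (top10 s)^-1.
exists sigma; pose w s := upd s (14 + 0) (iterate 0 s).
have R8w s x : R8 (upd s (14 + 0) x) = R8 s by exact: jet_function_upd _ (@R8_order R) I _.
have tw s x : top10 (upd s (14 + 0) x) = top10 s by exact: jet_function_upd _ (@top10_order R) I _.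
have lw s x : low10 (upd s (14 + 0) x) = low10 s by exact: jet_function_upd _ (@low10_order R) I _.
have Cw s : regular s -> C (w s) = R10 s ^+ 3.
  by move=> rs; rewrite /C /w R8w updE /= divfK // expf_neq0 //; exact: rs.
have Cwt : 0 < e * C (w t).
  rewrite Cw; last exact: r8.
  by rewrite exprS mulrA /e -normrEsg mulr_gt0 ?normr_gt0 // exprn_even_gt0.
have sC s : jsm s C by apply: jsmM; [exact: jsm_coord|apply: jsmX; exact: jsm_R8].
have top0 : top10 (w t) != 0 by rewrite tw top10_neq0.
have st s : jsm s (@top10 R) := jsm_jet_function (@top10_order R) I.
have sl s : jsm s (@low10 R) := jsm_jet_function (@low10_order R) I.
have R8wt : R8 (w t) != 0 by rewrite R8w.
have nw : jnbhs (w t) (fun s => [/\ 0 < e * C s, top10 s != 0 & R8 s != 0]).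
  have h1 := jsm_neq0 (st _) top0; have h2 := jsm_neq0 (jsm_R8 _) R8wt.
  have h3 : jnbhs (w t) (fun s => 0 < e * C s).
    apply: (jsm_preimage (O := [set x | 0 < x])); [|exact: open_gt|exact: Cwt].
    by apply: jsmM => //; exact: jsm_cst.
  by apply: filterS (filterI h3 (filterI h1 h2)) => s [? []].
split.
- apply: filterS nw => s [c0 t0 _].
  have C0 : C s != 0 by apply: contraTneq c0 => ->; rewrite mulr0 ltxx.
  apply: jsmM; last exact: jsmV.
  apply: jsm_sub => //; apply: jsmM; first exact: jsm_cst.
  exact: jsm_abs_powR.
- apply: filterS nw => s [c0 t0 r0].
  have -> : iterate 0 (upd s (14 + 0) (sigma s)) =
      R10 (upd s (14 + 0) (sigma s)) ^+ 3 / R8 (upd s (14 + 0) (sigma s)) ^+ 7 by [].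
  rewrite R8w R10_affine tw lw updE eqxx /sigma.
  rewrite [top10 s * _]mulrC mulfVK // subrK exprMn cube_abs_powR.
  have -> : e ^+ 3 * `|C s| = C s.
    by rewrite abs_e // exprS expr2 e2 mulr1 mulrA e2 mul1r.
  by rewrite /C mulfK // expf_neq0.
- have sR := jsm_R10 t.
  have h : jnbhs t (fun s => 0 < e * R10 s).
    apply: (jsm_preimage (O := [set x | 0 < x])); [|exact: open_gt|].
      by apply: jsmM => //; exact: jsm_cst.
    by rewrite /= /e -normrEsg normr_gt0.
  apply: filterS (filterI (generic_near gt) h) => s [gs es].
  rewrite /sigma Cw; last exact: generic_regular.
  rewrite tw lw normrX abs_powR_cube.
  have -> : e * `|R10 s| = R10 s by rewrite abs_e // mulrA e2 mul1r.
  by rewrite R10_affine addrK mulrC mulKf ?top10_neq0.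
Qed.

(** The new coordinates: the first [n] iterates replace [q_10, .., q_(9+n)]. *)
Definition coords n t : jet R := fun l =>
  if (14 <= l < 14 + n)%N then iterate (l - 14) t else t l.

Lemma coords0 t : coords 0 t = t.
Proof.
apply/funext => l; rewrite /coords addn0.
by case: ltnP => // l14; rewrite ltnNge l14.
Qed.

(** The iterate of index [n] is substituted first, as the ones of smaller index do
    not depend on the coordinate that it replaces. *)
Lemma coordsS n t : regular t ->
  coords n.+1 t = coords n (upd t (14 + n) (iterate n t)).
Proof.
move=> rt; apply/funext => l; rewrite /coords updE addnS ltnS.
case: (ltngtP l (14 + n)) => [ln|ln|->].
- case: (leqP 14 l) => //= l14; rewrite iterate_upd //.
  by rewrite addSn subnKC.
- by rewrite andbF.
- by rewrite leq_addr /= addKn ?andbF.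
Qed.

Lemma solve_iterate n t : generic t -> exists sigma, solves n t sigma.
Proof. by case: n => [|n]; [exact: solve_I10|exact: solve_iterateS]. Qed.

(** One coordinate is solved for at a time.  In the inductive step the base jet moves
    to the jet [w t] in which the coordinate of highest order is already replaced.
    When [I10] itself is substituted this jet need not be generic, because [generic]
    involves [q_10]; this is why the case [n = 0] is stated for all jets. *)
Lemma local_inverse n t : n = 0%N \/ generic t -> exists Psi : jet R -> jet R,
  jnbhs (coords n t) (fun s => (forall l, jsm s (fun s => Psi s l)) /\
    coords n (Psi s) = s) /\
  jnbhs t (fun s => Psi (coords n s) = s).
Proof.
elim: n t => [|n IH] t H.
  exists id; split; apply: filterE => s; rewrite coords0 //; split=> //.
  exact: jsm_coord.
have {H} gt : generic t by case: H.
have [sigma [ss s1 s2]] := solve_iterate n gt.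
pose w s := upd s (14 + n) (iterate n s).
have [Psi [P1 P2]] : exists Psi : jet R -> jet R,
  jnbhs (coords n (w t)) (fun s => (forall l, jsm s (fun s => Psi s l)) /\
    coords n (Psi s) = s) /\
  jnbhs (w t) (fun s => Psi (coords n s) = s).
  apply: IH; case: n {sigma ss s1 s2} @w => [|n] w; [by left|right].
  by apply/generic_upd.
have rt := generic_regular gt.
have Pt : Psi (coords n (w t)) = w t := jnbhs_at P2.
have sP : forall l, jsm (coords n (w t)) (fun s => Psi s l).
  by have [] := jnbhs_at P1.
exists (fun s => upd (Psi s) (14 + n) (sigma (Psi s))).
rewrite coordsS // -/(w t); split.
  have rw : regular (w t) by apply/regular_upd.
  rewrite -[upd t _ _]/(w t) -Pt in ss s1 rw.
  have h1 := jnbhs_preimage sP ss.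
  have h2 := jnbhs_preimage sP s1.
  have h3 := jnbhs_preimage sP (regular_near rw).
  apply: filterS (filterI P1 (filterI h1 (filterI h2 h3))) => s.
  move=> [[sPs cs] [sss [es rs]]]; split.
    move=> l; have [sc _] := chain_rule sPs sss.
    case: (eqVneq l (14 + n)%N) => [->|/negbTE lj].
      by rewrite (_ : (fun s => _) = fun s => sigma (Psi s)) //; apply/funext => u; rewrite updE eqxx.
    by rewrite (_ : (fun s => _) = fun s => Psi s l) //; apply/funext => u; rewrite updE lj.
  rewrite coordsS; last by apply/regular_upd.
  by rewrite es upd_upd upd_id.
have sw l : jsm t (fun s => w s l) by apply: jsm_upd; exact: jsm_iterate.
have h := jnbhs_preimage sw P2.
apply: filterS (filterI h (filterI s2 (regular_near rt))) => s [es [e2 rs]].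
by rewrite coordsS // es e2 upd_upd upd_id.
Qed.

Lemma jsm_coords n t l : regular t -> jsm t (fun s => coords n s l).
Proof.
by move=> rt; rewrite /coords; case: (14 <= l < 14 + n)%N; [exact: jsm_iterate|exact: jsm_coord].
Qed.

(** Some prolonged symmetry has the same first 14 components as [Y].  Both kill the
    iterates, which depend on their highest coordinates, so all the components that
    matter for [I] agree. *)
Lemma lie_invariant_eq0 n k (U : set (E R k)) I t (Y : nat -> R) :
  diff_invariant U I -> U (trunc k t) -> generic t -> (k <= 9 + n)%N ->
  (forall j, (j < n)%N -> lie (fun l _ => Y l) (iterate j) t = 0) ->
  lie (fun l _ => Y l) I t = 0.
Proof.
move=> [HI inv] Ut gt kn HY; have [q2 r8 _] := gt.
have rt := generic_regular gt.
have [v symv ev] := symmetry_through Y q2 r8.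
suff e l : (l < 14 + n)%N -> prolong v l t = Y l.
  rewrite -(inv v symv t Ut) !(lie_jet _ HI Ut (leqnn _)).
  apply: eq_bigr => l _; rewrite e //.
  by apply: leq_trans (ltn_ord l) _; rewrite -[(14 + n)%N]/(5 + (9 + n))%N leq_add2l.
elim/ltn_ind: l => l IH ln; case: (ltnP l 14) => [/ev //|l14].
have lE : l = (14 + (l - 14))%N by rewrite subnKC.
have jn : (l - 14 < n)%N by rewrite ltn_subLR.
rewrite [in LHS]lE [in RHS]lE.
apply: (lie_eq_top (Y := fun l _ => Y l) (iterate_order R (l - 14)) (trunc_Reg _ rt)).
- move=> j jl; apply: IH; first by rewrite lE.
  by apply: leq_trans (ltnW ln); rewrite [in leqRHS]lE.
- by rewrite (iterate_invariant _ symv rt) HY.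
- exact: pd_top_iterate.
Qed.

(** In the new coordinates the invariant depends on the iterates only: the other
    coordinate fields kill all the iterates. *)
Lemma pd_invariant_inverse n k (U : set (E R k)) I (Psi : jet R -> jet R) s i :
  diff_invariant U I -> (k <= 9 + n)%N ->
  jnbhs s (fun s => [/\ forall l, jsm s (fun s => Psi s l), coords n (Psi s) = s,
    U (trunc k (Psi s)) & generic (Psi s)]) ->
  ~~ (14 <= i < 14 + n)%N ->
  pd i (fun s => I (Psi s)) s = 0.
Proof.
move=> HI kn Hs ni; have [sP _ Us gs] := jnbhs_at Hs.
have sI : jsm (Psi s) I by case: HI => HI _; exact: jsm_jet_function HI Us.
have [_ ->] := chain_rule sP sI.
apply: (lie_invariant_eq0 HI Us gs kn) => j jn.
have [_ <-] := chain_rule sP (jsm_iterate j (generic_regular gs)).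
rewrite (@pd_near_eq _ s _ (fun s => s (14 + j)%N)).
  rewrite pd_coord; case: eqP => // e; move: ni; rewrite -e leq_addr ltn_add2l.
  by rewrite jn.
apply: filterS Hs => u [_ eu _ _]; rewrite -[in RHS]eu /coords leq_addr.
by rewrite ltn_add2l jn /= addKn.
Qed.

End Coordinates.

(** * Generation *)

Section Generation.
Variable R : realType.
Implicit Types (t s : jet R) (f : jet R -> R).

Lemma derive0_segment (phi : R -> R) (a b : R) : a <= b ->
  (forall x, a <= x <= b -> is_derive x 1 phi 0) -> phi a = phi b.
Proof.
move=> ab H.
have [||c _ e] := @MVT_segment _ phi (fun=> 0) _ _ ab.
- by move=> x; rewrite in_itv /= => /andP[/ltW ax /ltW xb]; apply: H; rewrite ax.
- apply: continuous_in_subspaceT => x; rewrite inE /= in_itv /= => /H [d _].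
  exact/differentiable_continuous/derivable1_diffP.
by move: e; rewrite mul0r => /eqP; rewrite subr_eq0 => /eqP.
Qed.

Lemma derive0_ball (phi : R -> R) (c r y : R) :
  (forall x, `|c - x| < r -> is_derive x 1 phi 0) -> `|c - y| < r ->
  phi y = phi c.
Proof.
move=> H cy; have r0 : 0 < r := le_lt_trans (normr_ge0 _) cy.
move: cy; rewrite ltr_norml => /andP[c1 c2].
have [yc|cy] := leP y c.
  apply: derive0_segment => // x /andP[x1 x2]; apply: H.
  by rewrite ltr_norml; apply/andP; split; lra.
apply/esym/derive0_segment; first exact: ltW.
move=> x /andP[x1 x2]; apply: H.
by rewrite ltr_norml; apply/andP; split; lra.
Qed.

(** The coordinates outside [A] are moved one at a time to their values at [s0],
    inside a cube on which the derivatives of [J] in these coordinates vanish. *)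
Lemma near_independent (A : pred nat) J s0 : jsm s0 J ->
  jnbhs s0 (fun s => forall i, ~~ A i -> pd i J s = 0) ->
  jnbhs s0 (fun s => J s = J (fun l => if A l then s l else s0 l)).
Proof.
move=> sJ dJ.
have [//|m [U [_ oU Us0 U0 /(_ 0%N isT) HJ]]] := @jsm_common R 1 0 (fun=> J) s0 _ _ dJ.
have /nbhs_ballP[r /= r0 rU] : nbhs (trunc m s0) U by exact: open_nbhs_nbhs.
pose B s := forall l, (l < 5 + m)%N -> `|s0 l - s l| < r.
have BU s : B s -> U (trunc m s).
  by move=> Bs; apply: rU; split=> // i j; rewrite !mxE; exact: Bs.
have nB : jnbhs s0 B.
  exists m, (interior (ball (trunc m s0) r)); split; first exact: open_interior.
    by apply: nbhsx_ballx.
  move=> s /interior_subset [_ sb] l lm; have := sb 0 (Ordinal lm).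
  by rewrite !mxE.
apply: filterS nB => s Bs.
pose mix j : jet R := fun l => if A l || (j <= l)%N then s l else s0 l.
have step j : (j < 5 + m)%N -> J (mix j) = J (mix j.+1).
  move=> jm.
  have [Aj|nA] := boolP (A j).
    congr J; apply/funext => l; rewrite /mix leq_eqVlt.
    by case: eqP => [<-|//]; rewrite Aj.
  have -> : mix j = upd (mix j) j (s j).
    by rewrite -[X in upd _ _ X](_ : mix j j = _) ?upd_id // /mix leqnn orbT.
  have -> : mix j.+1 = upd (mix j) j (s0 j).
    apply/funext => l; rewrite updE /mix; case: eqP => [->|/eqP lj].
      by rewrite (negbTE nA) ltnn.
    by rewrite [in RHS]leq_eqVlt eq_sym (negbTE lj).
  apply: (@derive0_ball (fun x => J (upd (mix j) j x)) _ r); last exact: Bs.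
  move=> x xr; have Bx : B (upd (mix j) j x).
    move=> l lm; rewrite updE; case: eqP => [->//|_]; rewrite /mix.
    by case: ifP => _; [exact: Bs|rewrite subrr normr0].
  have := pd_is_derive j (jsm_jet_function HJ (BU _ Bx)).
  rewrite (U0 _ (BU _ Bx) _ nA) updE eqxx.
  by under eq_fun do rewrite upd_upd.
have -> : J s = J (mix 0%N) by congr J; apply/funext => l; rewrite /mix orbT.
have chain j : (j <= 5 + m)%N -> J (mix 0%N) = J (mix j).
  elim: j => [_|j IH jm]; first reflexivity.
  by rewrite -(step _ jm); exact/IH/ltnW.
rewrite (chain _ (leqnn _)); apply: (jet_function_dep HJ).
  apply: BU => l lm; rewrite /mix.
  by case: ifP => _; [exact: Bs|rewrite subrr normr0].
by apply/rowP => l; rewrite !mxE /mix leqNgt ltn_ord orbF.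
Qed.

(** For an invariant of order at most [9 + n] the function [F] is the invariant in
    the new coordinates, with the coordinates other than the iterates fixed at their
    values at [t]. *)
Lemma generation :
  Lie_Tresse_generated (@regular R) (@I10 R) (@box_coef R).
Proof.
exists 10, (@Gen R); split; [exact: Gen_open|exact: Gen_dense|].
move=> k U I t HI Ut /GenP gt.
(* The first [14 + n] coordinates contain those of order at most [k]. *)
pose n := k; have kn : (k <= 9 + n)%N by exact: leq_addl.
have rt := generic_regular gt.
have [Psi [P1 P2]] := @local_inverse R n t (or_intror gt).
set s0 := coords n t in P1.
have Pt : Psi s0 = t := jnbhs_at P2.
have sP : forall l, jsm s0 (fun s => Psi s l) by have [] := jnbhs_at P1.
have [oU _] : jet_function U I by case: HI.
have good : jnbhs s0 (fun s => [/\ forall l, jsm s (fun s => Psi s l),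
    coords n (Psi s) = s, U (trunc k (Psi s)) & generic (Psi s)]).
  have nt : jnbhs (Psi s0) (fun t => U (trunc k t) /\ generic t).
    rewrite Pt; apply: filterI; last exact: generic_near.
    exact: jet_function_jnbhs.
  by apply: filterS (filterI P1 (jnbhs_preimage sP nt)) => s [[? ?] [? ?]].
pose J s := I (Psi s).
have sI : jsm (Psi s0) I.
  by rewrite Pt; case: HI => HI _; exact: jsm_jet_function HI Ut.
have [sJ _] := chain_rule sP sI.
pose A i := (14 <= i < 14 + n)%N.
have JA : jnbhs s0 (fun s => J s = J (fun l => if A l then s l else s0 l)).
  apply: near_independent => //; apply: filterS (jnbhs_nbhs good) => s gs i nA.
  exact: (pd_invariant_inverse HI kn gs nA).
have [m [W0 [HJ W0s]]] := sJ.
have oW0 : open W0 by case: HJ.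
pose c (w : 'rV[R]_n) (l : nat) : R := 
  if (14 <= l)%N then
    if insub (l - 14)%N is Some i then w 0 i else s0 l
  else s0 l.
pose theta (w : 'rV[R]_n) : E R m := \row_l c w l.
have smooth_c l : smooth setT (c ^~ l).
  apply/smooth_Ck => N; rewrite /c; case: (14 <= l)%N; last exact: Ck_cst.
  by case: insub => [i|]; [exact: Ck_coord|exact: Ck_cst].
have oW : open (theta @^-1` W0).
  apply: open_comp => // w _; apply: differentiable_continuous.
  by apply: differentiable_row => l; exact: smooth_differentiable (smooth_c l) _.
have [sg gE] := jet_function_ext HJ.
pose mix s : jet R := fun l => if A l then s l else s0 l.
have mixE s : trunc m (mix (coords n s)) = theta (iterates (@box_coef R) (@I10 R) n s).
  apply/rowP => l; rewrite !mxE /mix /c /A.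
  case: leqP => //= l14.
  case: insubP => [i|]; rewrite ltn_subLR //; last by move=> /negbTE ->.
  by move=> il ei; rewrite il mxE ei /coords l14 il.
have mix0 : mix s0 = s0 by apply/funext => l; rewrite /mix if_same.
have nW : jnbhs s0 (fun s => W0 (trunc m (mix s))).
  apply: (@jnbhs_preimage _ mix s0 (fun s => W0 (trunc m s))) => [l|]; last by rewrite mix0; exact: jet_function_jnbhs.
  by rewrite /mix; case: (A l); [exact: jsm_coord|exact: jsm_cst].
have sc l : jsm t (fun s => coords n s l) by exact: jsm_coords.
have n1 := jnbhs_preimage sc JA.
have n2 := jnbhs_preimage sc nW.
have n3 : jnbhs t (fun t => U (trunc k t)) := jet_function_jnbhs oU Ut.
have [l [V [oV Vt VP]]] := filterI n1 (filterI n2 (filterI n3 (filterI P2 (regular_near rt)))).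
exists n, l, V, (theta @^-1` W0), (fun w => J (ext (theta w))).
split=> //.
  apply/smooth_Ck => N; apply: (@Ck_comp _ _ _ N _ W0 (fun a => J (ext a)) (fun j w => c w j)) => //.
  - exact: smoothCk.
  - by move=> j; apply: smoothCk; exact: smooth_sub (smooth_c j).
move=> t' /VP [e [w' [u' [p' r']]]]; split=> //.
  by rewrite /= -mixE.
rewrite -mixE; transitivity (J (mix (coords n t'))); last exact: gE.
by rewrite -[RHS]e /J p'.
Qed.

End Generation.

Theorem theorem1 (R : realType) :
  [/\ diff_invariant (trunc 10 @` @regular R) (@I10 R),
      invariant_derivation (trunc 8 @` @regular R) (@box_coef R) &
      Lie_Tresse_generated (@regular R) (@I10 R) (@box_coef R)].
Proof.
split; [exact: I10_invariant|exact: box_invariant|exact: generation].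
Qed.
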